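(* Let $H$ be a pointed Majid algebra over a field $k$ and $\operatorname{gr}H$ its coradically graded Majid algebra. Then there is a unique Hopf quiver $Q(H)$ and a graded Majid algebra structure on the path coalgebra $kQ(H)$ such that $\operatorname{gr}H$ embeds into $kQ(H)$ as a sub Majid algebra containing $kQ(H)_0\oplus kQ(H)_1$ (the span of vertices and arrows).
   Context: A Majid algebra (dual quasi-Hopf algebra) over $k$ is a coalgebra $(H,\Delta,\varepsilon)$ (Sweedler notation $\Delta(a)=a_1\otimes a_2$) together with coalgebra maps $\mathrm{M}:H\otimes H\to H$, $a\otimes b\mapsto ab$, and $\mu:k\to H$, $\lambda\mapsto\lambda 1_H$, a convolution-invertible linear map $\Phi:H^{\otimes 3}\to k$, a coalgebra antimorphism $\mathcal S:H\to H$ and linear maps $\alpha,\beta:H\to k$ such that for all $a,b,c,d\in H$: (i) $a_1(b_1c_1)\Phi(a_2,b_2,c_2)=\Phi(a_1,b_1,c_1)(a_2b_2)c_2$; (ii) $1_Ha=a=a1_H$; (iii) $\Phi(a_1,b_1,c_1d_1)\Phi(a_2b_2,c_2,d_2)=\Phi(b_1,c_1,d_1)\Phi(a_1,b_2c_2,d_2)\Phi(a_2,b_3,c_3)$; (iv) $\Phi(a,1_H,b)=\varepsilon(a)\varepsilon(b)$; (v) $\mathcal S(a_1)\alpha(a_2)a_3=\alpha(a)1_H$ and $a_1\beta(a_2)\mathcal S(a_3)=\beta(a)1_H$; (vi) $\Phi(a_1,\mathcal S(a_3),a_5)\beta(a_2)\alpha(a_4)=\Phi^{-1}(\mathcal S(a_1),a_3,\mathcal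 S(a_5))\alpha(a_2)\beta(a_4)=\varepsilon(a)$. $H$ is pointed if all simple subcoalgebras are one-dimensional. With coradical filtration $H_0\subseteq H_1\subseteq\cdots$, $\operatorname{gr}H=H_0\oplus H_1/H_0\oplus H_2/H_1\oplus\cdots$ is the associated graded coalgebra, with the Majid algebra structure induced from $H$: product induced by $H_iH_j\subseteq H_{i+j}$, and $\operatorname{gr}\Phi,\operatorname{gr}\alpha,\operatorname{gr}\beta$ equal to $\Phi,\alpha,\beta$ on $H_0$ and zero whenever some homogeneous argument has positive degree; $H_0=kG(H)$ with $G(H)$ the group of group-likes. The quiver $Q(C)$ of a pointed coalgebra $C$ has vertex set the group-likes $G(C)$ and, for $g,h\in G(C)$, a number of arrows from $h$ to $g$ equal to $\dim_k P_{g,h}(C)/k(g-h)$, where $P_{g,h}(C)=\{x\in C:\Delta(x)=g\otimes x+x\otimes h\}$. Path coalgebra $kQ$ (basis the paths; vertices group-like; $\Delta(a_n\cdots a_1)=a_n\cdots a_1\otimes s(a_1)+\sum_{i=1}^{n-1}a_n\cdots a_{i+1}\otimes a_i\cdots a_1+t(a_n)\otimes a_n\cdots a_1$), graded by length with $kQ_n$ spanned by paths of length $n$. A graded Majid algebra structure on $kQ$ is a Majid algebra structure on the coalgebra $kQ$ with $\mathrm{M}(kQ_i\otimes kQ_j)\subseteq kQ_{i+j}$, $1\in kQ_0$, $\mathcal S(kQ_n)\subseteq kQ_n$, and $\Phi,\alpha,\beta$ vanishing whenever some homogeneous argument has positive degree. A Hopf quiver is a quiver of the form $Q(G,R)$: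 for a group $G$ and ramification datum $R=\sum_C R_CC$ ($R_C\in\mathbb N$, $C$ running over conjugacy classes), vertex set $G$ and $R_C$ arrows from $x$ to $cx$ for each $x\in G$, $c\in C$.
   Formalization: The ramification numbers R_C of a Hopf quiver may be arbitrary cardinals instead of natural numbers, since P_{g,h}/k(g-h) can be infinite-dimensional; the embedding of gr H is taken to be graded, also in the uniqueness claim. *)

(* Defs.v *)
From HB Require Import structures.
From mathcomp Require Import all_boot all_algebra.
From mathcomp Require Import monalg.

Set Implicit Arguments.
Unset Strict Implicit.
Unset Printing Implicit Defensive.

Import GRing.Theory.
Local Open Scope ring_scope.

(* Linear algebra over a field k, tensors encoded by finite lists of pairs   *)
(* (Sweedler-style representatives).                                          *)
Section Lin.
Variables (k : fieldType) (V W : lmodType k).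

Definition islinf (f : V -> k) : Prop :=
  forall (a : k) (x y : V), f (a *: x + y) = a * f x + f y.

Definition islin (f : V -> W) : Prop :=
  forall (a : k) (x y : V), f (a *: x + y) = a *: f x + f y.

Definition islin_on (P : V -> Prop) (f : V -> W) : Prop :=
  forall (a : k) (x y : V), P x -> P y -> f (a *: x + y) = a *: f x + f y.

Definition isbilin (m : V -> V -> W) : Prop :=
  (forall y, islin (fun x => m x y)) /\ (forall x, islin (fun y => m x y)).

Definition istrilinf (p : V -> V -> V -> k) : Prop :=
  [/\ forall y z, islinf (fun x => p x y z),
      forall x z, islinf (fun y => p x y z) &
      forall x y, islinf (fun z => p x y z)].

(* Equality of the tensors  sum_i s_i.1 (x) s_i.2  and  sum_j t_j.1 (x) t_j.2
   in V (x) V, detected by all pairs of linear functionals (this is faithful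
   over a field: V (x) V embeds into (V^* (x) V^* )^* ). *)
Definition teq2 (s t : seq (V * V)) : Prop :=
  forall f g : V -> k, islinf f -> islinf g ->
    \sum_(p <- s) f p.1 * g p.2 = \sum_(p <- t) f p.1 * g p.2.

Definition teq3 (s t : seq (V * V * V)) : Prop :=
  forall f g h : V -> k, islinf f -> islinf g -> islinf h ->
    \sum_(p <- s) f p.1.1 * g p.1.2 * h p.2 =
    \sum_(p <- t) f p.1.1 * g p.1.2 * h p.2.

Definition subspace (P : V -> Prop) : Prop :=
  P 0 /\ forall (a : k) x y, P x -> P y -> P (a *: x + y).

Definition tens_in (A B : V -> Prop) (t : seq (V * V)) : Prop :=
  exists s : seq (V * V), (forall p, p \in s -> A p.1 /\ B p.2) /\ teq2 t s.

Definition tens_sum (A B A' B' : V -> Prop) (t : seq (V * V)) : Prop :=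
  exists s1 s2 : seq (V * V),
    [/\ forall p, p \in s1 -> A p.1 /\ B p.2,
        forall p, p \in s2 -> A' p.1 /\ B' p.2 &
        teq2 t (s1 ++ s2)].

End Lin.

Section Majid.
Variables (k : fieldType) (V : lmodType k).
Variable (cop : V -> seq (V * V)).
Variable (eps : V -> k).

(* iterated Sweedler coproduct: swe n a lists the (n+1)-tuples
   (a_1, ..., a_(n+1)) of Delta^n(a), Delta being applied to the first factor *)
Fixpoint swe (n : nat) (a : V) : seq (seq V) :=
  match n with
  | 0 => [:: [:: a]]
  | n'.+1 => flatten [seq [seq p.1 :: p.2 :: behead l | p <- cop (head 0 l)]
                     | l <- swe n' a]
  end.

Definition is_coalgebra : Prop :=
  [/\ forall (a : k) x y,
        teq2 (cop (a *: x + y)) ([seq (a *: p.1, p.2) | p <- cop x] ++ cop y),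
      islinf eps,
      forall a, teq3 [seq (p.1, q.1, q.2) | p <- cop a, q <- cop p.2]
                     [seq (q.1, q.2, p.2) | p <- cop a, q <- cop p.1] &
      forall a, \sum_(p <- cop a) eps p.1 *: p.2 = a /\
                \sum_(p <- cop a) eps p.2 *: p.1 = a].

Variables (mul : V -> V -> V) (one : V).
Variables (phi phiinv : V -> V -> V -> k) (S : V -> V) (alpha beta : V -> k).

Definition majid_structure_maps : Prop :=
  [/\
      [/\ isbilin mul,
          forall a b, teq2 (cop (mul a b))
                           [seq (mul p.1 q.1, mul p.2 q.2) | p <- cop a, q <- cop b] &
          forall a b, eps (mul a b) = eps a * eps b],
      teq2 (cop one) [:: (one, one)] /\ eps one = 1,
      [/\ istrilinf phi, istrilinf phiinv,
          forall a b c,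
            \sum_(p <- cop a) \sum_(q <- cop b) \sum_(r <- cop c)
               phi p.1 q.1 r.1 * phiinv p.2 q.2 r.2 = eps a * eps b * eps c &
          forall a b c,
            \sum_(p <- cop a) \sum_(q <- cop b) \sum_(r <- cop c)
               phiinv p.1 q.1 r.1 * phi p.2 q.2 r.2 = eps a * eps b * eps c] &
      [/\ islin S,
          forall a, teq2 (cop (S a)) [seq (S p.2, S p.1) | p <- cop a],
          forall a, eps (S a) = eps a,
          islinf alpha & islinf beta]].

Definition majid_axioms : Prop :=
  [/\
      forall a b c,
        \sum_(p <- cop a) \sum_(q <- cop b) \sum_(r <- cop c)
            phi p.2 q.2 r.2 *: mul p.1 (mul q.1 r.1) =
        \sum_(p <- cop a) \sum_(q <- cop b) \sum_(r <- cop c)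
            phi p.1 q.1 r.1 *: mul (mul p.2 q.2) r.2,
      forall a, mul one a = a /\ mul a one = a,
      forall a b c d,
        \sum_(p <- cop a) \sum_(q <- cop b) \sum_(r <- cop c) \sum_(u <- cop d)
            phi p.1 q.1 (mul r.1 u.1) * phi (mul p.2 q.2) r.2 u.2 =
        \sum_(p <- cop a) \sum_(lb <- swe 2 b) \sum_(lc <- swe 2 c)
          \sum_(u <- cop d)
            phi lb`_0 lc`_0 u.1 * phi p.1 (mul lb`_1 lc`_1) u.2 *
            phi p.2 lb`_2 lc`_2,
      forall a b, phi a one b = eps a * eps b &
      (forall a, \sum_(l <- swe 2 a) alpha l`_1 *: mul (S l`_0) l`_2 = alpha a *: one
             /\ \sum_(l <- swe 2 a) beta l`_1 *: mul l`_0 (S l`_2) = beta a *: one) /\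
      (forall a, \sum_(l <- swe 4 a)
                   phi l`_0 (S l`_2) l`_4 * beta l`_1 * alpha l`_3 = eps a
             /\ \sum_(l <- swe 4 a)
                   phiinv (S l`_0) l`_2 (S l`_4) * alpha l`_1 * beta l`_3 = eps a)].

Definition is_majid : Prop :=
  [/\ is_coalgebra, majid_structure_maps & majid_axioms].

End Majid.

Section Corad.
Variables (k : fieldType) (V : lmodType k) (cop : V -> seq (V * V)).

Definition grouplike (g : V) : Prop := g != 0 /\ teq2 (cop g) [:: (g, g)].

Definition subcoalg (C : V -> Prop) : Prop :=
  subspace C /\ forall c, C c -> tens_in C C (cop c).

Definition simple_subcoalg (C : V -> Prop) : Prop :=
  [/\ subcoalg C, exists c, C c /\ c != 0 &
      forall D, subcoalg D -> (forall x, D x -> C x) ->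
        (forall x, D x -> x = 0) \/ (forall x, C x -> D x)].

Definition onedim (C : V -> Prop) : Prop :=
  exists c, c != 0 /\ forall x, C x <-> exists a : k, x = a *: c.

Definition pointed : Prop :=
  forall C, simple_subcoalg C -> onedim C.

Definition coradical (x : V) : Prop :=
  exists s : seq V,
    (forall y, y \in s -> exists C, simple_subcoalg C /\ C y) /\
    x = \sum_(y <- s) y.

Fixpoint corad_filt (n : nat) : V -> Prop :=
  match n with
  | 0 => coradical
  | n'.+1 => fun x =>
      tens_sum (fun _ => True) (corad_filt n') coradical (fun _ => True) (cop x)
  end.

End Corad.

Section Quiver.
Variables (V E : choiceType) (s t : E -> V).

(* (v, [:: a_1; ...; a_n]) is the path a_n ... a_1 starting at v;
   (v, [::]) is the vertex v *)
Definition pathb (p : V * seq E) : bool :=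
  (if p.2 is a :: _ then s a == p.1 else true) &&
  sorted (fun a b => t a == s b) p.2.

Definition pathT := {p : V * seq E | pathb p}.

Definition plen (p : pathT) : nat := size (val p).2.

Definition pend (p : V * seq E) : V := last p.1 [seq t a | a <- p.2].

Section kQ.
Variable k : fieldType.

Definition kQ := {malg k[pathT]}.

Definition pb (p : V * seq E) : kQ :=
  if insub p is Some q then << (q : pathT) >> else 0.

Definition pcop_path (q : pathT) : seq (kQ * kQ) :=
  [seq (pb (pend ((val q).1, take i (val q).2), drop i (val q).2),
        pb ((val q).1, take i (val q).2)) | i <- iota 0 (plen q).+1].

Definition pcop (x : kQ) : seq (kQ * kQ) :=
  [seq (x@_q *: pq.1, pq.2) | q <- finmap.enum_fset (msupp x), pq <- pcop_path q].

Definition peps (x : kQ) : k := \sum_(q <- finmap.enum_fset (msupp x) | plen q == 0%N) x@_q.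

Definition homog (n : nat) (x : kQ) : Prop :=
  forall q, q \in finmap.enum_fset (msupp x) -> plen q = n.

Definition graded_majid (mul : kQ -> kQ -> kQ) (one : kQ)
    (phi phiinv : kQ -> kQ -> kQ -> k) (S : kQ -> kQ) (alpha beta : kQ -> k)
    : Prop :=
  [/\ is_majid pcop peps mul one phi phiinv S alpha beta,
      forall i j x y, homog i x -> homog j y -> homog (i + j)%N (mul x y),
      homog 0 one,
      forall n x, homog n x -> homog n (S x) &
      [/\ forall i j l x y z, homog i x -> homog j y -> homog l z ->
            (0 < i + j + l)%N -> phi x y z = 0,
          forall n x, homog n x -> (0 < n)%N -> alpha x = 0 &
          forall n x, homog n x -> (0 < n)%N -> beta x = 0]].
End kQ.

(* Q is a Hopf quiver Q(G,R) for some group structure G on the vertex set and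
   some ramification datum R (R_C = number of arrows 1 -> c, c in C, possibly
   an arbitrary cardinal) *)
Definition hopf_quiver : Prop :=
  exists (gmul : V -> V -> V) (gone : V) (ginv : V -> V),
    [/\ forall x y z, gmul x (gmul y z) = gmul (gmul x y) z,
        forall x, gmul gone x = x,
        forall x, gmul (ginv x) x = gone,
        forall x y, exists f : {e : E | s e = x /\ t e = y} ->
                               {e : E | s e = gone /\ t e = gmul y (ginv x)},
                      bijective f &
        forall c g, exists f : {e : E | s e = gone /\ t e = c} ->
                    {e : E | s e = gone /\ t e = gmul (gmul g c) (ginv g)},
                      bijective f].
End Quiver.

Definition quiver_iso (V E V' E' : choiceType) (s t : E -> V) (s' t' : E' -> V')
  : Prop :=
  exists (fv : V -> V') (fe : E -> E'),
    [/\ bijective fv, bijective fe &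
        forall e, s' (fe e) = fv (s e) /\ t' (fe e) = fv (t e)].

(* gr H = (+)_n H_n/H_(n-1) is represented through the family of maps        *)
(* phi_n : H_n -> kQ_n, linear, with kernel H_(n-1) (H_(-1) = 0), so that     *)
(* they induce an injective graded map gr H -> kQ.                             *)
Section Embed.
Variables (k : fieldType) (H : lmodType k).
Variables (cop : H -> seq (H * H)) (eps : H -> k) (mul : H -> H -> H) (one : H)
          (phi phiinv : H -> H -> H -> k) (S : H -> H) (alpha beta : H -> k).
Variables (V E : choiceType) (s t : E -> V).
Variables (mulQ : kQ s t k -> kQ s t k -> kQ s t k) (oneQ : kQ s t k)
          (phiQ phiinvQ : kQ s t k -> kQ s t k -> kQ s t k -> k)
          (SQ : kQ s t k -> kQ s t k) (alphaQ betaQ : kQ s t k -> k).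

Local Notation F := (corad_filt cop).

Definition gr_embedding (f : nat -> H -> kQ s t k) : Prop :=
  [/\
      [/\ forall n, islin_on (F n) (f n),
          forall n x, F n x -> homog n (f n x) &
          forall n x, F n x ->
            (f n x = 0 <-> (if n is m.+1 then F m x else x = 0))],
      forall n y, (n <= 1)%N -> homog n y -> exists x, F n x /\ f n x = y,
      (* coalgebra map (coproduct and counit of gr H) *)
      [/\ forall n x, F n x ->
            exists sl : seq (nat * (H * H)),
              [/\ forall e, e \in sl ->
                    [/\ (e.1 <= n)%N, F e.1 e.2.1 & F (n - e.1)%N e.2.2],
                  teq2 (cop x) [seq e.2 | e <- sl] &
                  teq2 (pcop (f n x))
                       [seq (f e.1 e.2.1, f (n - e.1)%N e.2.2) | e <- sl]] &
          forall x, F 0 x -> peps (f 0 x) = eps x],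
      [/\ forall i j x y, F i x -> F j y ->
            f (i + j)%N (mul x y) = mulQ (f i x) (f j y),
          f 0 one = oneQ &
          forall n x, F n x -> f n (S x) = SQ (f n x)] &
      (* gr Phi, gr alpha, gr beta (which live in degree 0) *)
      [/\ forall x y z, F 0 x -> F 0 y -> F 0 z ->
            phiQ (f 0 x) (f 0 y) (f 0 z) = phi x y z,
          forall x, F 0 x -> alphaQ (f 0 x) = alpha x &
          forall x, F 0 x -> betaQ (f 0 x) = beta x]].

End Embed.

Definition good_quiver (k : fieldType) (H : lmodType k)
    (cop : H -> seq (H * H)) (eps : H -> k) (mul : H -> H -> H) (one : H)
    (phi phiinv : H -> H -> H -> k) (S : H -> H) (alpha beta : H -> k)
    (V E : choiceType) (s t : E -> V) : Prop :=
  hopf_quiver s t /\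
  exists (mulQ : kQ s t k -> kQ s t k -> kQ s t k) (oneQ : kQ s t k)
         (phiQ phiinvQ : kQ s t k -> kQ s t k -> kQ s t k -> k)
         (SQ : kQ s t k -> kQ s t k) (alphaQ betaQ : kQ s t k -> k),
    graded_majid mulQ oneQ phiQ phiinvQ SQ alphaQ betaQ /\
    exists f : nat -> H -> kQ s t k,
      gr_embedding cop eps mul one phi S alpha beta
                   mulQ oneQ phiQ SQ alphaQ betaQ f.

(* Main.v *)
Require Import Defs.
From HB Require Import structures.
From mathcomp Require Import all_boot all_algebra.
From mathcomp Require Import finmap.
From mathcomp Require Import monalg ring zify.
From mathcomp Require Import boolp classical_sets functions cardinality.

Set Implicit Arguments.
Unset Strict Implicit.
Unset Printing Implicit Defensive.
Import GRing.Theory.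
Local Open Scope ring_scope.

(* Modulo the coradical [k G], the skew-primitives of [H] form a bimodule over the group
   [G] of group-likes, associative up to [Phi]; a basis of it made of skew-primitives
   provides the arrows. The shuffle product with coefficients in this bimodule, and the
   antipode reversing paths arrow by arrow, turn the path coalgebra into a graded Majid
   algebra, the scalar data being pulled back along the projection of [kQ] onto [k G].
   An element of [H_n] is sent to the combination of paths of length [n] whose coefficients
   are obtained by convolving, along a path, the forms dual to its arrows.

   Translations by group-likes act injectively on the isotypic components of [H_1 / H_0],
   so that the exchange lemma and the Cantor-Bernstein theorem show that the quiver is a
   Hopf quiver. Conversely, if [gr H] embeds in [kQ'] with [kQ'_0] and [kQ'_1] in the image,
   the vertices of [Q'] are the group-likes of [H], and the arrows between two of them are
   as many as a basis of the corresponding isotypic component. *)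

(** * Linear algebra *)

(** Tensors are lists of pairs compared through functionals, and neither a tensor square nor [gr H]
    is formed. Coproduct identities become identities between convolutions of forms, or between the
    two commuting actions of the dual algebra on [H]. If [J] is the annihilator of the coradical,
    then [x] lies in [F n.+1] exactly when [J] sends it into [F n], for either action. Hence a form
    vanishing on [F (m - 1)] lowers the degree by [m], and a statement on [gr H] becomes a statement
    on [F n] in which lower terms die for reasons of degree.

    Since [Phi] lives in degree 0, axiom (i) on three paths compares the two bracketings with the
    values of [Phi] at the end points and at the starting points; this reduces it to one arrow at a
    time, and the antipode axioms reduce in the same spirit.

    The quiver may have infinitely many vertices, and infinitely many arrows between two of them.
    The coefficients prescribed for the image of [x] must therefore be shown to have finite support,
    and multiplicities are compared by injections in both directions instead of dimensions. *)

Section LinearMaps.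
Variables (k : fieldType) (V W : lmodType k) (f : V -> W).
Hypothesis lf : islin f.

Lemma islinD x y : f (x + y) = f x + f y.
Proof. by have := lf 1 x y; rewrite !scale1r. Qed.

Lemma islin0 : f 0 = 0.
Proof. by apply/(addrI (f 0)); rewrite -islinD !addr0. Qed.

Lemma islinZ a x : f (a *: x) = a *: f x.
Proof. by have := lf a x 0; rewrite islin0 !addr0. Qed.

Lemma islinB x y : f (x - y) = f x - f y.
Proof. by rewrite islinD -scaleN1r islinZ scaleN1r. Qed.

Lemma islin_sum I (r : seq I) (P : pred I) (F : I -> V) :
  f (\sum_(i <- r | P i) F i) = \sum_(i <- r | P i) f (F i).
Proof. by apply: big_morph; [exact: islinD | exact: islin0]. Qed.

End LinearMaps.

Section LinearForms.
Variables (k : fieldType) (V : lmodType k) (f : V -> k).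
Hypothesis lf : islinf f.

Let lf' : islin (f : V -> k^o) := lf.

Lemma islinfD x y : f (x + y) = f x + f y.
Proof. exact: (islinD lf'). Qed.

Lemma islinf0 : f 0 = 0.
Proof. exact: (islin0 lf'). Qed.

Lemma islinfZ a x : f (a *: x) = a * f x.
Proof. exact: (islinZ lf'). Qed.

Lemma islinfB x y : f (x - y) = f x - f y.
Proof. exact: (islinB lf'). Qed.

Lemma islinf_sum I (r : seq I) (P : pred I) (F : I -> V) :
  f (\sum_(i <- r | P i) F i) = \sum_(i <- r | P i) f (F i).
Proof. exact: (islin_sum lf'). Qed.

End LinearForms.

Section Closure.
Variables (k : fieldType) (V W : lmodType k).

Lemma islin_bigsum I (r : seq I) (F : I -> V -> W) :
  (forall i, islin (F i)) -> islin (fun x => \sum_(i <- r) F i x).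
Proof.
move=> lF a x y; rewrite scaler_sumr -big_split /=.
by apply: eq_bigr => i _; rewrite lF.
Qed.

Lemma islin_scale (c : k) (F : V -> W) :
  islin F -> islin (fun x => c *: F x).
Proof. by move=> lF a x y; rewrite lF scalerDr !scalerA mulrC. Qed.

Lemma islin_scalel (F : V -> k) (w : W) :
  islinf F -> islin (fun x => F x *: w).
Proof. by move=> lF a x y; rewrite lF scalerDl scalerA. Qed.

Lemma islin_add (F G : V -> W) : islin F -> islin G ->
  islin (fun x => F x + G x).
Proof. by move=> lF lG a x y; rewrite lF lG scalerDr addrACA. Qed.

Lemma islin_sub (F G : V -> W) : islin F -> islin G ->
  islin (fun x => F x - G x).
Proof.
by move=> lF lG a x y; rewrite lF lG scalerBr opprD addrACA.
Qed.

Lemma islinf_comp (f : W -> k) (g : V -> W) : islinf f -> islin g ->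
  islinf (fun x => f (g x)).
Proof. by move=> lf lg a x y; rewrite lg lf. Qed.

Lemma islin_comp (U : lmodType k) (f : W -> U) (g : V -> W) :
  islin f -> islin g -> islin (fun x => f (g x)).
Proof. by move=> lf lg a x y; rewrite lg lf. Qed.

End Closure.

Lemma islinf_mull (k : fieldType) (V : lmodType k) (c : k) (F : V -> k) : islinf F -> islinf
  (fun x => c * F x).
Proof. exact: (@islin_scale k V k^o c F). Qed.

Lemma islinf_mulr (k : fieldType) (V : lmodType k) (c : k) (F : V -> k) : islinf F -> islinf
  (fun x => F x * c).
Proof. exact: (@islin_scalel k V k^o F c). Qed.

Lemma islinf_sub (k : fieldType) (V : lmodType k) (F G : V -> k) :
  islinf F -> islinf G -> islinf (fun x => F x - G x).
Proof. exact: (@islin_sub k V k^o). Qed.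

Lemma islin_id (k : fieldType) (V : lmodType k) : islin (fun x : V => x).
Proof. by []. Qed.

Section Subspaces.
Variables (k : fieldType) (V : lmodType k) (P : V -> Prop).
Hypothesis sP : subspace P.

Lemma subspace0 : P 0. Proof. by case: sP. Qed.

Lemma subspaceD x y : P x -> P y -> P (x + y).
Proof. by case: sP => _ H Px Py; have := H 1 _ _ Px Py; rewrite scale1r. Qed.

Lemma subspaceZ a x : P x -> P (a *: x).
Proof. by case: sP => P0 H Px; have := H a _ _ Px P0; rewrite addr0. Qed.

Lemma subspaceB x y : P x -> P y -> P (x - y).
Proof.
by move=> Px Py; apply: subspaceD => //; rewrite -scaleN1r; apply: subspaceZ.
Qed.

Lemma subspace_sum (I : eqType) (r : seq I) (F : I -> V) :
  (forall i, i \in r -> P (F i)) -> P (\sum_(i <- r) F i).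
Proof.
move=> H; rewrite big_seq; apply: big_ind => //; first exact: subspace0.
exact: subspaceD.
Qed.

Lemma subspace_eqmod x y : P (x - y) -> P y -> P x.
Proof. by move=> Pxy Py; rewrite -(subrK y x); apply: subspaceD. Qed.

Lemma subspace_eqmodr x y : P (x - y) -> P x -> P y.
Proof.
by move=> Pxy Px; rewrite -(subKr x y); apply: subspaceB.
Qed.

End Subspaces.

(** * Spans, separating functionals and bases modulo a subspace *)

Section Span.
Variables (k : fieldType) (V : lmodType k).

(** The sum of [P] and the linear span of [A]. The base [P] makes independence and bases relative to
    a quotient, and finite combinations come with an induction principle. *)
Inductive spn (P A : V -> Prop) : V -> Prop :=
| spn_base x : P x -> spn P A x
| spn_add c a x : A a -> spn P A x -> spn P A (c *: a + x).

Lemma spn_mono (P A A' : V -> Prop) x :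
  (forall a, A a -> A' a) -> spn P A x -> spn P A' x.
Proof.
move=> AA'; elim=> [y Py|c a y Aa _ IH]; first exact: spn_base.
by apply: spn_add => //; apply: AA'.
Qed.

Lemma spn_sub (P A Q : V -> Prop) : subspace Q -> (forall x, P x -> Q x) ->
  (forall a, A a -> Q a) -> forall x, spn P A x -> Q x.
Proof.
move=> sQ PQ AQ x; elim=> [y /PQ //|c a y /AQ Qa _ IH].
by apply: subspaceD => //; apply: subspaceZ.
Qed.

Section WithSubspace.
Variables (P A : V -> Prop).
Hypothesis sP : subspace P.

Lemma subspace_spn : subspace (spn P A).
Proof.
split; first by apply: spn_base; apply: subspace0.
move=> c x y; elim=> [z Pz|d a z Aa _ IH] Hy.
  elim: Hy => [w Pw|d b w Ab _ IH]; first by apply: spn_base; case: sP => _; apply.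
  by rewrite addrCA; apply: spn_add.
by rewrite scalerDr scalerA -addrA; apply: spn_add => //; apply: IH.
Qed.

Lemma spn_gen a : A a -> spn P A a.
Proof.
move=> Aa; rewrite -[a]addr0 -[a]scale1r; apply: spn_add => //.
by apply: spn_base; apply: subspace0.
Qed.

End WithSubspace.

Lemma spn_addP (P A : V -> Prop) v x : subspace P ->
  spn P (fun a => A a \/ a = v) x -> exists c, spn P A (x - c *: v).
Proof.
move=> sP; elim=> [y Py|c a y Aa _ [d IH]].
  by exists 0; rewrite scale0r subr0; apply: spn_base.
case: Aa => [Aa|->]; first by exists d; rewrite -addrA; apply: spn_add.
by exists (c + d); rewrite scalerDl opprD addrACA subrr add0r.
Qed.

(** Zorn's lemma gives a maximal [Q] such that [v] stays outside the span of [P] and [Q]. This span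
    is then a hyperplane complementary to [v], and [f] reads off the coefficient of [v]. *)
Lemma functional_sep (P : V -> Prop) v : subspace P -> ~ P v ->
  exists f : V -> k, [/\ islinf f, forall x, P x -> f x = 0 & f v = 1].
Proof.
move=> sP nPv.
pose C (Q : set V) := ~ spn P Q v.
have [F FC totF|Q [CQ maxQ]] := @Zorn_bigcup V C.
  move=> sv.
  (* A derivation of [v] over the union of a chain uses finitely many generators, hence holds over
     one member. The first alternative, a derivation without generators, covers the empty chain. *)
  have [Pv|[Q FQ Qv]] : P v \/ exists2 Q, F Q & spn P Q v.
  - elim: sv => [x Px|c a x [Q FQ Qa] _ [Px|[Q' FQ' Qx]]]; first by left.
    + right; exists Q => //; apply: spn_add => //; exact: spn_base.
    + case: (totF _ _ FQ FQ') => QQ'; right.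
        by exists Q' => //; apply: spn_add => //; apply: QQ'.
      exists Q => //; apply: spn_add => //; exact: spn_mono QQ' Qx.
  - by [].
  - exact: (FC _ FQ).
have sQ : subspace (spn P Q) by apply: subspace_spn.
have dec x : exists c, spn P Q (x - c *: v).
  have [Qx|nQx] := pselect (spn P Q x).
    by exists 0; rewrite scale0r subr0.
  have : ~ C (fun a => Q a \/ a = x).
    apply: maxQ; split; first by move=> y; left.
    by move=> QQ; apply: nQx; apply: spn_gen => //; apply: QQ; right.
  move=> /contrapT /(spn_addP sP)[c Hc].
  have c0 : c != 0.
    by apply/eqP => c0; move: Hc; rewrite c0 scale0r subr0.
  exists c^-1; have := subspaceZ sQ (- c^-1) Hc.
  by rewrite scalerBr !scaleNr opprK scalerA mulVf // scale1r addrC.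
have [f Hf] := choice dec.
have uniq_c c d x : spn P Q (x - c *: v) -> spn P Q (x - d *: v) -> c = d.
  move=> Hc Hd; apply/eqP; rewrite -subr_eq0; apply/eqP; apply: contrapT.
  move=> /eqP cd; apply: CQ.
  have := subspaceB sQ Hd Hc.
  rewrite opprB addrC addrA subrK -scalerBl => /(subspaceZ sQ (c - d)^-1).
  by rewrite scalerA mulVf // scale1r.
exists f; split.
- move=> a x y; apply: uniq_c (Hf _) _.
  rewrite scalerDl opprD addrACA -scalerA -scalerBr.
  by apply: subspaceD => //; apply: subspaceZ.
- move=> x Px; apply: uniq_c (Hf _) _; rewrite scale0r subr0; exact: spn_base.
- by apply: uniq_c (Hf _) _; rewrite scale1r subrr; apply: subspace0.
Qed.

Lemma subspace_sepP (P : V -> Prop) x : subspace P ->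
  (forall f : V -> k, islinf f -> (forall y, P y -> f y = 0) -> f x = 0) -> P x.
Proof.
move=> sP H; apply: contrapT => /(functional_sep sP) [f [lf Pf fx]].
by have /eqP := H f lf Pf; rewrite fx oner_eq0.
Qed.

Lemma functional_ext (x y : V) :
  (forall f : V -> k, islinf f -> f x = f y) -> x = y.
Proof.
move=> H; apply/eqP; rewrite -subr_eq0; apply/eqP.
apply: (@subspace_sepP (fun z => z = 0)).
  by split=> // a u v -> ->; rewrite scaler0 addr0.
by move=> f lf _; rewrite islinfB // H // subrr.
Qed.

(** A maximal subset of [A] independent modulo [P]. Taking it inside a generating set [A] lets the
    basis vectors keep the property defining [A]: group-likes in one use, skew-primitives in
    another. *)
Lemma basis_mod (P A : V -> Prop) : subspace P ->
  exists (B : V -> Prop) (d : V -> V -> k),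
    [/\ forall b, B b -> A b, forall b, islinf (d b),
        forall b x, P x -> d b x = 0,
        forall b b', B b -> B b' -> d b b' = (b == b')%:R &
        forall x, A x -> spn P B x].
Proof.
move=> sP.
pose indep (B : set V) := forall b, B b -> ~ spn P (fun c => B c /\ c <> b) b.
pose C (B : set V) := (forall b, B b -> A b) /\ indep B.
have [F FC totF|B [[BA iB] maxB]] := @Zorn_bigcup V C.
  split=> [b [Q FQ Qb]|b [Q FQ Qb] sb]; first by case: (FC _ FQ) => + _; apply.
  have [Q' FQ' [Q'b sQ']] : exists2 Q', F Q' &
      Q' b /\ spn P (fun c => Q' c /\ c <> b) b.
    suff : forall x, spn P (fun c => (\bigcup_(X in F) X)%classic c /\ c <> b) x ->
        exists2 Q', F Q' & Q' b /\ spn P (fun c => Q' c /\ c <> b) x by exact.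
    move=> x; elim=> [y Py|c a y [[R FR Ra] ab] _ [Q' FQ' [Q'b Q'y]]].
      by exists Q => //; split => //; apply: spn_base.
    case: (totF _ _ FR FQ') => RQ'.
      by exists Q' => //; split => //; apply: spn_add => //; split => //; apply: RQ'.
    exists R => //; split; first exact: RQ'.
    apply: spn_add => //; apply: spn_mono Q'y => z [/RQ' Rz zb]; by split.
  by case: (FC _ FQ') => _ /(_ _ Q'b).
have spanB x : A x -> spn P B x.
  move=> Ax; apply: contrapT => nBx.
  have nB : ~ B x by move=> Bx; apply: nBx; apply: spn_gen.
  have : ~ C (fun b => B b \/ b = x).
    apply: maxB; split; first by move=> y; left.
    by move=> BB; apply: nB; apply: BB; right.
  apply; split=> [b [/BA //|-> //]|b Hb].
  have [->|bx] := pselect (b = x).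
    move=> sx; apply: nBx; apply: spn_mono sx => c [[//|->]]; by case.
  case: Hb => // Bb.
  have sQ := @subspace_spn P (fun c => B c /\ c <> b) sP.
  move=> sb.
  have [|c Hc] := @spn_addP P (fun c => B c /\ c <> b) x b sP.
    apply: spn_mono sb => c [[Bc cb|-> _]]; last by right.
    by left.
  have [c0|c0] := eqVneq c 0.
    by apply: (iB _ Bb); move: Hc; rewrite c0 scale0r subr0.
  apply: nBx.
  have sB := @subspace_spn P B sP.
  have HcB : spn P B (b - c *: x) by apply: spn_mono Hc => z [].
  have : spn P B (c *: x).
    by rewrite -(subKr b (c *: x)); apply: subspaceB => //; apply: spn_gen.
  by move=> /(subspaceZ sB c^-1); rewrite scalerA mulVf // scale1r.
(* The dual form of [b] separates [b] from the span of [P] and the other basis vectors; the zero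
   form is the default outside [B]. *)
have /choice[d Hd] : forall b, exists f : V -> k,
    [/\ islinf f, forall x, P x -> f x = 0 &
        B b -> forall b', B b' -> f b' = (b == b')%:R].
  move=> b; have [Bb|nBb] := pselect (B b); last first.
    by exists (fun=> 0); split => // a x y; rewrite mulr0 addr0.
  have [f [lf Pf fb]] := functional_sep (subspace_spn _ sP) (iB _ Bb).
  exists f; split=> // [x Px|_ b' Bb']; first by apply: Pf; apply: spn_base.
  have [<- //|/eqP bb'] := eqVneq b b'.
  by apply: Pf; apply: spn_gen => //; split => // bb; apply: bb'.
exists B, d; split => //; try by move=> b; case: (Hd b).
by move=> b b' Bb Bb'; case: (Hd b) => _ _; apply.
Qed.

End Span.

Section Expansion.
Variables (k : fieldType) (V : lmodType k) (P B : V -> Prop) (d : V -> V -> k).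
Hypotheses (ld : forall b, islinf (d b))
  (dP : forall b x, P x -> d b x = 0)
  (dB : forall b b', B b -> B b' -> d b b' = (b == b')%:R).

Definition expands (es : seq V) x := P (x - \sum_(e <- es) d e x *: e).

Definition subbasis (es : seq V) := uniq es /\ forall e, e \in es -> B e.

Lemma dual_sum es (c : V -> k) b : subbasis es -> B b ->
  d b (\sum_(e <- es) c e *: e) = if b \in es then c b else 0.
Proof.
move=> [ues Bes] Bb; rewrite islinf_sum //.
rewrite big_seq (eq_bigr (fun e => if e == b then c e else 0)); last first.
  move=> e /Bes Be; rewrite islinfZ // dB // eq_sym.
  by case: eqP => _; rewrite ?mulr1 ?mulr0.
rewrite -big_seq; case: ifP => bes.
  by rewrite (bigD1_seq b) //= eqxx big1 ?addr0 // => e /negPf ->.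
by rewrite big1_seq // => e /andP[_ ees]; case: eqP => // eb; rewrite -eb ees in bes.
Qed.

Lemma expands_notin es x b : subbasis es -> expands es x -> B b -> b \notin es ->
  d b x = 0.
Proof.
move=> Hes /(dP b); rewrite islinfB // => H Bb nb; move: H.
by rewrite dual_sum // (negPf nb) subr0.
Qed.

(** Enlarging the list only adds zero coefficients, so finitely many vectors can share one finite
    part of an infinite basis. *)
Lemma expands_sub es es' x : subbasis es -> subbasis es' -> {subset es <= es'} ->
  expands es x -> expands es' x.
Proof.
move=> Hes Hes' sub Hx; suff E : \sum_(e <- es') d e x *: e = \sum_(e <- es) d e x *: e
  by rewrite /expands E.
case: (Hes) => u1 _; case: (Hes') => u2 B2.
rewrite (bigID (mem es)) /= addrC big1_seq ?add0r; last first.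
  move=> e /andP[ne /B2 Be]; rewrite (expands_notin Hes Hx Be) ?scale0r //.
rewrite -big_filter; apply: perm_big; apply: uniq_perm => //.
  exact: filter_uniq.
move=> e; rewrite mem_filter /=; apply: andb_idr; exact: sub.
Qed.

Lemma subbasis_undup es : (forall e, e \in es -> B e) -> subbasis (undup es).
Proof. by move=> H; split; [exact: undup_uniq | move=> e; rewrite mem_undup; exact: H]. Qed.

Lemma spn_expands x : spn P B x -> exists2 es, subbasis es & expands es x.
Proof.
elim=> [y Py|c a y Ba _ [es Hes Hy]].
  exists [::]; first by split.
  by rewrite /expands big_nil subr0.
have H' : subbasis (undup (a :: es)).
  apply: subbasis_undup => e; rewrite inE => /predU1P[-> //|]; case: Hes => _; exact.
exists (undup (a :: es)) => //.
have Hy' : expands (undup (a :: es)) y.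
  by apply: expands_sub Hy => // e ees; rewrite mem_undup inE ees orbT.
rewrite /expands.
have -> : \sum_(e <- undup (a :: es)) d e (c *: a + y) *: e =
   c *: a + \sum_(e <- undup (a :: es)) d e y *: e.
  rewrite (eq_bigr (fun e => c *: (d e a *: e) + d e y *: e)); last first.
    by move=> e _; rewrite ld scalerDl scalerA.
  rewrite big_split /= -scaler_sumr; congr (_ *: _ + _).
  have ain : a \in undup (a :: es) by rewrite mem_undup mem_head.
  case: H' => u B'.
  rewrite (bigD1_seq a) //= dB // eqxx scale1r big1_seq ?addr0 //.
  by move=> e /andP[ea /B' Be]; rewrite dB // (negPf ea) scale0r.
by rewrite opprD addrACA subrr add0r.
Qed.

Lemma spn_expands_seq (xs : seq V) : (forall x, x \in xs -> spn P B x) ->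
  exists2 es, subbasis es & forall x, x \in xs -> expands es x.
Proof.
elim: xs => [|x xs IH] H; first by exists [::] => //; split.
have [|es1 H1 E1] := IH; first by move=> y yxs; apply: H; rewrite inE yxs orbT.
have [|es2 H2 E2] := @spn_expands x; first by apply: H; rewrite mem_head.
have H3 : subbasis (undup (es1 ++ es2)).
  apply: subbasis_undup => e; rewrite mem_cat => /orP[].
    by case: H1 => _; apply.
  by case: H2 => _; apply.
exists (undup (es1 ++ es2)) => // y; rewrite inE => /predU1P[->|yxs].
  by apply: expands_sub E2 => // e; rewrite mem_undup mem_cat => ->; rewrite orbT.
by apply: expands_sub (E1 _ yxs) => // e; rewrite mem_undup mem_cat => ->.
Qed.

End Expansion.

Lemma subspace_eq0 (k : fieldType) (V : lmodType k) : subspace (fun x : V => x = 0).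
Proof. by split=> // a x y -> ->; rewrite scaler0 addr0. Qed.

(** The device behind all changes of representatives: finitely many vectors are expanded modulo [P]
    by forms that are defined everywhere and vanish on [P]. When [P] is a step of the coradical
    filtration, such forms lower the degree. *)
Lemma finite_dual_basis (k : fieldType) (V : lmodType k) (P : V -> Prop) (xs : seq V) :
  subspace P -> exists (es : seq V) (d : V -> V -> k),
    [/\ {subset es <= xs}, forall e, islinf (d e), forall e x, P x -> d e x = 0 &
        forall x, x \in xs -> P (x - \sum_(e <- es) d e x *: e)].
Proof.
move=> sP.
have [B [d [BA ld dP dB sB]]] := @basis_mod k V P (fun x => x \in xs) sP.
have [es [u Bes] H] := spn_expands_seq ld dP dB (fun x => sB x).
by exists es, d; split => // e /Bes /BA.
Qed.

(** * From tests by functionals to arbitrary multilinear maps *)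

Section TensorEquality.
Variables (k : fieldType) (V W : lmodType k).
Implicit Types (s t : seq (V * V)).

Definition isbilin_on (P : V -> Prop) (B : V -> V -> W) :=
  (forall y, P y -> islin_on P (fun x => B x y)) /\
  (forall x, P x -> islin_on P (B x)).

Lemma islin_on_sum (P : V -> Prop) (f : V -> W) (r : seq V) (c : V -> k) :
  subspace P -> islin_on P f -> (forall e, e \in r -> P e) ->
  f (\sum_(e <- r) c e *: e) = \sum_(e <- r) c e *: f e.
Proof.
move=> sP lf; elim: r => [|a r IH] Hr.
  rewrite !big_nil; have := lf 1 0 0 (subspace0 sP) (subspace0 sP).
  by rewrite !scale1r addr0 => /eqP; rewrite -subr_eq0 opprD addNKr oppr_eq0 => /eqP.
have Pa : P a by apply: Hr; rewrite mem_head.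
have Pr e : e \in r -> P e by move=> er; apply: Hr; rewrite inE er orbT.
rewrite !big_cons lf ?IH //.
by apply: subspace_sum => // e er; apply: subspaceZ => //; apply: Pr.
Qed.

(** Both sides are expanded in a finite basis of all entries of the two lists; the coefficients of
    [B e e'] are then values of a pair of functionals, on which the tensors agree. Bilinearity
    relative to [P] suits maps that are linear on one filtration step only. *)
Lemma teq2_bilin_on (P : V -> Prop) (B : V -> V -> W) s t : subspace P ->
  isbilin_on P B ->
  (forall p, p \in s -> P p.1 /\ P p.2) -> (forall p, p \in t -> P p.1 /\ P p.2) ->
  teq2 s t -> \sum_(p <- s) B p.1 p.2 = \sum_(p <- t) B p.1 p.2.
Proof.
move=> sP [B1 B2] Ps Pt st.
pose xs := flatten [seq [:: p.1; p.2] | p <- s ++ t].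
have Pxs x : x \in xs -> P x.
  move=> /flattenP[l /mapP[p pst ->]].
  have [P1 P2] : P p.1 /\ P p.2.
    by move: pst; rewrite mem_cat => /orP[/Ps|/Pt].
  by rewrite !inE => /pred2P[] ->.
have [es [d [esx ld _ Hd]]] := finite_dual_basis xs (@subspace_eq0 k V).
have Pes e : e \in es -> P e by move=> /esx /Pxs.
suff E r : {subset r <= s ++ t} -> \sum_(p <- r) B p.1 p.2 =
    \sum_(e <- es) \sum_(e' <- es) (\sum_(p <- r) d e p.1 * d e' p.2) *: B e e'.
  rewrite (E s) ?(E t); try by move=> p pr; rewrite mem_cat pr ?orbT.
  by apply: eq_bigr => e _; apply: eq_bigr => e' _; rewrite st.
move=> rst.
transitivity (\sum_(p <- r) \sum_(e <- es) \sum_(e' <- es) (d e p.1 * d e' p.2) *: B e e').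
  apply: eq_big_seq => p /rst pst.
  have in1 : p.1 \in xs.
    by apply/flattenP; exists [:: p.1; p.2]; rewrite ?mem_head //; apply/mapP; exists p.
  have in2 : p.2 \in xs.
    by apply/flattenP; exists [:: p.1; p.2]; rewrite ?inE ?eqxx ?orbT //; apply/mapP; exists p.
  have P2 := Pxs _ in2.
  have /eqP := Hd _ in1; rewrite subr_eq0 => /eqP {1}->.
  rewrite (islin_on_sum _ sP (B1 _ P2)) //; apply: eq_big_seq => e ees.
  have /eqP := Hd _ in2; rewrite subr_eq0 => /eqP {1}->.
  rewrite (islin_on_sum _ sP (B2 _ (Pes _ ees))) // scaler_sumr.
  by apply: eq_bigr => e' _; rewrite scalerA.
rewrite exchange_big; apply: eq_bigr => e _; rewrite exchange_big.
by apply: eq_bigr => e' _; rewrite scaler_suml.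
Qed.

Lemma teq2_bilin (B : V -> V -> W) s t : isbilin B -> teq2 s t ->
  \sum_(p <- s) B p.1 p.2 = \sum_(p <- t) B p.1 p.2.
Proof.
move=> [B1 B2]; apply: (@teq2_bilin_on (fun=> True)) => //.
by split=> y _ a x z _ _; [apply: B1 | apply: B2].
Qed.

Definition istrilin (T : V -> V -> V -> W) :=
  [/\ forall y z, islin (fun x => T x y z), forall x z, islin (fun y => T x y z) &
      forall x y, islin (T x y)].

Lemma teq3_trilin (T : V -> V -> V -> W) (s t : seq (V * V * V)) : istrilin T -> teq3 s t ->
  \sum_(p <- s) T p.1.1 p.1.2 p.2 = \sum_(p <- t) T p.1.1 p.1.2 p.2.
Proof.
move=> [T1 T2 T3] st.
pose xs := flatten [seq [:: p.1.1; p.1.2; p.2] | p <- s ++ t].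
have [es [d [esx ld _ Hd]]] := finite_dual_basis xs (@subspace_eq0 k V).
suff E r : {subset r <= s ++ t} -> \sum_(p <- r) T p.1.1 p.1.2 p.2 =
    \sum_(e <- es) \sum_(e' <- es) \sum_(e'' <- es)
       (\sum_(p <- r) d e p.1.1 * d e' p.1.2 * d e'' p.2) *: T e e' e''.
  rewrite (E s) ?(E t); try by move=> p pr; rewrite mem_cat pr ?orbT.
  do 3 (apply: eq_bigr => ? _); by rewrite st.
move=> rst.
transitivity (\sum_(p <- r) \sum_(e <- es) \sum_(e' <- es) \sum_(e'' <- es)
    (d e p.1.1 * d e' p.1.2 * d e'' p.2) *: T e e' e'').
  apply: eq_big_seq => p /rst pst.
  have ex x : x \in xs -> x = \sum_(e <- es) d e x *: e.
    by move=> /Hd /eqP; rewrite subr_eq0 => /eqP.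
  have inn x : x \in [:: p.1.1; p.1.2; p.2] -> x \in xs.
    by move=> xp; apply/flattenP; exists [:: p.1.1; p.1.2; p.2] => //; apply/mapP; exists p.
  rewrite {1}(ex p.1.1) ?inn ?inE ?eqxx //.
  rewrite (islin_sum (T1 _ _)); apply: eq_bigr => e _.
  rewrite {1}(ex p.1.2) ?inn ?inE ?eqxx ?orbT // (islinZ (T1 _ _)).
  rewrite (islin_sum (T2 _ _)) scaler_sumr; apply: eq_bigr => e' _.
  rewrite (islinZ (T2 _ _)) {1}(ex p.2) ?inn ?inE ?eqxx ?orbT //.
  rewrite (islin_sum (T3 _ _)) !scaler_sumr; apply: eq_bigr => e'' _.
  by rewrite (islinZ (T3 _ _)) !scalerA.
rewrite exchange_big; apply: eq_bigr => e _; rewrite exchange_big.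
apply: eq_bigr => e' _; rewrite exchange_big.
by apply: eq_bigr => e'' _; rewrite scaler_suml.
Qed.

End TensorEquality.

(** * The exchange lemma for infinite families *)

Section Steinitz.
Variables (k : fieldType) (V : lmodType k) (P : V -> Prop) (I J : Type).
Variables (b : I -> V) (b' : J -> V).
Hypothesis sP : subspace P.
Hypothesis indep_b : forall i, ~ spn P (fun v => exists j, j <> i /\ v = b j) (b i).
Hypothesis span_b' : forall i, spn P (fun v => exists j, v = b' j) (b i).

Let bb (x : I + J) := match x with inl i => b i | inr j => b' j end.

(* The family obtained from [b] by exchanging along the partial matching [R];
   [U] is the matching deciding which [b i] have been removed. *)
Let exch (R U : set (I * J)) (x : I + J) : Prop :=
  match x with inl i => ~ exists j, U (i, j) | inr j => exists i, R (i, j) end.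

Let rest (R U : set (I * J)) x v := exists y, [/\ exch R U y, y <> x & v = bb y].

Let good (R : set (I * J)) :=
  [/\ forall i j j', R (i, j) -> R (i, j') -> j = j',
      forall i i' j, R (i, j) -> R (i', j) -> i = i' &
      forall x, exch R R x -> ~ spn P (rest R R x) (bb x)].

(** A maximal partial matching [R] is taken for which the family stays independent after each
    matched [b i] is replaced by its partner. If some [b i] were unmatched, a pair [(i, j)] could be
    added; hence [R] is the graph of an injection. *)
Lemma steinitz : exists f : I -> J, injective f.
Proof.
have good0 : good set0.
  split=> // -[i _|j []] //= si; apply: (@indep_b i).
  apply: spn_mono si => v [[j [_ ji ->]|j []]]; last by case.
  by exists j; split=> // E; apply: ji; rewrite E.
have [F FC totF|R [[Rf Ri indR] maxR]] := @Zorn_bigcup _ good.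
  set U := (\bigcup_(X in F) X)%classic.
  (* The empty matching is adjoined so that a surviving [b i] has a witness even when the chain is
     empty. Removals are read off [U] throughout, so a larger member of the chain only adds
     vectors. *)
  pose F' := fun X => F X \/ X = set0.
  have F'C X : F' X -> good X by case=> [/FC|->].
  have F'U X : F' X -> (X `<=` U)%classic.
    by case=> [FX x Xx|->] //; exists X.
  have totF' X Y : F' X -> F' Y -> (X `<=` Y \/ Y `<=` X)%classic.
    case=> [FX|-> _]; last by left.
    case=> [FY|->]; last by right.
    exact: totF.
  have UF' x : U x -> exists2 X, F' X & X x by case=> X FX Xx; exists X => //; left.
  have restS X Y x : (X `<=` Y)%classic -> forall v, rest X U x v -> rest Y U x v.
    move=> XY v [y [Ky yx ->]]; exists y; split => //.
    by case: y Ky {yx} => [//|j [i /XY]] /=; exists i.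
  have joint p q : U p -> U q -> exists2 X, F' X & X p /\ X q.
    move=> /UF'[X FX Xp] /UF'[Y FY Yq]; case: (totF' _ _ FX FY) => XY.
      by exists Y => //; split => //; apply: XY.
    by exists X => //; split => //; apply: XY.
  split.
  - move=> i j j' Uj Uj'; have [X /F'C[H _ _] [Xj Xj']] := joint _ _ Uj Uj'.
    exact: H Xj Xj'.
  - move=> i i' j Uj Uj'; have [X /F'C[_ H _] [Xj Xj']] := joint _ _ Uj Uj'.
    exact: H Xj Xj'.
  move=> x Ux sx.
  have loc y : exch U U y -> exists2 X, F' X & exch X U y.
    case: y => [i H|j [i /UF'[X FX Xij]]]; first by exists set0 => //; right.
    by exists X => //; exists i.
  have [X FX sX] : exists2 X, F' X & spn P (rest X U x) (bb x).
    elim: sx => [v Pv|c a v [y [/loc[Y FY Yy] yx ->]] _ [X FX sX]].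
      by exists set0; [right|apply: spn_base].
    case: (totF' _ _ FX FY) => XY.
      exists Y => //; apply: spn_add; first by exists y.
      exact: spn_mono (restS _ _ _ XY) sX.
    exists X => //; apply: spn_add => //; apply: (restS _ _ _ XY); by exists y.
  have [Y FY Yx] := loc x Ux.
  have [Z [FZ ZU Zx sZ]] : exists Z, [/\ F' Z, (Z `<=` U)%classic, exch Z U x &
      spn P (rest Z U x) (bb x)].
    case: (totF' _ _ FX FY) => XY.
      exists Y; split => //; first exact: F'U.
      exact: spn_mono (restS _ _ _ XY) sX.
    exists X; split => //; first exact: F'U.
    by case: (x) Yx => [//|j [i /XY]] /=; exists i.
  have weak y : exch Z U y -> exch Z Z y.
    by case: y => [i H [j /ZU Uij]|//]; apply: H; exists j.
  case: (F'C _ FZ) => _ _ /(_ x (weak _ Zx)); apply.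
  by apply: spn_mono sZ => v [y [/weak Ky yx ->]]; exists y.
suff dom i : exists j, R (i, j).
  have [f Hf] := choice dom; exists f => i i' E.
  by apply: (Ri _ _ (f i)) => //; rewrite E.
apply: contrapT => nR.
have Ki : exch R R (inl i) by [].
have nbi := indR _ Ki; rewrite /= in nbi.
set Q := spn P (rest R R (inl i)) in nbi.
have sQ : subspace Q by apply: subspace_spn.
(* If the span [Q] of the other vectors contained every [b' j], it would contain [b i], against
   independence. *)
have [j nj] : exists j, ~ Q (b' j).
  apply: contrapT => H; apply: nbi; apply: (spn_sub sQ) (span_b' i).
    by move=> x Px; apply: spn_base.
  by move=> _ [j ->]; apply: contrapT => nj; apply: H; exists j.
have nRj i' : ~ R (i', j).
  by move=> Rj; apply: nj; apply: spn_gen => //; exists (inr j); split=> //; exists i'.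
pose R1 : set (I * J) := fun p => R p \/ p = (i, j).
have : ~ good R1.
  apply: maxR; split; first by move=> p; left.
  by move=> /(_ (i, j)) H; apply: (nRj i); apply: H; right.
have K1 x : exch R1 R1 x -> (exch R R x /\ x <> inl i) \/ x = inr j.
  case: x => [i' H|j' [i' [Rij|[_ ->]]]]; last by right.
    left; split; first by move=> [j' Rij]; apply: H; exists j'; left.
    by move=> [E]; apply: H; exists j; right; rewrite E.
  by left; split => //; exists i'.
apply; split.
- move=> i' j1 j2 [H1|[E1 E1']] [H2|[E2 E2']].
  + exact: Rf H1 H2.
  + by case: nR; exists j1; rewrite -E2.
  + by case: nR; exists j2; rewrite -E1.
  + by rewrite E1' E2'.
- move=> i1 i2 j' [H1|[E1 E1']] [H2|[E2 E2']].
  + exact: Ri H1 H2.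
  + by rewrite E2' in H1; case: (nRj _ H1).
  + by rewrite E1' in H2; case: (nRj _ H2).
  + by rewrite E1 E2.
move=> x /K1 Kx sx.
case: Kx => [[Kx xi]|xj]; last first.
  apply: nj; rewrite -[b' j]/(bb (inr j)) -xj; apply: spn_mono sx.
  by move=> v [y [/K1 [[Ky yi]|yj] yx ->]]; [exists y | rewrite yj xj in yx].
(* A relation for the new family may involve [b' j]. With coefficient zero it is a relation for the
   old family; otherwise solving for [b' j] puts it in [Q]. *)
have [|c Hc] := @spn_addP _ _ P (fun v => exists y, [/\ exch R R y, y <> inl i, y <> x & v =
  bb y]) (b' j) (bb x) sP.
  apply: spn_mono sx => v [y [/K1 [[Ky yi]|yj] yx ->]]; last by right; rewrite yj.
  by left; exists y.
have [c0|c0] := eqVneq c 0.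
  apply: (indR _ Kx); move: Hc; rewrite c0 scale0r subr0; apply: spn_mono.
  by move=> v [y [Ky _ yx ->]]; exists y.
apply: nj; rewrite -[b' j]scale1r -(mulVf c0) -scalerA; apply: subspaceZ => //.
rewrite -(subKr (bb x) (c *: b' j)); apply: subspaceB => //.
  by apply: spn_gen => //; exists x.
by apply: spn_mono Hc => v [y [Ky yi _ ->]]; exists y.
Qed.

End Steinitz.

Lemma inj_surj_bij (I J : Type) (f : I -> J) :
  injective f -> (forall y, exists x, f x = y) -> bijective f.
Proof.
by move=> injf /choice[g Hg]; exists g => // x; apply: injf; rewrite Hg.
Qed.

Lemma inj_inj_bij (I J : Type) (f : I -> J) (g : J -> I) :
  injective f -> injective g -> exists h : I -> J, bijective h.
Proof.
have le T U (u : T -> U) : injective u -> ([set: T] #<= [set: U])%card.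
  move=> iu; have [_ H] := @injfunPex T U setT setT.
  by have [|h] := H; [exists u => // x y _ _ /iu | exact: inj_card_le].
move=> /le fg /le gf; have /card_bijP[h [h' hK h'K]] := Cantor_Bernstein fg gf.
exists (val \o h \o to_setT), (val \o h' \o to_setT) => x /=.
  have -> : to_setT (val (h (to_setT x))) = h (to_setT x) by apply: val_inj.
  by rewrite hK.
have -> : to_setT (val (h' (to_setT x))) = h' (to_setT x) by apply: val_inj.
by rewrite h'K.
Qed.

(** * Coalgebras and the coradical filtration *)

Section Teq2.
Variables (k : fieldType) (V : lmodType k).
Implicit Types s t u : seq (V * V).

Lemma teq2_refl s : teq2 s s. Proof. by []. Qed.

Lemma teq2_sym s t : teq2 s t -> teq2 t s.
Proof. by move=> H f g lf lg; rewrite H. Qed.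

Lemma teq2_trans s t u : teq2 s t -> teq2 t u -> teq2 s u.
Proof. by move=> H1 H2 f g lf lg; rewrite H1 // H2. Qed.

Lemma teq2_cat s s' t t' : teq2 s s' -> teq2 t t' -> teq2 (s ++ t) (s' ++ t').
Proof. by move=> H1 H2 f g lf lg; rewrite !big_cat /= H1 // H2. Qed.

(** Contracting the right factors with the forms [d] splits a tensor into a part with right factors
    [es] and a part whose right factors are the remainders of the expansion. Suitable [es] and [d]
    make these remainders small in the filtration. *)
Lemma teq2_step s (es : seq V) (d : V -> V -> k) :
  teq2 s ([seq (\sum_(p <- s) d e p.2 *: p.1, e) | e <- es] ++
          [seq (p.1, p.2 - \sum_(e <- es) d e p.2 *: e) | p <- s]).
Proof.
move=> f g lf lg; rewrite big_cat !big_map /=.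
rewrite [X in X + _](eq_bigr (fun e => \sum_(p <- s) f p.1 * (d e p.2 * g e))); last first.
  move=> e _; rewrite islinf_sum // mulr_suml; apply: eq_bigr => p _.
  by rewrite islinfZ // mulrAC mulrA mulrC [RHS]mulrC mulrA mulrC mulrA.
rewrite exchange_big /= -big_split /=; apply: eq_bigr => p _.
rewrite islinfB // islinf_sum // mulrBr mulr_sumr addrC.
by under [X in _ - X]eq_bigr do rewrite islinfZ //; rewrite subrK.
Qed.

End Teq2.

Section Coalgebra.
Variables (k : fieldType) (V : lmodType k) (cop : V -> seq (V * V)) (eps : V -> k).
Hypothesis Hc : is_coalgebra cop eps.

Let copD : forall (a : k) x y,
  teq2 (cop (a *: x + y)) ([seq (a *: p.1, p.2) | p <- cop x] ++ cop y).
Proof. by case: Hc. Qed.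

Lemma islinf_eps : islinf eps. Proof. by case: Hc. Qed.
Hint Resolve islinf_eps : core.

(** The product of the dual algebra, followed by its left action [hit] and right action [ract] on
    the coalgebra. That the actions commute is coassociativity. *)
Definition conv (f g : V -> k) (x : V) : k := \sum_(p <- cop x) f p.1 * g p.2.
Definition hit (f : V -> k) (x : V) : V := \sum_(p <- cop x) f p.2 *: p.1.
Definition ract (f : V -> k) (x : V) : V := \sum_(p <- cop x) f p.1 *: p.2.

Lemma islin_copsum (W : lmodType k) (B : V -> V -> W) : isbilin B ->
  islin (fun x => \sum_(p <- cop x) B p.1 p.2).
Proof.
move=> bB a x y; rewrite (teq2_bilin bB (copD a x y)) big_cat big_map /=.
rewrite scaler_sumr; congr (_ + _); apply: eq_bigr => p _.
by case: bB => B1 _; rewrite (islinZ (B1 _)).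
Qed.

Lemma isbilin_mulf (f g : V -> k) : islinf f -> islinf g ->
  isbilin (fun x y => f x * g y : k^o).
Proof.
move=> lf lg; split=> y.
  by move=> a x z; rewrite lf mulrDl /GRing.scale /= mulrA.
by move=> a x z; rewrite lg mulrDr /GRing.scale /= mulrCA.
Qed.

Lemma isbilin_hit (f : V -> k) : islinf f -> isbilin (fun x y : V => f y *: x).
Proof.
move=> lf; split=> y; first exact: islin_scale.
exact: islin_scalel.
Qed.

Lemma isbilin_ract (f : V -> k) : islinf f -> isbilin (fun x y : V => f x *: y).
Proof.
move=> lf; split=> y; first exact: islin_scalel.
exact: islin_scale.
Qed.

Lemma islinf_conv f g : islinf f -> islinf g -> islinf (conv f g).
Proof. by move=> lf lg; apply: (islin_copsum (isbilin_mulf lf lg)). Qed.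

Lemma islin_hit f : islinf f -> islin (hit f).
Proof. by move=> lf; apply: (islin_copsum (isbilin_hit lf)). Qed.

Lemma islin_ract f : islinf f -> islin (ract f).
Proof. by move=> lf; apply: (islin_copsum (isbilin_ract lf)). Qed.

Lemma convE f g x s : islinf f -> islinf g -> teq2 (cop x) s ->
  conv f g x = \sum_(p <- s) f p.1 * g p.2.
Proof. by move=> lf lg H; apply: H. Qed.

Lemma hitE f x s : islinf f -> teq2 (cop x) s -> hit f x = \sum_(p <- s) f p.2 *: p.1.
Proof. by move=> lf H; apply: (teq2_bilin (isbilin_hit lf) H). Qed.

Lemma ractE f x s : islinf f -> teq2 (cop x) s -> ract f x = \sum_(p <- s) f p.1 *: p.2.
Proof. by move=> lf H; apply: (teq2_bilin (isbilin_ract lf) H). Qed.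

Lemma apply_hit f g x : islinf f -> f (hit g x) = conv f g x.
Proof.
move=> lf; rewrite islinf_sum //; apply: eq_bigr => p _.
by rewrite islinfZ // mulrC.
Qed.

Lemma apply_ract f g x : islinf f -> f (ract g x) = conv g f x.
Proof. by move=> lf; rewrite islinf_sum //; apply: eq_bigr => p _; rewrite islinfZ. Qed.

Lemma coassoc (W : lmodType k) (T : V -> V -> V -> W) a : istrilin T ->
  \sum_(p <- cop a) \sum_(q <- cop p.2) T p.1 q.1 q.2 =
  \sum_(p <- cop a) \sum_(q <- cop p.1) T q.1 q.2 p.2.
Proof.
move=> tT; case: Hc => _ _ /(_ a) H _.
have := teq3_trilin tT H.
by rewrite !big_allpairs_dep.
Qed.

Lemma convA f g h x : islinf f -> islinf g -> islinf h ->
  conv f (conv g h) x = conv (conv f g) h x.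
Proof.
move=> lf lg lh; rewrite /conv.
have tT : istrilin (fun x y z => f x * g y * h z : k^o).
  by split=> y z a u v; rewrite ?lf ?lg ?lh /GRing.scale /=; ring.
have := coassoc x tT => /= E.
transitivity (\sum_(p <- cop x) \sum_(q <- cop p.2) f p.1 * g q.1 * h q.2).
  by apply: eq_bigr => p _; rewrite mulr_sumr; apply: eq_bigr => q _; rewrite mulrA.
by rewrite E; apply: eq_bigr => p _; rewrite mulr_suml.
Qed.

Lemma conv_epsl f x : islinf f -> conv eps f x = f x.
Proof.
move=> lf; rewrite -(apply_ract _ _ lf) /ract.
by case: Hc => _ _ _ /(_ x)[-> _].
Qed.

Lemma conv_epsr f x : islinf f -> conv f eps x = f x.
Proof.
move=> lf; rewrite -(apply_hit _ _ lf) /hit.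
by case: Hc => _ _ _ /(_ x)[_ ->].
Qed.

Lemma hit_eps x : hit eps x = x.
Proof. by case: Hc => _ _ _ /(_ x)[_ ]. Qed.

Lemma ract_eps x : ract eps x = x.
Proof. by case: Hc => _ _ _ /(_ x)[]. Qed.

Lemma hit_hit f g x : islinf f -> islinf g -> hit f (hit g x) = hit (conv f g) x.
Proof.
move=> lf lg; apply: functional_ext => h lh.
rewrite !apply_hit //; last exact: islinf_conv.
by rewrite -convA // -apply_hit //; apply: islinf_conv.
Qed.

Lemma ract_ract f g x : islinf f -> islinf g -> ract f (ract g x) = ract (conv g f) x.
Proof.
move=> lf lg; apply: functional_ext => h lh.
rewrite !apply_ract //; last exact: islinf_conv.
by rewrite convA // -apply_ract //; apply: islinf_conv.
Qed.

Lemma hit_ract f g x : islinf f -> islinf g -> hit f (ract g x) = ract g (hit f x).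
Proof.
move=> lf lg; apply: functional_ext => h lh.
rewrite apply_hit // apply_ract; last exact: islinf_conv.
by rewrite apply_ract // apply_hit ?convA //; apply: islinf_conv.
Qed.

Lemma hitB f g x : hit (fun y => f y - g y) x = hit f x - hit g x.
Proof. by rewrite /hit -sumrB; apply: eq_bigr => p _; rewrite scalerBl. Qed.

Lemma ractB f g x : ract (fun y => f y - g y) x = ract f x - ract g x.
Proof. by rewrite /ract -sumrB; apply: eq_bigr => p _; rewrite scalerBl. Qed.

Lemma hitZ c f x : hit (fun y => c * f y) x = c *: hit f x.
Proof. by rewrite /hit scaler_sumr; apply: eq_bigr => p _; rewrite scalerA. Qed.

Lemma ractZ c f x : ract (fun y => c * f y) x = c *: ract f x.
Proof. by rewrite /ract scaler_sumr; apply: eq_bigr => p _; rewrite scalerA. Qed.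

(** ** Group-like elements *)

Notation gl := (grouplike cop).

Lemma gl_hit f g : gl g -> islinf f -> hit f g = f g *: g.
Proof. by move=> [_ H] lf; rewrite (hitE lf H) big_seq1. Qed.

Lemma gl_ract f g : gl g -> islinf f -> ract f g = f g *: g.
Proof. by move=> [_ H] lf; rewrite (ractE lf H) big_seq1. Qed.

Lemma gl_conv f h g : gl g -> islinf f -> islinf h -> conv f h g = f g * h g.
Proof. by move=> [_ H] lf lh; rewrite (convE lf lh H) big_seq1. Qed.

Lemma gl_eps g : gl g -> eps g = 1.
Proof.
move=> gg; have := gl_hit gg islinf_eps; rewrite hit_eps => /eqP.
rewrite -{1}[g]scale1r -subr_eq0 -scalerBl scaler_eq0 subr_eq0.
by case: gg => /negPf -> _; rewrite orbF eq_sym => /eqP.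
Qed.

Lemma eps1_gl g : teq2 (cop g) [:: (g, g)] -> eps g = 1 -> gl g.
Proof.
move=> H e1; split => //; apply/eqP => g0; move: e1; rewrite g0 islinf0 // => /eqP.
by rewrite eq_sym oner_eq0.
Qed.

(** Group-likes are linearly independent. A group-like [g] is expanded in a maximal independent set
    of group-likes: its coefficients are orthogonal idempotents of the field, so exactly one is
    nonzero and it equals 1. *)
Lemma gl_dual : exists d : V -> V -> k, (forall g, islinf (d g)) /\
  (forall g h, gl g -> gl h -> d g h = (g == h)%:R).
Proof.
have [B [d [Bg ld _ dB sB]]] := @basis_mod k V (fun x => x = 0) gl (@subspace_eq0 k V).
suff gB g : gl g -> B g by exists d; split => // g h /gB Bg' /gB Bh; apply: dB.
move=> gg.
have [es Hes] := spn_expands ld (fun b x (x0 : x = 0) => etrans (congr1 (d b) x0)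
  (islinf0 (ld b))) dB (sB g gg).
rewrite /expands => /eqP; rewrite subr_eq0 => /eqP Eg.
case: (Hes) => u Bes.
(* The product of the forms [d e] and [d e'] is evaluated on [g] directly and through the expansion
   of [g]. *)
have ortho e e' : B e -> B e' -> d e g * d e' g = (e == e')%:R * d e g.
  move=> Be Be'; rewrite -(gl_conv gg (ld e) (ld e')) {1}Eg.
  rewrite (islinf_sum (islinf_conv (ld e) (ld e'))).
  rewrite (eq_big_seq (fun e0 => (d e0 g * (e == e')%:R) * (e0 == e)%:R)); last first.
    move=> e0 /Bes Be0; rewrite (islinfZ (islinf_conv (ld e) (ld e'))).
    rewrite (gl_conv (Bg _ Be0)) // (dB _ _ Be Be0) (dB _ _ Be' Be0).
    have [->|ne] := eqVneq e0 e; first by rewrite mul1r mulr1 eq_sym.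
    by rewrite mul0r !mulr0.
  have [ees|nes] := boolP (e \in es).
    rewrite (bigD1_seq e) //= eqxx mulr1 big1 ?addr0 1?mulrC // => e0 /negPf ->.
    by rewrite mulr0.
  have -> : d e g = 0 by rewrite Eg (dual_sum ld dB _ Hes Be) (negPf nes).
  rewrite mulr0 big1_seq // => e0 /andP[_ e0s]; have [E|_] := eqVneq e0 e; last by rewrite mulr0.
  by rewrite -E e0s in nes.
have [e ees de] : exists2 e, e \in es & d e g != 0.
  apply: contrapT => H; case: gg => /eqP g0 _; apply: g0; rewrite Eg big1_seq //.
  move=> e /andP[_ ees]; case: (eqVneq (d e g) 0) => [->|ne]; first by rewrite scale0r.
  by case: H; exists e.
have Be := Bes e ees.
suff -> : g = e by [].
rewrite Eg (bigD1_seq e) //= big1_seq ?addr0.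
  have := ortho e e Be Be; rewrite eqxx => /(mulIf de) ->; exact: scale1r.
move=> e' /andP[e'e /Bes Be']; have /eqP := ortho e e' Be Be'.
by rewrite [e == e']eq_sym (negPf e'e) mul0r mulf_eq0 (negPf de) => /eqP ->; rewrite scale0r.
Qed.

(** ** The coradical filtration of a pointed coalgebra *)

Notation F := (corad_filt cop).

Lemma subspace_coradical : subspace (coradical cop).
Proof.
split; first by exists [::]; rewrite big_nil.
move=> a x y [s [Hs ->]] [t [Ht ->]]; exists ([seq a *: z | z <- s] ++ t); split.
  move=> z; rewrite mem_cat => /orP[/mapP[w /Hs[C [sC Cw]] ->]|/Ht //].
  exists C; split => //; apply: subspaceZ => //.
  by case: sC => [[]].
by rewrite big_cat big_map scaler_sumr.
Qed.

Hypothesis Hp : pointed cop.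

Lemma gl_simple g : gl g -> simple_subcoalg cop (fun x => exists a, x = a *: g).
Proof.
move=> gg; split.
- split.
    split; first by exists 0; rewrite scale0r.
    by move=> a _ _ [b ->] [c ->]; exists (a * b + c); rewrite scalerDl scalerA.
  move=> _ [a ->]; exists [:: (a *: g, g)]; split.
    by move=> p; rewrite inE => /eqP -> /=; split; [exists a | exists 1; rewrite scale1r].
  move=> f h lf lh; rewrite -/(conv f h (a *: g)) (islinfZ (islinf_conv lf lh)).
  by rewrite gl_conv // big_seq1 /= islinfZ // mulrA.
- by exists g; split; [exists 1; rewrite scale1r | case: gg].
move=> D [sD _] DC; have [[x [Dx x0]]|H] := pselect (exists x, D x /\ x != 0).
  right; have [a xa] := DC _ Dx; have a0 : a != 0.
    by apply/eqP => a0; rewrite xa a0 scale0r eqxx in x0.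
  move=> _ [b ->]; suff -> : b *: g = (b / a) *: x by apply: subspaceZ.
  by rewrite xa scalerA mulfVK.
by left=> x Dx; apply/eqP/negPn/negP => x0; apply: H; exists x.
Qed.

(** A simple subcoalgebra is spanned by some [c] whose coproduct is [lam] times the square tensor of
    [c]. The counit gives [lam * eps c = 1], so [lam *: c] is group-like. *)
Lemma coradical_spn x : coradical cop x <-> spn (fun y => y = 0) gl x.
Proof.
split; last first.
  apply: (spn_sub subspace_coradical) => [y ->|g gg]; first exact: subspace0 subspace_coradical.
  exists [:: g]; split; last by rewrite big_seq1.
  move=> y; rewrite inE => /eqP ->; exists (fun x => exists a, x = a *: g).
  by split; [apply: gl_simple | exists 1; rewrite scale1r].
move=> [s [Hs ->]]; apply: (subspace_sum (subspace_spn _ (@subspace_eq0 k V))).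
move=> y /Hs [C [sC Cy]].
have [c [c0 Cc]] := Hp sC.
have cC : C c by apply/Cc; exists 1; rewrite scale1r.
case: sC => [[_ /(_ _ cC)[t [Ct ct]]] _ _].
have [lam Hlam] : exists lam : k, teq2 (cop c) [:: (lam *: c, c)].
  have /choice[u Hu] : forall z, exists a, C z -> z = a *: c.
    by move=> z; have [/Cc[a ->]|nC] := pselect (C z); [exists a | exists 0].
  exists (\sum_(p <- t) u p.1 * u p.2) => f h lf lh.
  rewrite ct // big_seq1 /= islinfZ // mulr_suml mulr_suml; apply: eq_big_seq => p /Ct[C1 C2].
  by rewrite {1}(Hu _ C1) {1}(Hu _ C2) !islinfZ // mulrACA mulrA.
have lam1 : lam * eps c = 1.
  have := hitE islinf_eps Hlam; rewrite hit_eps big_seq1 /= scalerA => /eqP.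
  rewrite -{1}[c]scale1r -subr_eq0 -scalerBl scaler_eq0 (negPf c0) orbF subr_eq0.
  by rewrite mulrC => /eqP.
have lam0 : lam != 0.
  by apply/eqP => l0; move: lam1 => /eqP; rewrite l0 mul0r eq_sym oner_eq0.
have gg : gl (lam *: c).
  split; first by rewrite scaler_eq0 negb_or lam0.
  move=> f h lf lh; rewrite -/(conv f h (lam *: c)) (islinfZ (islinf_conv lf lh)).
  by rewrite (convE lf lh Hlam) !big_seq1 /= !islinfZ //; ring.
move: Cy => /Cc[a ->]; have -> : a *: c = (a / lam) *: (lam *: c) + 0.
  by rewrite addr0 scalerA mulfVK.
by apply: spn_add => //; apply: spn_base.
Qed.

Lemma gl_F0 g : gl g -> F 0%N g.
Proof. by move=> gg; apply/coradical_spn; apply: spn_gen => //; apply: subspace_eq0. Qed.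

(** The annihilator [J] of the coradical in the dual algebra. The step [F n] consists of the
    elements killed by the power [J^(n+1)], and the criteria below use one factor of [J] at a
    time. *)
Definition inJ (f : V -> k) := islinf f /\ forall x, F 0%N x -> f x = 0.

Lemma inJP f : islinf f -> (forall g, gl g -> f g = 0) -> inJ f.
Proof.
move=> lf fg; split => // x /coradical_spn; elim=> [y ->|c a y /fg fa _ IH].
  exact: islinf0.
by rewrite lf fa IH mulr0 addr0.
Qed.

(** The wedge defining [F n.+1], restated for the right action of [J]. For the converse, the left
    tensor factors are expanded modulo the coradical: the coefficient forms [d e] lie in [J], so
    they contract [x] into [F n]. *)
Lemma F_ractP n x : subspace (F n) ->
  F n.+1 x <-> forall f, inJ f -> F n (ract f x).
Proof.
move=> sF; split=> [[s1 [s2 [H1 H2 E]]] f [lf f0]|H].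
  rewrite (ractE lf E) big_cat /=; apply: subspaceD => //.
    by apply: subspace_sum => // p /H1[_ Fp]; apply: subspaceZ.
  rewrite big1_seq ?subspace0 //; first exact: subspace0.
  by move=> p /andP[_ /H2[/f0 -> _]]; rewrite scale0r.
have [es [d [_ ld dP Hd]]] := finite_dual_basis [seq p.1 | p <- cop x] subspace_coradical.
exists [seq (e, ract (d e) x) | e <- es],
   [seq (p.1 - \sum_(e <- es) d e p.1 *: e, p.2) | p <- cop x].
split.
- by move=> p /mapP[e ees ->]; split => //; apply: H; split; [apply: ld | apply: dP].
- by move=> p /mapP[q qx ->]; split => //; apply: Hd; apply: map_f.
move=> f g lf lg; rewrite big_cat !big_map /=.
rewrite [X in X + _](eq_bigr (fun e => \sum_(p <- cop x) f e * (d e p.1 * g p.2))); last first.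
  by move=> e _; rewrite apply_ract // /conv mulr_sumr.
rewrite exchange_big /= -big_split /=; apply: eq_bigr => p _.
rewrite islinfB // islinf_sum // mulrBl mulr_suml addrC.
rewrite [X in _ - X](eq_bigr (fun e => f e * (d e p.1 * g p.2))) ?subrK //.
by move=> e _; rewrite islinfZ // mulrA [f e * _]mulrC.
Qed.

Lemma subspace_F n : subspace (F n).
Proof.
elim: n => [|n IH]; first exact: subspace_coradical.
split; first by apply/F_ractP => // f [lf _]; rewrite (islin0 (islin_ract lf)); apply: subspace0.
move=> a x y /(F_ractP _ IH) Hx /(F_ractP _ IH) Hy; apply/F_ractP => // f Jf.
rewrite (islin_ract (proj1 Jf)); apply: subspaceD => //; last exact: Hy.
by apply: subspaceZ => //; apply: Hx.
Qed.

(* Shifted filtration, so that the degree [-1] part [0] is included. *)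
Definition Fs (n : nat) (x : V) : Prop := if n is m.+1 then F m x else x = 0.

Lemma subspace_Fs n : subspace (Fs n).
Proof. by case: n => [|n]; [apply: subspace_eq0 | apply: subspace_F]. Qed.
Hint Resolve subspace_F subspace_Fs : core.

Lemma Fs_ractP n x : Fs n.+1 x <-> forall f, inJ f -> Fs n (ract f x).
Proof.
case: n => [|n]; last exact: F_ractP.
split=> [Fx f [lf f0]|H].
  move: Fx => /coradical_spn; elim=> [y ->|c a y ga _ IH]; first exact: islin0 (islin_ract lf).
  rewrite (islin_ract lf) gl_ract // f0 ?scale0r ?scaler0 ?add0r //; exact: gl_F0.
apply: (subspace_sepP subspace_coradical) => f lf f0.
by rewrite -conv_epsr // -apply_ract // H ?islinf0.
Qed.

(** The wedge is one-sided; the symmetric criterion follows by induction because the two actions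
    commute. In the base case, a form killing the coradical is compared with its convolution by the
    counit. *)
Lemma Fs_hitP n x : Fs n.+1 x <-> forall f, inJ f -> Fs n (hit f x).
Proof.
elim: n x => [|n IH] x.
  split=> [Fx f [lf f0]|H].
    move: Fx => /coradical_spn; elim=> [y ->|c a y ga _ IH]; first exact: islin0 (islin_hit lf).
    rewrite (islin_hit lf) gl_hit // f0 ?scale0r ?scaler0 ?add0r //; exact: gl_F0.
  apply: (subspace_sepP subspace_coradical) => f lf f0.
  by rewrite -conv_epsl // -apply_hit // H ?islinf0.
split=> H.
  move=> f Jf; apply/Fs_ractP => g Jg; case: (Jf) => lf _; case: (Jg) => lg _.
  rewrite -hit_ract //; move/Fs_ractP: H => /(_ g Jg) /IH; exact.
apply/Fs_ractP => g Jg; apply/IH => f Jf; case: (Jf) => lf _; case: (Jg) => lg _.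
by rewrite hit_ract //; move: (H f Jf) => /Fs_ractP; apply.
Qed.

Lemma Fs_ract n x f : islinf f -> Fs n x -> Fs n (ract f x).
Proof.
move=> lf; elim: n x => [|n IH] x; first by move=> ->; apply: islin0 (islin_ract lf).
move=> /Fs_hitP H; apply/Fs_hitP => g Jg; rewrite hit_ract //; last by case: Jg.
by apply: IH; apply: H.
Qed.

Lemma Fs_hit n x f : islinf f -> Fs n x -> Fs n (hit f x).
Proof.
move=> lf; elim: n x => [|n IH] x; first by move=> ->; apply: islin0 (islin_hit lf).
move=> /Fs_ractP H; apply/Fs_ractP => g Jg; rewrite -hit_ract //; last by case: Jg.
by apply: IH; apply: H.
Qed.

Lemma FsS n x : Fs n x -> Fs n.+1 x.
Proof. by move=> Fx; apply/Fs_hitP => f [lf _]; apply: Fs_hit. Qed.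

Lemma Fs_le m n x : (m <= n)%N -> Fs m x -> Fs n x.
Proof. by move=> /subnK <-; elim: (n - m)%N => [//|j IH] /IH; apply: FsS. Qed.

(** A form vanishing on the [m] lowest steps lowers the degree by [m]. The induction on [j] runs
    through the opposite action, which commutes with [hit]; for [j = 0] the contraction is zero. *)
Lemma Fs_hit_kill m j x f : islinf f -> (forall y, Fs m y -> f y = 0) ->
  Fs (m + j) x -> Fs j (hit f x).
Proof.
move=> lf fk; elim: j x => [|j IH] x.
  rewrite addn0 => Fx; apply: functional_ext => g lg.
  rewrite islinf0 // apply_hit // -apply_ract // fk //; exact: Fs_ract.
rewrite addnS => /Fs_ractP H; apply/Fs_ractP => g Jg.
by rewrite -hit_ract //; [apply: IH; apply: H | case: Jg].
Qed.

Lemma Fs_ract_kill m j x f : islinf f -> (forall y, Fs m y -> f y = 0) ->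
  Fs (m + j) x -> Fs j (ract f x).
Proof.
move=> lf fk; elim: j x => [|j IH] x.
  rewrite addn0 => Fx; apply: functional_ext => g lg.
  rewrite islinf0 // apply_ract // -apply_hit // fk //; exact: Fs_hit.
rewrite addnS => /Fs_hitP H; apply/Fs_hitP => g Jg.
by rewrite hit_ract //; [apply: IH; apply: H | case: Jg].
Qed.

(** The coproduct is compatible with the filtration. The tag records the degree of the left factor,
    without which the coproduct of the graded coalgebra could not be read off a representative. *)
Lemma cop_tagged n x : F n x -> exists sl : seq (nat * (V * V)),
  (forall e, e \in sl -> [/\ (e.1 <= n)%N, F e.1 e.2.1 & F (n - e.1)%N e.2.2]) /\
  teq2 (cop x) [seq e.2 | e <- sl].
Proof.
move=> Fx.
suff [sl [rest [H1 H2 E]]] : exists (sl : seq (nat * (V * V))) (rest : seq (V * V)),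
  [/\ forall e, e \in sl -> [/\ (e.1 <= n)%N, F e.1 e.2.1 & F (n - e.1)%N e.2.2],
      forall p, p \in rest -> p.2 = 0 & teq2 (cop x) ([seq e.2 | e <- sl] ++ rest)].
  exists sl; split => //; apply: teq2_trans E _ => f g lf lg.
  rewrite big_cat /= [X in _ + X]big1_seq ?addr0 // => p /andP[_ /H2 ->].
  by rewrite islinf0 // mulr0.
(* Invariant: after [m] rounds the terms of left degree below [m] are tagged, and the remaining
   right factors lie in [Fs (n.+1 - m)], which is 0 at [m = n.+1]. *)
suff H m : (m <= n.+1)%N -> exists (sl : seq (nat * (V * V))) (rest : seq (V * V)),
  [/\ forall e, e \in sl -> [/\ (e.1 < m)%N, F e.1 e.2.1 & F (n - e.1)%N e.2.2],
      forall p, p \in rest -> Fs (n.+1 - m) p.2 & teq2 (cop x) ([seq e.2 | e <- sl] ++ rest)].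
  have [sl [rest [H1 H2 E]]] := H n.+1 (leqnn _); exists sl, rest; split => //.
  by move=> p /H2; rewrite subnn.
elim: m => [_|m IH mn].
  have [es [d [_ ld dP Hd]]] := finite_dual_basis [seq p.2 | p <- cop x] (subspace_Fs n.+1).
  exists [::], [seq (p.1, p.2 - \sum_(e <- es) d e p.2 *: e) | p <- cop x]; split => //.
    by move=> _ /mapP[p px ->]; rewrite subn0; apply: Hd; apply: map_f.
  apply: teq2_trans (teq2_step _ es d) _ => f g lf lg /=.
  rewrite big_cat /= [X in X + _]big1_seq ?add0r // => _ /andP[_ /mapP[e _ ->]] /=.
  have -> : \sum_(p <- cop x) d e p.2 *: p.1 = hit (d e) x by [].
  by rewrite (@Fs_hit_kill n.+1 0) ?addn0 ?islinf0 ?mul0r // => y; apply: dP.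
have [sl [rest [H1 H2 E]]] := IH (ltnW mn).
have [es [d [ses ld dP Hd]]] := finite_dual_basis [seq p.2 | p <- rest] (subspace_Fs (n - m)).
exists (sl ++ [seq (m, (\sum_(p <- rest) d e p.2 *: p.1, e)) | e <- es]),
  [seq (p.1, p.2 - \sum_(e <- es) d e p.2 *: e) | p <- rest]; split.
- move=> e; rewrite mem_cat => /orP[/H1[em Fe1 Fe2]|/mapP[a aes ->]] /=.
    by split => //; apply: leqW.
  split => //; last first.
    by have /mapP[p /H2 + ->] := ses _ aes; rewrite subSn.
  (* The new left factor is the contraction of [x] by a form that kills [Fs (n - m)], minus terms
     tagged earlier; both lie in [F m]. *)
  have : hit (d a) x = \sum_(e <- sl) d a e.2.2 *: e.2.1 + \sum_(p <- rest) d a p.2 *: p.1.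
    by rewrite (hitE (ld a) E) big_cat big_map.
  move=> /eqP; rewrite addrC -subr_eq => /eqP <-.
  apply: (subspaceB (subspace_F m)).
    apply: (@Fs_hit_kill (n - m) m.+1) => //; first exact: dP.
    by rewrite addnS subnK.
  apply: subspace_sum => // e' /H1[em Fe _]; apply: subspaceZ => //.
  by apply: (@Fs_le e'.1.+1 m.+1) => //; apply: leqW.
- by move=> _ /mapP[p prest ->]; rewrite subSS; apply: Hd; apply: map_f.
apply: teq2_trans E _; rewrite map_cat -catA; apply: teq2_cat => //.
rewrite -map_comp; apply: teq2_trans (teq2_step _ es d) _.
exact: teq2_refl.
Qed.

(** ** The first term of the filtration *)

(** An [x] in P_{g,h} satisfies [hit f x = f x *: g + f h *: x] and
    [ract f x = f g *: x + f x *: h]. Keeping these relations modulo the coradical yields an entire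
    isotypic component of [F 1], a subspace containing [F 0]; translations and the antipode permute
    these components. *)
Definition sprim (g h x : V) : Prop := F 1%N x /\ forall f, islinf f ->
  F 0%N (hit f x - f h *: x) /\ F 0%N (ract f x - f g *: x).

Lemma subspace_sprim g h : subspace (sprim g h).
Proof.
split.
  split; first exact: subspace0.
  move=> f lf; rewrite (islin0 (islin_hit lf)) (islin0 (islin_ract lf)) !scaler0 !subrr.
  by split; apply: (subspace0 subspace_coradical).
move=> a x y [Fx Hx] [Fy Hy]; split; first by case: (subspace_F 1) => _; apply.
move=> f lf; have [x1 x2] := Hx f lf; have [y1 y2] := Hy f lf.
rewrite (islin_hit lf) (islin_ract lf) !scalerDr !opprD.
split; rewrite addrACA !scalerA mulrC -scalerA -scalerBr;
  by apply: subspaceD => //; apply: subspaceZ.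
Qed.

Lemma sprim_F0 g h x : F 0%N x -> sprim g h x.
Proof.
move=> Fx; split; first exact: (@FsS 1).
move=> f lf; split; apply: (subspaceB subspace_coradical).
- exact: (@Fs_hit 1).
- exact: (subspaceZ subspace_coradical).
- exact: (@Fs_ract 1).
- exact: (subspaceZ subspace_coradical).
Qed.

Lemma hit_F1 f x : inJ f -> F 1%N x -> F 0%N (hit f x).
Proof. by move=> Jf Fx; move: x Fx; move=> x /(@Fs_hitP 1); apply. Qed.

Lemma ract_F1 f x : inJ f -> F 1%N x -> F 0%N (ract f x).
Proof. by move=> Jf Fx; move: x Fx; move=> x /(@Fs_ractP 1); apply. Qed.

Section Dual.
Variable dl : V -> V -> k.
Hypothesis ldl : forall g, islinf (dl g).
Hypothesis dlE : forall g h, gl g -> gl h -> dl g h = (g == h)%:R.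

Lemma spn_F0_expands (xs : seq V) : (forall x, x \in xs -> F 0%N x) ->
  exists2 Gs, subbasis gl Gs & forall x, x \in xs -> x = \sum_(g <- Gs) dl g x *: g.
Proof.
move=> Fxs.
have [Gs HG E] := spn_expands_seq ldl
  (fun b x (x0 : x = 0) => etrans (congr1 (dl b) x0) (islinf0 (ldl b))) dlE
  (fun x xx => proj1 (coradical_spn x) (Fxs x xx)).
by exists Gs => // x /E /eqP; rewrite subr_eq0 => /eqP.
Qed.

Lemma F0_expand x : F 0%N x -> exists2 Gs, subbasis gl Gs &
  x = \sum_(g <- Gs) dl g x *: g.
Proof.
move=> Fx; have [|Gs HG E] := @spn_F0_expands [:: x].
  by move=> y; rewrite inE => /eqP ->.
by exists Gs => //; apply: E; rewrite mem_head.
Qed.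

Lemma convdl_inJl f g : islinf f -> gl g ->
  inJ (fun y => conv f (dl g) y - f g * dl g y).
Proof.
move=> lf gg; apply: inJP.
  by apply: islinf_sub; [apply: islinf_conv | apply: islinf_mull].
move=> h gh; rewrite gl_conv // dlE //; case: eqP => [->|_]; last by rewrite !mulr0 subrr.
by rewrite subrr.
Qed.

Lemma convdl_inJr f g : islinf f -> gl g ->
  inJ (fun y => conv (dl g) f y - f g * dl g y).
Proof.
move=> lf gg; apply: inJP.
  by apply: islinf_sub; [apply: islinf_conv | apply: islinf_mull].
move=> h gh; rewrite gl_conv // dlE //; case: eqP => [->|_].
  by rewrite mulrC subrr.
by rewrite mul0r mulr0 subrr.
Qed.

(** On [F 1] modulo [F 0] the forms [dl g] act as orthogonal idempotents:
    [conv f (dl g) - f g * dl g] vanishes on the group-likes, so it lies in [J], which maps [F 1]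
    into [F 0]. *)
Lemma sprim_proj g h x : gl g -> gl h -> F 1%N x -> sprim g h (ract (dl g) (hit (dl h) x)).
Proof.
move=> gg gh Fx.
have Fhx : F 1%N (hit (dl h) x) by apply: (@Fs_hit 2).
split; first exact: (@Fs_ract 2).
move=> f lf; split.
  rewrite hit_ract // hit_hit // -(islinZ (islin_ract (ldl g))) -(islinB (islin_ract (ldl g))).
  apply: (@Fs_ract 1) => //; rewrite -hitZ -hitB; apply: hit_F1 => //.
  exact: convdl_inJl.
rewrite ract_ract // -ractZ -ractB; apply: ract_F1 => //; exact: convdl_inJr.
Qed.

(* Modulo [F 0] the counit acts on [F 1] as the sum of the [dl g]. *)
Lemma counit_sum_dual (s : seq (V * V)) :
  (forall f, inJ f -> F 0%N (\sum_(p <- s) f p.2 *: p.1)) ->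
  exists2 Gs, (forall g, g \in Gs -> gl g) &
    F 0%N (\sum_(p <- s) eps p.2 *: p.1 -
           \sum_(g <- Gs) \sum_(p <- s) dl g p.2 *: p.1).
Proof.
move=> sJ.
have [es [d [_ ld dP Hd]]] := finite_dual_basis [seq p.2 | p <- s] subspace_coradical.
have E := teq2_step s es d.
set s1 := [seq _ | e <- es] in E; set s2 := [seq _ | p <- s] in E.
have s1F p : p \in s1 -> F 0%N p.1.
  by move=> /mapP[e _ ->] /=; apply: sJ; split; [apply: ld | apply: dP].
have s2F y : y \in [seq p.2 | p <- s2] -> F 0%N y.
  by move=> /mapP[_ /mapP[p px ->] ->]; apply: Hd; apply: map_f.
have [Gs [_ HG] EG] := spn_F0_expands s2F.
exists Gs => //.
have dec f : islinf f ->
    F 0%N (\sum_(p <- s) f p.2 *: p.1 - \sum_(p <- s2) f p.2 *: p.1).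
  move=> lf; rewrite (teq2_bilin (isbilin_hit lf) E) big_cat /= addrK.
  by apply: (subspace_sum subspace_coradical) => p /s1F; apply: subspaceZ.
have {1}-> : \sum_(p <- s) eps p.2 *: p.1 =
   (\sum_(p <- s) eps p.2 *: p.1 - \sum_(p <- s2) eps p.2 *: p.1)
   + \sum_(g <- Gs) \sum_(p <- s2) dl g p.2 *: p.1.
  rewrite -[LHS](subrK (\sum_(p <- s2) eps p.2 *: p.1)); congr (_ + _).
  rewrite exchange_big /=; apply: eq_big_seq => p ps2.
  rewrite -scaler_suml; congr (_ *: _).
  rewrite {1}(EG p.2) ?map_f // islinf_sum //; apply: eq_big_seq => g /HG gg.
  by rewrite islinfZ // gl_eps // mulr1.
rewrite -addrA -sumrB; apply: (subspaceD subspace_coradical); first exact: dec.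
apply: (subspace_sum subspace_coradical) => g _.
by rewrite -opprB -scaleN1r; apply: (subspaceZ subspace_coradical); apply: dec.
Qed.

Lemma F1_hit_sum x : F 1%N x -> exists2 Gs, (forall g, g \in Gs -> gl g) &
  F 0%N (x - \sum_(g <- Gs) hit (dl g) x).
Proof.
move=> Fx; have [|Gs HG E] := @counit_sum_dual (cop x).
  by move=> f Jf; apply: hit_F1.
by exists Gs => //; rewrite -[X in X - _]hit_eps.
Qed.

Lemma F1_ract_sum x : F 1%N x -> exists2 Gs, (forall g, g \in Gs -> gl g) &
  F 0%N (x - \sum_(g <- Gs) ract (dl g) x).
Proof.
move=> Fx; have [|Gs HG E] := @counit_sum_dual [seq (p.2, p.1) | p <- cop x].
  by move=> f Jf; rewrite big_map /=; apply: ract_F1.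
exists Gs => //; move: E; rewrite big_map /= -/(ract eps x) ract_eps.
by under eq_bigr do rewrite big_map /=.
Qed.

(** Expanding the counit over group-likes for each of the two actions writes [x], modulo [F 0], as a
    finite sum of isotypic components. *)
Lemma F1_spn x : F 1%N x ->
  spn (F 0%N) (fun y => exists g h, [/\ gl g, gl h & sprim g h y]) x.
Proof.
move=> Fx; set A := fun y => _.
have sA : subspace (spn (F 0%N) A) by apply/subspace_spn/subspace_coradical.
have base y : F 0%N y -> spn (F 0%N) A y by apply: spn_base.
have [Hs HH Ex] := F1_hit_sum Fx.
apply: (subspace_eqmod sA (base _ Ex)); apply: subspace_sum => // h /HH gh.
have Fy : F 1%N (hit (dl h) x) by apply: (@Fs_hit 2).
have [Gs HG Ey] := F1_ract_sum Fy.
apply: (subspace_eqmod sA (base _ Ey)); apply: subspace_sum => // g /HG gg.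
apply: spn_gen; first exact: subspace_coradical.
by exists g, h; split => //; apply: sprim_proj.
Qed.

End Dual.
End Coalgebra.

(** * A basis of [F 1] modulo [F 0] made of skew-primitives, and its dual forms *)

Section ArrowBasis.
Variables (k : fieldType) (V : lmodType k) (cop : V -> seq (V * V)) (eps : V -> k).
Hypothesis Hc : is_coalgebra cop eps.
Hypothesis Hp : pointed cop.
Variable dl : V -> V -> k.
Hypothesis ldl : forall g, islinf (dl g).
Hypothesis dlE : forall g h, grouplike cop g -> grouplike cop h -> dl g h = (g == h)%:R.

Notation F := (corad_filt cop).
Notation gl := (grouplike cop).
Notation Fs := (Fs cop).
Notation sprim := (sprim cop).
Notation hit := (hit cop).
Notation ract := (ract cop).

Let sF n : subspace (F n) := subspace_F Hc n.
Let sFs n : subspace (Fs n) := subspace_Fs Hc n.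
Hint Resolve sF sFs : core.

Lemma F0_dl_eq0 x : F 0%N x -> (forall g, gl g -> dl g x = 0) -> x = 0.
Proof.
move=> Fx x0; have [Gs [_ HG] ->] := F0_expand Hc Hp ldl dlE Fx.
by rewrite big1_seq // => g /andP[_ /HG /x0 ->]; rewrite scale0r.
Qed.

(** For forms in [J] there is no error term. As [ract f x] lies in [F 0], it is determined by the
    forms [dl g']; these are moved to the other action, where [sprim] computes them modulo the
    kernel of [f]. *)
Lemma sprim_ract (f : V -> k) g h x : gl h -> sprim g h x -> inJ cop f -> ract f x = f x *: h.
Proof.
move=> gh [Fx Hx] Jf; case: (Jf) => lf f0.
apply/eqP; rewrite -subr_eq0; apply/eqP; apply: F0_dl_eq0.
  apply: (subspaceB (sF 0)); first exact: (ract_F1 Hc Hp).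
  by apply: (subspaceZ (sF 0)); apply: (gl_F0 Hc Hp).
move=> g' gg'; rewrite islinfB // islinfZ // apply_ract // -apply_hit //.
have [/f0 + _] := Hx _ (ldl g').
by rewrite islinfB // islinfZ // mulrC => /eqP; rewrite subr_eq0 => /eqP ->; rewrite mulrC subrr.
Qed.

Lemma sprim_hit (f : V -> k) g h x : gl g -> sprim g h x -> inJ cop f -> hit f x = f x *: g.
Proof.
move=> gg [Fx Hx] Jf; case: (Jf) => lf f0.
apply/eqP; rewrite -subr_eq0; apply/eqP; apply: F0_dl_eq0.
  apply: (subspaceB (sF 0)); first exact: (hit_F1 Hc Hp).
  by apply: (subspaceZ (sF 0)); apply: (gl_F0 Hc Hp).
move=> g' gg'; rewrite islinfB // islinfZ // apply_hit // -apply_ract //.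
have [_ /f0] := Hx _ (ldl g').
by rewrite islinfB // islinfZ // mulrC => /eqP; rewrite subr_eq0 => /eqP ->; rewrite mulrC subrr.
Qed.

(* The coproduct of a skew-primitive is [g (x) x + x (x) h] modulo [F 0 (x) F 0]. *)
Lemma sprim_copsum (W : lmodType k) (B : V -> V -> W) (Q : W -> Prop) g h x :
  subspace Q -> isbilin B -> (forall y z, F 0%N y -> F 0%N z -> Q (B y z)) ->
  gl g -> gl h -> sprim g h x ->
  Q (\sum_(p <- cop x) B p.1 p.2 - (B g x + B x h)).
Proof.
move=> sQ [B1 B2] QB gg gh Hx; apply: (subspace_sepP sQ) => f lf fQ.
pose L y z := f (B y z).
have L1 z : islinf (L^~ z) by move=> a u v; rewrite /L B1 lf.
have L2 y : islinf (L y) by move=> a u v; rewrite /L B2 lf.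
have L0 y z : F 0%N y -> F 0%N z -> L y z = 0 by move=> Fy Fz; apply: fQ; apply: QB.
have [es [d [_ ld dP Hd]]] := finite_dual_basis
   (x :: [seq p.1 | p <- cop x] ++ [seq p.2 | p <- cop x]) (sF 0).
have Jd e : inJ cop (d e) by split; [apply: ld | apply: dP].
rewrite islinfB // islinf_sum // islinfD // -!/(L _ _).
have Hd1 p : p \in cop x -> F 0%N (p.1 - \sum_(e <- es) d e p.1 *: e).
  by move=> px; apply: Hd; rewrite inE mem_cat map_f ?orbT.
have Hd2 p : p \in cop x -> F 0%N (p.2 - \sum_(e <- es) d e p.2 *: e).
  by move=> px; apply: Hd; rewrite inE mem_cat (map_f snd) ?orbT.
have Hdx : F 0%N (x - \sum_(e <- es) d e x *: e) by apply: Hd; rewrite mem_head.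
have E1 : L g x = \sum_(e <- es) d e x * L g e.
  have /eqP := L0 _ _ (gl_F0 Hc Hp gg) Hdx; rewrite islinfB // subr_eq0 => /eqP ->.
  by rewrite islinf_sum //; apply: eq_bigr => e _; rewrite islinfZ.
have E2 : L x h = \sum_(e <- es) d e x * L e h.
  have /eqP := L0 _ _ Hdx (gl_F0 Hc Hp gh).
  rewrite (islinfB (L1 _)) subr_eq0 => /eqP ->.
  by rewrite (islinf_sum (L1 _)); apply: eq_bigr => e _; rewrite (islinfZ (L1 _)).
apply/eqP; rewrite subr_eq0; apply/eqP.
(* Expanding the left factor modulo [F 0], then the right factor of the remainder, leaves only the
   contractions [ract (d e) x] and [hit (d e) x], known exactly because [d e] lies in [J]. *)
rewrite (eq_big_seq (fun p => \sum_(e <- es) L (d e p.1 *: e) p.2 +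
    \sum_(e <- es) d e p.2 * L (p.1 - \sum_(e' <- es) d e' p.1 *: e') e)); last first.
  move=> p px; rewrite -/(L _ _) -{1}(subrK (\sum_(e <- es) d e p.1 *: e) p.1).
  rewrite (islinfD (L1 _)) addrC (islinf_sum (L1 _)); congr (_ + _).
  rewrite -{1}(subrK (\sum_(e <- es) d e p.2 *: e) p.2) islinfD // L0 ?add0r; last 2 first.
  - exact: Hd1.
  - exact: Hd2.
  by rewrite islinf_sum //; apply: eq_bigr => e _; rewrite islinfZ.
rewrite big_split /= addrC E1 E2; congr (_ + _); rewrite exchange_big /=; apply: eq_bigr => e _.
  transitivity (L (hit (d e) x - \sum_(e' <- es) conv cop (d e') (d e) x *: e') e).
    rewrite (islinfB (L1 _)) /hit (islinf_sum (L1 _)).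
    under eq_bigr do rewrite (islinfB (L1 _)) mulrBr.
    rewrite sumrB; congr (_ - _).
      by apply: eq_bigr => p _; rewrite (islinfZ (L1 _)).
    rewrite (islinf_sum (L1 _)).
    under eq_bigr do rewrite (islinf_sum (L1 _)) mulr_sumr.
    rewrite exchange_big /=; apply: eq_bigr => e' _.
    rewrite (islinfZ (L1 _)) /conv mulr_suml; apply: eq_bigr => p _.
    by rewrite (islinfZ (L1 _)) mulrCA mulrA.
  rewrite (sprim_hit gg Hx) // big1 ?subr0 ?(islinfZ (L1 _)) // => e' _.
  rewrite -apply_hit // (dP e') ?scale0r //.
  by apply: (hit_F1 Hc Hp) => //; case: Hx.
transitivity (L e (ract (d e) x)).
  rewrite /ract islinf_sum //; apply: eq_bigr => p _.
  by rewrite (islinfZ (L1 _)) islinfZ.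
by rewrite (sprim_ract gh Hx) // islinfZ.
Qed.

(** Choosing the basis among skew-primitives gives each basis vector a source and a target: these
    vectors are the arrows of the quiver. *)
Lemma arrow_basis : exists (B : V -> Prop) (d : V -> V -> k) (sr tg : V -> V),
  [/\ forall b, islinf (d b), forall b x, F 0%N x -> d b x = 0,
      forall b b', B b -> B b' -> d b b' = (b == b')%:R,
      forall x, F 1%N x -> spn (F 0%N) B x &
      forall b, B b -> [/\ gl (sr b), gl (tg b) & sprim (tg b) (sr b) b]].
Proof.
have [B [d [BA ld dP dB sB]]] :=
  @basis_mod k V (F 0%N) (fun y => exists g h, [/\ gl g, gl h & sprim g h y]) (sF 0).
have /choice[tg /choice[sr H]] : forall b, exists g, exists h,
    B b -> [/\ gl g, gl h & sprim g h b].
  move=> b; have [/BA[g [h H]]|nB] := pselect (B b); first by exists g, h.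
  by exists 0, 0.
exists B, d, sr, tg; split => //; last by move=> b /H[].
move=> x Fx; apply: (spn_sub _ _ sB (F1_spn Hc Hp ldl dlE Fx)).
  exact/subspace_spn/(sF 0).
by move=> y; apply: spn_base.
Qed.

Section Basis.
Variables (B : V -> Prop) (d : V -> V -> k) (sr tg : V -> V).
Hypotheses (ld : forall b, islinf (d b)) (dP : forall b x, F 0%N x -> d b x = 0)
  (dB : forall b b', B b -> B b' -> d b b' = (b == b')%:R)
  (sB : forall x, F 1%N x -> spn (F 0%N) B x)
  (Bst : forall b, B b -> [/\ gl (sr b), gl (tg b) & sprim (tg b) (sr b) b]).

Lemma basis_F1 b : B b -> F 1%N b.
Proof. by move=> /Bst[_ _ []]. Qed.

Lemma F1_form_eq0 f x : islinf f -> (forall y, F 0%N y -> f y = 0) ->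
  (forall b, B b -> f b = 0) -> F 1%N x -> f x = 0.
Proof.
move=> lf f0 fB /sB; apply: (spn_sub (Q := fun y => f y = 0)) => //.
split; first exact: islinf0.
by move=> a u v fu fv; rewrite lf fu fv mulr0 addr0.
Qed.

Lemma F1_d_eq0 x : F 1%N x -> (forall b, B b -> d b x = 0) -> F 0%N x.
Proof.
move=> /sB /(spn_expands ld dP dB)[es [_ Bes] + x0].
by rewrite /expands big1_seq ?subr0 // => e /andP[_ /Bes /x0 ->]; rewrite scale0r.
Qed.

(** Dual form of [sprim]: on [F 1], the form [d b] is an eigenvector of both actions, with
    eigenvalues the values of [f] at the end points of [b]. Both sides vanish on the coradical and
    agree on the basis. *)
Lemma d_hit b f x : B b -> islinf f -> F 1%N x -> d b (hit f x) = f (sr b) * d b x.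
Proof.
move=> Bb lf Fx; apply/eqP; rewrite -subr_eq0; apply/eqP.
apply: (@F1_form_eq0 (fun x => d b (hit f x) - f (sr b) * d b x)) => //.
- apply: islinf_sub; last exact: islinf_mull.
  by apply: islinf_comp => //; apply: (islin_hit Hc).
- move=> y Fy; rewrite (dP b Fy) dP ?mulr0 ?subrr //.
  exact: (@Fs_hit _ _ _ _ Hc Hp 1).
move=> b' Bb'; have [_ _ [_ /(_ f lf)[/(dP b) + _]]] := Bst Bb'.
rewrite islinfB // islinfZ // (dB Bb Bb') => /eqP; rewrite subr_eq0 => /eqP ->.
by case: eqP => [->|_]; rewrite ?mulr0 ?subrr.
Qed.

Lemma d_ract b f x : B b -> islinf f -> F 1%N x -> d b (ract f x) = f (tg b) * d b x.
Proof.
move=> Bb lf Fx; apply/eqP; rewrite -subr_eq0; apply/eqP.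
apply: (@F1_form_eq0 (fun x => d b (ract f x) - f (tg b) * d b x)) => //.
- apply: islinf_sub; last exact: islinf_mull.
  by apply: islinf_comp => //; apply: (islin_ract Hc).
- move=> y Fy; rewrite (dP b Fy) dP ?mulr0 ?subrr //.
  exact: (@Fs_ract _ _ _ _ Hc Hp 1).
move=> b' Bb'; have [_ _ [_ /(_ f lf)[_ /(dP b) +]]] := Bst Bb'.
rewrite islinfB // islinfZ // (dB Bb Bb') => /eqP; rewrite subr_eq0 => /eqP ->.
by case: eqP => [->|_]; rewrite ?mulr0 ?subrr.
Qed.

Lemma sprim_dP g h x : F 1%N x ->
  sprim g h x <-> forall b, B b -> d b x != 0 -> tg b = g /\ sr b = h.
Proof.
move=> Fx; split=> [[_ Hx] b Bb dx|H].
  split; apply: functional_ext => f lf; apply: (mulIf dx).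
    rewrite -d_ract //; have [_ /(dP b)] := Hx f lf.
    by rewrite islinfB // islinfZ // => /eqP; rewrite subr_eq0 => /eqP.
  rewrite -d_hit //; have [/(dP b) + _] := Hx f lf.
  by rewrite islinfB // islinfZ // => /eqP; rewrite subr_eq0 => /eqP.
split => // f lf; split; apply: F1_d_eq0.
- by apply: (subspaceB (sF 1)); [apply: (@Fs_hit _ _ _ _ Hc Hp 2) | apply: (subspaceZ (sF 1))].
- move=> b Bb; rewrite islinfB // islinfZ // d_hit //.
  have [->|/(H b Bb)[_ ->]] := eqVneq (d b x) 0; first by rewrite !mulr0 subrr.
  by rewrite subrr.
- by apply: (subspaceB (sF 1)); [apply: (@Fs_ract _ _ _ _ Hc Hp 2) | apply: (subspaceZ (sF 1))].
move=> b Bb; rewrite islinfB // islinfZ // d_ract //.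
have [->|/(H b Bb)[-> _]] := eqVneq (d b x) 0; first by rewrite !mulr0 subrr.
by rewrite subrr.
Qed.

(** The shape of the coproduct that drives the embedding: a right factor is a basis arrow or a
    group-like, or its left factor has degree at most [n - 2]. It results from three expansions of
    the right factor: modulo [F 1], then in the arrows modulo [F 0], then in the group-likes. The
    index of [Fs] is shifted, so [Ua a] has degree at most [n - 1]. *)
Lemma cop_split n x : F n x ->
  exists (As Gs : seq V) (Ua Ug : V -> V) (rest : seq (V * V)),
  [/\ subbasis B As, subbasis gl Gs, (forall a, Fs n (Ua a)) /\ (forall g, F n (Ug g)),
      forall p, p \in rest -> Fs n.-1 p.1 &
      teq2 (cop x) ([seq (Ua a, a) | a <- As] ++ [seq (Ug g, g) | g <- Gs] ++ rest)].
Proof.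
move=> Fx.
have [es [c [_ lc cP Hc']]] := finite_dual_basis [seq p.2 | p <- cop x] (sF 1).
have E1 := teq2_step (cop x) es c.
set r := [seq _ | e <- es] in E1; set s := [seq _ | p <- cop x] in E1.
have rF p : p \in r -> Fs n.-1 p.1.
  move=> /mapP[e _ ->] /=.
  apply: (@Fs_hit_kill _ _ _ _ Hc Hp 2 n.-1) => //; first by apply: cP.
  by apply: (@Fs_le _ _ _ _ Hc Hp n.+1) => //; case: (n).
have sF1 w : w \in [seq p.2 | p <- s] -> F 1%N w.
  by move=> /mapP[_ /mapP[p px ->] ->]; apply: Hc'; apply: map_f.
have [As HA EA] := spn_expands_seq ld dP dB (fun w ws => sB (sF1 w ws)).
have E2 := teq2_step s As d.
set s2 := [seq _ | p <- s] in E2; set sa := [seq _ | e <- As] in E2.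
have s2F w : w \in [seq p.2 | p <- s2] -> F 0%N w.
  by move=> /mapP[_ /mapP[p px ->] ->]; apply: EA; apply: map_f.
have [Gs HG EG] := spn_F0_expands Hc Hp ldl dlE s2F.
have E3 := teq2_step s2 Gs dl.
set s3 := [seq _ | p <- s2] in E3; set sg := [seq _ | e <- Gs] in E3.
have s30 : teq2 (sg ++ s3) sg.
  move=> f g lf lg; rewrite big_cat /= [X in _ + X]big1_seq ?addr0 //.
  move=> _ /andP[_ /mapP[p ps ->]] /=; rewrite -(EG p.2) ?map_f // subrr.
  by rewrite islinf0 // mulr0.
have nle : (n.-1 <= n)%N by case: (n).
have sdec f : islinf f -> \sum_(p <- s) f p.2 *: p.1 = hit f x - \sum_(p <- r) f p.2 *: p.1.
  by move=> lf; rewrite (hitE lf E1) big_cat /= addrAC subrr add0r.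
have Ua_F a : Fs n (\sum_(p <- s) d a p.2 *: p.1).
  rewrite sdec //; apply: (subspaceB (sFs n)).
    by apply: (@Fs_hit_kill _ _ _ _ Hc Hp 1 n) => // y; apply: dP.
  by apply: (subspace_sum (sFs n)) => p /rF /(Fs_le Hc Hp nle); apply: subspaceZ.
exists As, Gs, (fun a => \sum_(p <- s) d a p.2 *: p.1),
  (fun g => \sum_(p <- s2) dl g p.2 *: p.1), r; split => //.
  split=> // g.
  have -> : \sum_(p <- s2) dl g p.2 *: p.1 =
     \sum_(p <- s) dl g p.2 *: p.1 - \sum_(p <- sa) dl g p.2 *: p.1.
    have := teq2_bilin (isbilin_hit (ldl g)) E2; rewrite big_cat /= => ->.
    by rewrite addrAC subrr add0r.
  rewrite sdec //; apply: (subspaceB (sF n)).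
    apply: (subspaceB (sF n)); first exact: (@Fs_hit _ _ _ _ Hc Hp n.+1).
    apply: (subspace_sum (sF n)) => p /rF Hr; apply: (subspaceZ (sF n)).
    by apply: (@Fs_le _ _ _ _ Hc Hp n.-1 n.+1) => //; apply: leqW.
  apply: (subspace_sum (sF n)) => _ /mapP[a _ ->] /=; apply: (subspaceZ (sF n)).
  exact: (FsS Hc Hp (Ua_F a)).
apply: teq2_trans E1 _; apply: (@teq2_trans _ _ _ (s ++ r)).
  by move=> f g lf lg; rewrite !big_cat /= addrC.
rewrite catA; apply: teq2_cat => //; apply: teq2_trans E2 _; apply: teq2_cat => //.
exact: teq2_trans E3 s30.
Qed.

End Basis.
End ArrowBasis.

(** * Pointed Majid algebras *)

Section Sweedler.
Variables (k : fieldType) (V W : lmodType k) (cop : V -> seq (V * V)).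

Lemma sweS n a (G : seq V -> W) : \sum_(l <- swe cop n.+1 a) G l =
  \sum_(l <- swe cop n a) \sum_(p <- cop (head 0 l)) G [:: p.1, p.2 & behead l].
Proof. by rewrite /= big_flatten big_map; apply: eq_bigr => l _; rewrite big_map. Qed.

Lemma swe2E a (G : seq V -> W) : \sum_(l <- swe cop 2 a) G l =
  \sum_(p <- cop a) \sum_(q <- cop p.1) G [:: q.1; q.2; p.2].
Proof. by rewrite !sweS big_seq1. Qed.

Lemma swe4E a (G : seq V -> W) : \sum_(l <- swe cop 4 a) G l =
  \sum_(p <- cop a) \sum_(q <- cop p.1) \sum_(r <- cop q.1) \sum_(u <- cop r.1)
    G [:: u.1; u.2; r.2; q.2; p.2].
Proof. by rewrite !sweS big_seq1. Qed.

End Sweedler.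

Section Bilinear.
Variables (k : fieldType) (V W : lmodType k).

Lemma gl_copsum (cop : V -> seq (V * V)) (B : V -> V -> W) g :
  isbilin B -> grouplike cop g -> \sum_(p <- cop g) B p.1 p.2 = B g g.
Proof. by move=> bB [_ /(teq2_bilin bB) ->]; rewrite big_seq1. Qed.

End Bilinear.

Section Majid.
Variables (k : fieldType) (H : lmodType k).
Variables (cop : H -> seq (H * H)) (eps : H -> k) (mul : H -> H -> H) (one : H)
          (phi phiinv : H -> H -> H -> k) (S : H -> H) (alpha beta : H -> k).
Hypothesis HM : is_majid cop eps mul one phi phiinv S alpha beta.
Hypothesis Hp : pointed cop.

Notation F := (corad_filt cop).
Notation gl := (grouplike cop).
Notation Fs := (Fs cop).
Notation sprim := (sprim cop).
Notation hit := (hit cop).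
Notation ract := (ract cop).

Lemma majid_coalgebra : is_coalgebra cop eps. Proof. by case: HM. Qed.
Let Hc := majid_coalgebra.
Let sF n : subspace (F n) := subspace_F Hc n.
Let sFs n : subspace (Fs n) := subspace_Fs Hc n.
Hint Resolve sF sFs : core.

Lemma bilin_mul : isbilin mul. Proof. by case: HM => _ [[]]. Qed.
Lemma lin_mull y : islin (mul^~ y). Proof. by case: bilin_mul => + _; apply. Qed.
Lemma lin_mulr x : islin (mul x). Proof. by case: bilin_mul => _; apply. Qed.
Hint Resolve lin_mull lin_mulr : core.

Lemma cop_mul a b : teq2 (cop (mul a b))
  [seq (mul p.1 q.1, mul p.2 q.2) | p <- cop a, q <- cop b].
Proof. by case: HM => _ [[]]. Qed.

Lemma eps_mul a b : eps (mul a b) = eps a * eps b. Proof. by case: HM => _ [[]]. Qed.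
Lemma gl_one : gl one.
Proof. by case: HM => _ [_ [H1 H2] _ _] _; apply: (eps1_gl Hc). Qed.
Lemma trilin_phi : istrilinf phi. Proof. by case: HM => _ [_ _ []]. Qed.
Lemma trilin_phiinv : istrilinf phiinv. Proof. by case: HM => _ [_ _ []]. Qed.
Lemma lin_S : islin S. Proof. by case: HM => _ [_ _ _ []]. Qed.
Lemma cop_S a : teq2 (cop (S a)) [seq (S p.2, S p.1) | p <- cop a].
Proof. by case: HM => _ [_ _ _ []]. Qed.
Lemma eps_S a : eps (S a) = eps a. Proof. by case: HM => _ [_ _ _ []]. Qed.
Lemma lin_alpha : islinf alpha. Proof. by case: HM => _ [_ _ _ []]. Qed.
Lemma lin_beta : islinf beta. Proof. by case: HM => _ [_ _ _ []]. Qed.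
Lemma mul1x a : mul one a = a. Proof. by case: HM => _ _ [_ /(_ a)[]]. Qed.
Lemma mulx1 a : mul a one = a. Proof. by case: HM => _ _ [_ /(_ a)[]]. Qed.
Hint Resolve lin_S lin_alpha lin_beta gl_one : core.

Lemma lin_phi1 y z : islinf (fun x => phi x y z). Proof. by case: trilin_phi. Qed.
Lemma lin_phi2 x z : islinf (fun y => phi x y z). Proof. by case: trilin_phi. Qed.
Lemma lin_phi3 x y : islinf (phi x y). Proof. by case: trilin_phi. Qed.
Hint Resolve lin_phi1 lin_phi2 lin_phi3 : core.

Lemma teq2_mul a b s t : teq2 (cop a) s -> teq2 (cop b) t ->
  teq2 (cop (mul a b)) [seq (mul p.1 q.1, mul p.2 q.2) | p <- s, q <- t].
Proof.
move=> Hs Ht; apply: teq2_trans (cop_mul a b) _ => f g lf lg.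
rewrite !big_allpairs_dep /=.
rewrite (teq2_bilin (B := fun x y => \sum_(q <- cop b) f (mul x q.1) * g (mul y q.2) : k^o) _ Hs).
  apply: eq_bigr => p _; apply: (teq2_bilin (B :=
    fun x y => f (mul p.1 x) * g (mul p.2 y) : k^o)) Ht.
  by apply: isbilin_mulf; apply: islinf_comp.
split=> y; apply: islin_bigsum => q.
  by case: (isbilin_mulf (islinf_comp lf (lin_mull q.1)) (islinf_comp lg (lin_mull q.2))).
by case: (isbilin_mulf (islinf_comp lf (lin_mull q.1)) (islinf_comp lg (lin_mull q.2))).
Qed.

Lemma teq2_S a s : teq2 (cop a) s -> teq2 (cop (S a)) [seq (S p.2, S p.1) | p <- s].
Proof.
move=> Hs; apply: teq2_trans (cop_S a) _ => f g lf lg; rewrite !big_map /=.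
apply: (teq2_bilin (B := fun x y => f (S y) * g (S x) : k^o)) Hs.
split=> y.
  move=> c u v; rewrite lin_S lg mulrDr /GRing.scale /= mulrCA; by [].
by move=> c u v; rewrite lin_S lf mulrDl /GRing.scale /= mulrA.
Qed.

(** ** Group-like elements *)

Lemma gl_mul g h : gl g -> gl h -> gl (mul g h).
Proof.
move=> gg gh; apply: (eps1_gl Hc); last by rewrite eps_mul !(gl_eps Hc) // mulr1.
by have := teq2_mul (proj2 gg) (proj2 gh).
Qed.

Lemma gl_S g : gl g -> gl (S g).
Proof.
move=> gg; apply: (eps1_gl Hc); last by rewrite eps_S (gl_eps Hc).
by have := teq2_S (proj2 gg).
Qed.

Lemma gl_phiK g h l : gl g -> gl h -> gl l -> phi g h l * phiinv g h l = 1.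
Proof.
move=> gg gh gl'; case: HM => _ [_ _ [_ _ /(_ g h l) + _] _] _.
rewrite !(gl_eps Hc) // !mulr1 => <-.
have [q1 q2 q3] := trilin_phiinv.
symmetry; rewrite (gl_copsum (B := fun x y =>
  \sum_(q <- cop h) \sum_(r <- cop l) phi x q.1 r.1 * phiinv y q.2 r.2 : k^o) _ gg); last first.
  by split=> y; do 2 (apply: islin_bigsum => ?);
    [apply: islinf_mulr; apply: lin_phi1 | apply: islinf_mull; apply: q1].
rewrite (gl_copsum (B := fun x y =>
  \sum_(r <- cop l) phi g x r.1 * phiinv g y r.2 : k^o) _ gh); last first.
  by split=> y; (apply: islin_bigsum => ?);
    [apply: islinf_mulr; apply: lin_phi2 | apply: islinf_mull; apply: q2].
apply: (gl_copsum (B := fun x y => phi g h x * phiinv g h y : k^o) _ gl').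
by split=> y; [apply: islinf_mulr; apply: lin_phi3 | apply: islinf_mull; apply: q3].
Qed.

Lemma gl_phi_neq0 g h l : gl g -> gl h -> gl l -> phi g h l != 0.
Proof.
move=> gg gh gl'; apply/eqP => p0; have /eqP := gl_phiK gg gh gl'.
by rewrite p0 mul0r eq_sym oner_eq0.
Qed.

Let quasi_assoc a b c :
        \sum_(p <- cop a) \sum_(q <- cop b) \sum_(r <- cop c)
            phi p.2 q.2 r.2 *: mul p.1 (mul q.1 r.1) =
        \sum_(p <- cop a) \sum_(q <- cop b) \sum_(r <- cop c)
            phi p.1 q.1 r.1 *: mul (mul p.2 q.2) r.2.
Proof. by case: HM => _ _ []. Qed.

Let BL (c : H -> k) (m : H -> H) : islinf c -> islin m -> isbilin (fun x y => c y *: m x).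
Proof.
by move=> lc lm; split=> y; [apply: islin_scale | apply: islin_scalel].
Qed.

Let BR (c : H -> k) (m : H -> H) : islinf c -> islin m -> isbilin (fun x y => c x *: m y).
Proof.
by move=> lc lm; split=> y; [apply: islin_scalel | apply: islin_scale].
Qed.

Let bilin_sum I (r : seq I) (B : I -> H -> H -> H) :
  (forall i, isbilin (B i)) -> isbilin (fun x y => \sum_(i <- r) B i x y).
Proof. by move=> HB; split=> y; apply: islin_bigsum => i; case: (HB i). Qed.

Lemma quasi_assoc1 x w u : gl w -> gl u ->
  mul (hit (fun y => phi y w u) x) (mul w u) =
  mul (mul (ract (fun y => phi y w u) x) w) u.
Proof.
move=> gw gu; have := quasi_assoc x w u.
under eq_bigr => p _.
  rewrite (gl_copsum (B := fun y z => \sum_(r <- cop u) phi p.2 z r.2 *: mul p.1 (mul y r.1)) _ gw).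
    rewrite (gl_copsum (B := fun y z => phi p.2 w z *: mul p.1 (mul w y)) _ gu); first over.
    by apply: BL => //; apply: islin_comp.
  by apply: bilin_sum => r; apply: BL => //; apply: islin_comp => //; apply: islin_comp.
move=> /= E; have := E; under [in X in _ = X -> _]eq_bigr => p _.
  rewrite (gl_copsum (B := fun y z => \sum_(r <- cop u) phi p.1 y r.1 *: mul (mul p.2 z) r.2) _ gw).
    rewrite (gl_copsum (B := fun y z => phi p.1 w y *: mul (mul p.2 w) z) _ gu); first over.
    exact: BR.
  by apply: bilin_sum => r; apply: BR => //; apply: (islin_comp (lin_mull _) (lin_mulr _)).
move=> /= {}E; rewrite /hit /ract !(islin_sum (lin_mull _)).
rewrite (eq_bigr (fun p => phi p.2 w u *: mul p.1 (mul w u))); last first.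
  by move=> p _; rewrite (islinZ (lin_mull _)).
by rewrite E; apply: eq_bigr => p _; rewrite !(islinZ (lin_mull _)).
Qed.

Lemma quasi_assoc2 x w u : gl w -> gl u ->
  mul w (mul (hit (fun y => phi w y u) x) u) =
  mul (mul w (ract (fun y => phi w y u) x)) u.
Proof.
move=> gw gu; have := quasi_assoc w x u.
rewrite (gl_copsum (B := fun y z => \sum_(q <- cop x) \sum_(r <- cop u)
   phi z q.2 r.2 *: mul y (mul q.1 r.1)) _ gw); last first.
  by do 2 (apply: bilin_sum => ?); apply: BL.
rewrite (gl_copsum (B := fun y z => \sum_(q <- cop x) \sum_(r <- cop u)
   phi y q.1 r.1 *: mul (mul z q.2) r.2) _ gw); last first.
  by do 2 (apply: bilin_sum => ?); apply: BR => //; apply: (islin_comp (lin_mull _) (lin_mull _)).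
under eq_bigr => p _.
  rewrite (gl_copsum (B := fun y z => phi w p.2 z *: mul w (mul p.1 y)) _ gu); first over.
  by apply: BL => //; apply: islin_comp.
move=> /= E; have := E; under [in X in _ = X -> _]eq_bigr => p _.
  rewrite (gl_copsum (B := fun y z => phi w p.1 y *: mul (mul w p.2) z) _ gu); first over.
  exact: BR.
move=> /= {}E; rewrite /hit /ract (islin_sum (lin_mull _)) !(islin_sum (lin_mulr _)).
rewrite (islin_sum (lin_mull _)).
rewrite (eq_bigr (fun p => phi w p.2 u *: mul w (mul p.1 u))); last first.
  by move=> p _; rewrite (islinZ (lin_mull _)) (islinZ (lin_mulr _)).
by rewrite E; apply: eq_bigr => p _; rewrite (islinZ (lin_mulr _)) (islinZ (lin_mull _)).
Qed.

Lemma quasi_assoc3 x w u : gl w -> gl u ->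
  mul w (mul u (hit (phi w u) x)) = mul (mul w u) (ract (phi w u) x).
Proof.
move=> gw gu; have := quasi_assoc w u x.
rewrite (gl_copsum (B := fun y z => \sum_(q <- cop u) \sum_(r <- cop x)
   phi z q.2 r.2 *: mul y (mul q.1 r.1)) _ gw); last first.
  by do 2 (apply: bilin_sum => ?); apply: BL.
rewrite (gl_copsum (B := fun y z => \sum_(q <- cop u) \sum_(r <- cop x)
   phi y q.1 r.1 *: mul (mul z q.2) r.2) _ gw); last first.
  by do 2 (apply: bilin_sum => ?); apply: BR => //; apply: (islin_comp (lin_mull _) (lin_mull _)).
rewrite (gl_copsum (B := fun y z => \sum_(r <- cop x)
   phi w z r.2 *: mul w (mul y r.1)) _ gu); last first.
  by (apply: bilin_sum => ?); apply: BL => //; apply: (islin_comp (lin_mulr _) (lin_mull _)).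
rewrite (gl_copsum (B := fun y z => \sum_(r <- cop x)
   phi w y r.1 *: mul (mul w z) r.2) _ gu); last first.
  by (apply: bilin_sum => ?); apply: BR => //; apply: (islin_comp (lin_mull _) (lin_mulr _)).
move=> /= E; rewrite /hit /ract !(islin_sum (lin_mulr _)).
rewrite (eq_bigr (fun p => phi w u p.2 *: mul w (mul u p.1))); last first.
  by move=> p _; rewrite !(islinZ (lin_mulr _)).
by rewrite E; apply: eq_bigr => p _; rewrite (islinZ (lin_mulr _)).
Qed.

(** On a group-like both actions multiply by the same value of [phi]; being nonzero, it cancels. *)
Lemma gl_mulA g h l : gl g -> gl h -> gl l -> mul g (mul h l) = mul (mul g h) l.
Proof.
move=> gg gh gl'; have := quasi_assoc1 g gh gl'.
rewrite gl_hit // gl_ract // !(islinZ (lin_mull _)).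
by apply: scalerI; apply: gl_phi_neq0.
Qed.

Lemma swe2_alpha x :
  \sum_(p <- cop x) mul (S (hit alpha p.1)) p.2 = alpha x *: one.
Proof.
case: HM => _ _ [_ _ _ _ [/(_ x)[+ _] _]]; rewrite swe2E => <-.
apply: eq_bigr => p _; rewrite /hit (islin_sum lin_S) (islin_sum (lin_mull _)).
by apply: eq_bigr => q _; rewrite (islinZ lin_S) (islinZ (lin_mull _)).
Qed.

Lemma swe2_beta x :
  \sum_(p <- cop x) mul (hit beta p.1) (S p.2) = beta x *: one.
Proof.
case: HM => _ _ [_ _ _ _ [/(_ x)[_ +] _]]; rewrite swe2E => <-.
apply: eq_bigr => p _; rewrite /hit (islin_sum (lin_mull _)).
by apply: eq_bigr => q _; rewrite (islinZ (lin_mull _)).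
Qed.

Lemma bilin_alpha : isbilin (fun x y => mul (S (hit alpha x)) y).
Proof.
split=> y //; apply: (islin_comp (lin_mull _)); apply: (islin_comp lin_S).
exact: (islin_hit Hc).
Qed.

Lemma bilin_beta : isbilin (fun x y => mul (hit beta x) (S y)).
Proof.
split=> y; first by apply: (islin_comp (lin_mull _)); apply: (islin_hit Hc).
exact: (islin_comp (lin_mulr _) lin_S).
Qed.

Let iter_gl (W : lmodType k) g (T : H -> H -> H -> H -> H -> W) : gl g ->
  (forall b c d e, islin (fun a => T a b c d e)) ->
  (forall a c d e, islin (fun b => T a b c d e)) ->
  (forall a b d e, islin (fun c => T a b c d e)) ->
  (forall a b c e, islin (fun d => T a b c d e)) ->
  (forall a b c d, islin (T a b c d)) ->
  \sum_(p <- cop g) \sum_(q <- cop p.1) \sum_(r <- cop q.1) \sum_(u <- cop r.1)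
    T u.1 u.2 r.2 q.2 p.2 = T g g g g g.
Proof.
move=> gg T1 T2 T3 T4 T5.
have B1 c d e : isbilin (fun a b => T a b c d e) by [].
have B2 d e : isbilin (fun x c => \sum_(u <- cop x) T u.1 u.2 c d e).
  by split=> y; [apply: (islin_copsum Hc (B1 y d e)) | apply: islin_bigsum => ?; apply: T3].
have B3 e : isbilin (fun x d => \sum_(r <- cop x) \sum_(u <- cop r.1) T u.1 u.2 r.2 d e).
  split=> y; first by apply: (islin_copsum Hc (B2 y e)).
  by do 2 (apply: islin_bigsum => ?).
have B4 : isbilin (fun x e => \sum_(q <- cop x) \sum_(r <- cop q.1)
    \sum_(u <- cop r.1) T u.1 u.2 r.2 q.2 e).
  split=> y; first by apply: (islin_copsum Hc (B3 y)).
  by do 3 (apply: islin_bigsum => ?).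
by rewrite (gl_copsum B4 gg) (gl_copsum (B3 g) gg) (gl_copsum (B2 g g) gg)
  (gl_copsum (B1 g g g) gg).
Qed.

(** Axiom (vi) on a group-like. It makes [alpha g] and [beta g] nonzero, and dividing axiom (v) by
    them turns [S g] into a two-sided inverse of [g]. *)
Lemma gl_alpha_beta g : gl g -> phi g (S g) g * beta g * alpha g = 1.
Proof.
move=> gg; case: HM => _ _ [_ _ _ _ [_ /(_ g)[+ _]]].
rewrite (@swe4E k H k^o) (gl_eps Hc) // => E; rewrite -[RHS]E; symmetry.
apply: (@iter_gl k^o g (fun a b c d e => phi a (S c) e * beta b * alpha d : k^o) gg) => /=.
- by move=> b c d e; do 2 apply: islinf_mulr.
- by move=> a c d e; apply: islinf_mulr; apply: islinf_mull.
- by move=> a b d e; do 2 apply: islinf_mulr; apply: (islinf_comp (lin_phi2 _ _)).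
- by move=> a b c e; apply: islinf_mull.
- by move=> a b c d; do 2 apply: islinf_mulr.
Qed.

Lemma gl_alpha_neq0 g : gl g -> alpha g != 0.
Proof.
move=> gg; apply/eqP => p0; have /eqP := gl_alpha_beta gg.
by rewrite p0 mulr0 eq_sym oner_eq0.
Qed.

Lemma gl_beta_neq0 g : gl g -> beta g != 0.
Proof.
move=> gg; apply/eqP => p0; have /eqP := gl_alpha_beta gg.
by rewrite p0 mulr0 mul0r eq_sym oner_eq0.
Qed.

Lemma gl_mulVx g : gl g -> mul (S g) g = one.
Proof.
move=> gg; apply: (scalerI (gl_alpha_neq0 gg)); rewrite -swe2_alpha.
rewrite (gl_copsum bilin_alpha gg) gl_hit //.
by rewrite (islinZ lin_S) (islinZ (lin_mull _)).
Qed.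

Lemma gl_mulxV g : gl g -> mul g (S g) = one.
Proof.
move=> gg; apply: (scalerI (gl_beta_neq0 gg)); rewrite -swe2_beta.
by rewrite (gl_copsum bilin_beta gg) gl_hit // (islinZ (lin_mull _)).
Qed.

(** ** Multiplication, antipode and the coradical filtration *)

Lemma F0_bilin (W : lmodType k) (B : H -> H -> W) (Q : W -> Prop) : subspace Q ->
  isbilin B -> (forall g h, gl g -> gl h -> Q (B g h)) ->
  forall x y, F 0%N x -> F 0%N y -> Q (B x y).
Proof.
move=> sQ [B1 B2] QB x y /(coradical_spn Hc Hp) Fx /(coradical_spn Hc Hp) Fy.
elim: Fx => [_ ->|c g z gg _ IH]; first by rewrite (islin0 (B1 _)); apply: subspace0.
rewrite B1; apply: subspaceD => //; apply: subspaceZ => //.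
elim: Fy => [_ ->|c' h w gh _ IH']; first by rewrite (islin0 (B2 _)); apply: subspace0.
by rewrite B2; apply: subspaceD => //; apply: subspaceZ => //; apply: QB.
Qed.

Lemma F0_mul x y : F 0%N x -> F 0%N y -> F 0%N (mul x y).
Proof.
apply: (F0_bilin (sF 0) bilin_mul).
by move=> g h gg gh; apply: (gl_F0 Hc Hp); apply: gl_mul.
Qed.

Lemma F0_S x : F 0%N x -> F 0%N (S x).
Proof.
move=> /(coradical_spn Hc Hp); elim=> [_ ->|c g y gg _ IH].
  by rewrite (islin0 lin_S); apply: (subspace0 (sF 0)).
rewrite lin_S; apply: (subspaceD (sF 0)) => //; apply: (subspaceZ (sF 0)).
by apply: (gl_F0 Hc Hp); apply: gl_S.
Qed.

(** Induction on [i + j] through the criterion for [ract]. A form in [J] applied to the left factors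
    kills the terms of bidegree [(0, 0)], and in every other term the right factors have smaller
    total degree. *)
Lemma F_mul i j x y : F i x -> F j y -> F (i + j)%N (mul x y).
Proof.
have [n] := ubnP (i + j)%N; elim: n => // n IH in i j x y * => ijn Fx Fy.
have Fle a b z : (a <= b)%N -> F a z -> F b z by move=> ab; apply: (@Fs_le _ _ _ _ Hc Hp a.+1 b.+1).
case E : (i + j)%N => [|m].
  by move/eqP: E Fx Fy; rewrite addn_eq0 => /andP[/eqP-> /eqP->]; apply: F0_mul.
apply/(F_ractP _ (sF m)) => // f Jf; case: (Jf) => lf f0.
have [s [Hs Es]] := cop_tagged Hc Hp Fx.
have [t [Ht Et]] := cop_tagged Hc Hp Fy.
rewrite (ractE lf (teq2_mul Es Et)) big_allpairs_dep !big_map /=.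
apply: (subspace_sum (sF m)) => p /Hs[pi p1 p2]; rewrite big_map.
apply: (subspace_sum (sF m)) => q /Ht[qj q1 q2] /=.
have [e0|e0] := posnP (p.1 + q.1)%N.
  move/eqP: e0 p1 q1; rewrite addn_eq0 => /andP[/eqP-> /eqP->] p1 q1.
  by rewrite f0 ?scale0r; [apply: (subspace0 (sF m)) | apply: F0_mul].
apply: (subspaceZ (sF m)); apply: (Fle ((i - p.1) + (j - q.1))%N); first by lia.
apply: IH => //; lia.
Qed.

Lemma Fs_mul i j x y : Fs i x -> Fs j y -> Fs (i + j).-1 (mul x y).
Proof.
case: i => [|i]; first by move=> -> _; rewrite (islin0 (lin_mull _)); apply: (subspace0 (sFs _)).
case: j => [|j]; first by move=> _ ->; rewrite (islin0 (lin_mulr _)); apply: (subspace0 (sFs _)).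
by rewrite addSn addnS /=; apply: F_mul.
Qed.

Lemma hit_S f x : islinf f -> hit f (S x) = S (ract (fun y => f (S y)) x).
Proof.
move=> lf; rewrite (hitE lf (cop_S x)) big_map /ract (islin_sum lin_S).
by apply: eq_bigr => p _; rewrite (islinZ lin_S).
Qed.

Lemma ract_S f x : islinf f -> ract f (S x) = S (hit (fun y => f (S y)) x).
Proof.
move=> lf; rewrite (ractE lf (cop_S x)) big_map /hit (islin_sum lin_S).
by apply: eq_bigr => p _; rewrite (islinZ lin_S).
Qed.

(** The antipode reverses the coproduct, so the criterion for one action becomes the criterion for
    the other. *)
Lemma Fs_S n x : Fs n x -> Fs n (S x).
Proof.
elim: n x => [|n IH] x; first by move=> ->; apply: islin0 lin_S.
move=> /(Fs_ractP Hc Hp) Fx; apply/(Fs_hitP Hc Hp) => f [lf f0].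
rewrite hit_S //; apply: IH; apply: Fx; split; first exact: islinf_comp.
by move=> y /F0_S; apply: f0.
Qed.

(** ** The bimodule of skew-primitives *)

Lemma hit_mulr f x w : gl w -> islinf f -> hit f (mul x w) = mul (hit (fun y => f (mul y w)) x) w.
Proof.
move=> [_ gw] lf; rewrite (hitE lf (teq2_mul (@teq2_refl _ _ (cop x)) gw)).
rewrite big_allpairs_dep /hit (islin_sum (lin_mull _)); apply: eq_bigr => p _.
by rewrite big_seq1 (islinZ (lin_mull _)).
Qed.

Lemma hit_mull f x w : gl w -> islinf f -> hit f (mul w x) = mul w (hit (fun y => f (mul w y)) x).
Proof.
move=> [_ gw] lf; rewrite (hitE lf (teq2_mul gw (@teq2_refl _ _ (cop x)))).
rewrite big_allpairs_dep big_seq1 /hit (islin_sum (lin_mulr _)); apply: eq_bigr => p _.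
by rewrite (islinZ (lin_mulr _)).
Qed.

Lemma ract_mulr f x w : gl w -> islinf f -> ract f (mul x w) = mul (ract
  (fun y => f (mul y w)) x) w.
Proof.
move=> [_ gw] lf; rewrite (ractE lf (teq2_mul (@teq2_refl _ _ (cop x)) gw)).
rewrite big_allpairs_dep /ract (islin_sum (lin_mull _)); apply: eq_bigr => p _.
by rewrite big_seq1 (islinZ (lin_mull _)).
Qed.

Lemma ract_mull f x w : gl w -> islinf f -> ract f (mul w x) = mul w (ract
  (fun y => f (mul w y)) x).
Proof.
move=> [_ gw] lf; rewrite (ractE lf (teq2_mul gw (@teq2_refl _ _ (cop x)))).
rewrite big_allpairs_dep big_seq1 /ract (islin_sum (lin_mulr _)); apply: eq_bigr => p _.
by rewrite (islinZ (lin_mulr _)).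
Qed.

Lemma sprim_mulr g h x w : gl w -> sprim g h x -> sprim (mul g w) (mul h w) (mul x w).
Proof.
move=> gw [Fx Hx]; have Fw := gl_F0 Hc Hp gw.
split; first by have := F_mul Fx Fw.
move=> f lf; have [H1 H2] := Hx _ (islinf_comp lf (lin_mull w)).
rewrite hit_mulr // ract_mulr //.
have := F0_mul H1 Fw; have := F0_mul H2 Fw.
by rewrite !(islinB (lin_mull _)) !(islinZ (lin_mull _)).
Qed.

Lemma sprim_mull g h x w : gl w -> sprim g h x -> sprim (mul w g) (mul w h) (mul w x).
Proof.
move=> gw [Fx Hx]; have Fw := gl_F0 Hc Hp gw.
split; first by have := F_mul Fw Fx.
move=> f lf; have [H1 H2] := Hx _ (islinf_comp lf (lin_mulr w)).
rewrite hit_mull // ract_mull //.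
have := F0_mul Fw H1; have := F0_mul Fw H2.
by rewrite !(islinB (lin_mulr _)) !(islinZ (lin_mulr _)).
Qed.

Lemma sprim_S g h x : sprim g h x -> sprim (S h) (S g) (S x).
Proof.
move=> [Fx Hx]; split; first exact: (@Fs_S 2).
move=> f lf; have [H1 H2] := Hx _ (islinf_comp lf lin_S).
rewrite hit_S // ract_S //; have := F0_S H1; have := F0_S H2.
by rewrite !(islinB lin_S) !(islinZ lin_S).
Qed.

(** * The Majid axioms on skew-primitives, modulo the coradical *)

Section SkewIdentities.
Variables (g h x : H).
Hypotheses (gg : gl g) (gh : gl h) (Hx : sprim g h x).

Let sx_hit f : islinf f -> F 0%N (hit f x - f h *: x).
Proof. by case: Hx => _ H' /H'[]. Qed.
Let sx_ract f : islinf f -> F 0%N (ract f x - f g *: x).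
Proof. by case: Hx => _ H' /H'[]. Qed.

Let cmp (u v u' v' : H) : u = v -> F 0%N (u - u') -> F 0%N (v - v') -> F 0%N (v' - u').
Proof.
move=> uv Hu Hv; have := subspaceB (sF 0) Hu Hv; rewrite uv.
by rewrite opprB addrC addrA subrK.
Qed.

(** In [quasi_assoc1], modulo [F 0], [hit] multiplies [x] by the value of the form at [h] and [ract]
    by its value at [g]. Translations are thus associative up to a quotient of two values of
    [phi]. *)
Lemma sprim_assocRR w u : gl w -> gl u ->
  F 0%N (phi g w u *: mul (mul x w) u - phi h w u *: mul x (mul w u)).
Proof.
move=> gw gu; apply: cmp (quasi_assoc1 x gw gu) _ _.
  have := F0_mul (sx_hit (lin_phi1 w u)) (gl_F0 Hc Hp (gl_mul gw gu)).
  by rewrite (islinB (lin_mull _)) (islinZ (lin_mull _)).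
have := F0_mul (F0_mul (sx_ract (lin_phi1 w u)) (gl_F0 Hc Hp gw)) (gl_F0 Hc Hp gu).
by rewrite !(islinB (lin_mull _)) !(islinZ (lin_mull _)).
Qed.

Lemma sprim_assocLR w u : gl w -> gl u ->
  F 0%N (phi w g u *: mul (mul w x) u - phi w h u *: mul w (mul x u)).
Proof.
move=> gw gu; apply: cmp (quasi_assoc2 x gw gu) _ _.
  have := F0_mul (gl_F0 Hc Hp gw) (F0_mul (sx_hit (lin_phi2 w u)) (gl_F0 Hc Hp gu)).
  by rewrite (islinB (lin_mull _)) (islinZ (lin_mull _)) (islinB (lin_mulr _))
    (islinZ (lin_mulr _)).
have := F0_mul (F0_mul (gl_F0 Hc Hp gw) (sx_ract (lin_phi2 w u))) (gl_F0 Hc Hp gu).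
by rewrite (islinB (lin_mulr _)) (islinZ (lin_mulr _)) (islinB (lin_mull _)) (islinZ (lin_mull _)).
Qed.

Lemma sprim_assocLL w u : gl w -> gl u ->
  F 0%N (phi w u g *: mul (mul w u) x - phi w u h *: mul w (mul u x)).
Proof.
move=> gw gu; apply: cmp (quasi_assoc3 x gw gu) _ _.
  have := F0_mul (gl_F0 Hc Hp gw) (F0_mul (gl_F0 Hc Hp gu) (sx_hit (lin_phi3 w u))).
  by rewrite !(islinB (lin_mulr _)) !(islinZ (lin_mulr _)).
have := F0_mul (gl_F0 Hc Hp (gl_mul gw gu)) (sx_ract (lin_phi3 w u)).
by rewrite (islinB (lin_mulr _)) (islinZ (lin_mulr _)).
Qed.

Variable dl : H -> H -> k.
Hypothesis ldl : forall g, islinf (dl g).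
Hypothesis dlE : forall g h, gl g -> gl h -> dl g h = (g == h)%:R.

(** Axiom (v) on a skew-primitive, whose coproduct is known modulo [F 0 (x) F 0]; its right-hand
    side is a multiple of [one] and disappears in the quotient. This is the antipode identity for a
    single arrow. *)
Lemma sprim_alpha : F 0%N (alpha g *: mul (S g) x + alpha h *: mul (S x) h).
Proof.
have := sprim_copsum Hc Hp ldl dlE (sF 0) bilin_alpha _ gg gh Hx.
rewrite swe2_alpha => E; have {E} := E _.
rewrite gl_hit // => E.
have Fo : F 0%N (alpha x *: one) by apply: (subspaceZ (sF 0)); apply: (gl_F0 Hc Hp).
have F1 : F 0%N (mul (S (alpha g *: g)) x + mul (S (hit alpha x)) h).
  apply: (subspace_eqmodr (sF 0) _ Fo); apply: E => y z Fy Fz; apply: F0_mul => //.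
  by apply: F0_S; apply: (@Fs_hit _ _ _ _ Hc Hp 1).
have F2 := F0_mul (F0_S (sx_hit lin_alpha)) (gl_F0 Hc Hp gh).
have := subspaceB (sF 0) F1 F2.
rewrite (islinB lin_S) !(islinZ lin_S) (islinB (lin_mull _)) !(islinZ (lin_mull _)).
by rewrite opprB -addrA [X in _ + X]addrC subrK.
Qed.

Lemma sprim_beta : F 0%N (beta g *: mul g (S x) + beta h *: mul x (S h)).
Proof.
have := sprim_copsum Hc Hp ldl dlE (sF 0) bilin_beta _ gg gh Hx.
rewrite swe2_beta => E; have {E} := E _.
rewrite gl_hit // => E.
have Fo : F 0%N (beta x *: one) by apply: (subspaceZ (sF 0)); apply: (gl_F0 Hc Hp).
have F1 : F 0%N (mul (beta g *: g) (S x) + mul (hit beta x) (S h)).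
  apply: (subspace_eqmodr (sF 0) _ Fo); apply: E => y z Fy Fz; apply: F0_mul => //.
    exact: (@Fs_hit _ _ _ _ Hc Hp 1).
  exact: F0_S.
have F2 := F0_mul (sx_hit lin_beta) (gl_F0 Hc Hp (gl_S gh)).
have := subspaceB (sF 0) F1 F2.
rewrite (islinB (lin_mull _)) !(islinZ (lin_mull _)).
by rewrite opprB -addrA [X in _ + X]addrC subrK.
Qed.

End SkewIdentities.
End Majid.

(** * Path coalgebras *)

Section FreeModule.
Variables (k : fieldType) (K : choiceType) (W : lmodType k).
Implicit Types (m : {malg k[K]}) (f : K -> W).

Definition mext f m : W := \sum_(e <- msupp m) m@_e *: f e.

Lemma mextE f m : mext f m = \sum_(e <- msupp m) m@_e *: f e.
Proof. by []. Qed.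

Lemma mextEw (D : {fset K}) f m : (msupp m `<=` D)%fset ->
  mext f m = \sum_(e <- D) m@_e *: f e.
Proof.
move=> /fsubsetP sD; rewrite /mext [RHS](bigID (mem (msupp m))) /=.
rewrite [X in _ = _ + X]big1 ?addr0; last first.
  by move=> e ne; rewrite mcoeff_outdom ?scale0r.
rewrite -[RHS]big_filter; apply: perm_big; apply: uniq_perm; rewrite ?filter_uniq // => e.
by rewrite mem_filter /=; symmetry; apply: andb_idr; apply: sD.
Qed.

Lemma islin_mext f : islin (mext f).
Proof.
move=> a x y; pose D := (msupp x `|` msupp y)%fset.
rewrite !(@mextEw D) ?fsubsetUl ?fsubsetUr //.
  by rewrite scaler_sumr -big_split /=; apply: eq_bigr => e _;
    rewrite mcoeffD mcoeffZ scalerDl scalerA.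
apply/fsubsetP => e; rewrite in_fsetU -!mcoeff_neq0 mcoeffD mcoeffZ.
by apply: contraR; rewrite negb_or !negbK => /andP[/eqP -> /eqP ->]; rewrite mulr0 addr0.
Qed.

Lemma mextU f e : mext f << e >> = f e.
Proof. by rewrite (mextEw _ (msuppU_le)) big_seq_fset1 mcoeffUU scale1r. Qed.

Lemma malg_sum m : m = \sum_(e <- msupp m) m@_e *: << e >>.
Proof.
rewrite {1}[m]monalgE; apply: eq_bigr => e _; apply/malgP => e'.
by rewrite mcoeffZ !mcoeffU mulrnAr mulr1.
Qed.

Lemma malg_lin_eq (F G : {malg k[K]} -> W) m : islin F -> islin G ->
  (forall e, m@_e != 0 -> F << e >> = G << e >>) -> F m = G m.
Proof.
move=> lF lG FG; rewrite [m]malg_sum !islin_sum //; apply: eq_big_seq => e.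
by rewrite -mcoeff_neq0 => /FG E; rewrite !islinZ // E.
Qed.

Lemma islin_mextf (U : lmodType k) (f : K -> U -> W) m :
  (forall e, islin (f e)) -> islin (fun x => mext (f^~ x) m).
Proof. by move=> lf; apply: islin_bigsum => e; apply: islin_scale. Qed.

End FreeModule.

Lemma islinf_mcoeff (k : fieldType) (K : choiceType) (e : K) :
  islinf (fun m : {malg k[K]} => m@_e).
Proof. by move=> a x y; rewrite mcoeffD mcoeffZ. Qed.

Lemma coassoc_teq3 (k : fieldType) (U : lmodType k) (cop : U -> seq (U * U)) a :
  (forall f g h : U -> k, islinf f -> islinf g -> islinf h ->
    \sum_(p <- cop a) \sum_(q <- cop p.2) f p.1 * g q.1 * h q.2 =
    \sum_(p <- cop a) \sum_(q <- cop p.1) f q.1 * g q.2 * h p.2) ->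
  teq3 [seq (p.1, q.1, q.2) | p <- cop a, q <- cop p.2]
       [seq (q.1, q.2, p.2) | p <- cop a, q <- cop p.1].
Proof.
by move=> H f g h lf lg lh; rewrite big_allpairs_dep [RHS]big_allpairs_dep; apply: H.
Qed.

Lemma teq2_allpairs (k : fieldType) (U : lmodType k) (r r1 r2 : seq (U * U)) (m : U -> U -> U) :
  (forall f g : U -> k, islinf f -> islinf g -> \sum_(p <- r) f p.1 * g p.2 =
     \sum_(p <- r1) \sum_(q <- r2) f (m p.1 q.1) * g (m p.2 q.2)) ->
  teq2 r [seq (m p.1 q.1, m p.2 q.2) | p <- r1, q <- r2].
Proof. by move=> H f g lf lg; rewrite big_allpairs_dep; apply: H. Qed.

Section Paths.
Variables (V E : choiceType) (s t : E -> V).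
Implicit Types (v w : V) (e a b : E) (p q : V * seq E).

Lemma pathb_cons v a l : pathb s t (v, a :: l) = (s a == v) && pathb s t (t a, l).
Proof.
rewrite /pathb /=; case: l => [|b l] /=; first by rewrite !andbT.
by rewrite [s b == t a]eq_sym.
Qed.

Lemma pend_cons v a l : pend t (v, a :: l) = pend t (t a, l).
Proof. by []. Qed.

Lemma pend_cat v l l' : pend t (v, l ++ l') = pend t (pend t (v, l), l').
Proof. by rewrite /pend /= map_cat last_cat. Qed.

Lemma pend_rcons v l e : pend t (v, rcons l e) = t e.
Proof. by rewrite /pend /= map_rcons last_rcons. Qed.

Lemma pathb_cat v l l' : pathb s t (v, l ++ l') =
  pathb s t (v, l) && pathb s t (pend t (v, l), l').
Proof. by elim: l v => [|a l IH] v //=; rewrite !pathb_cons IH andbA pend_cons. Qed.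

Lemma pathb_rcons v l e : pathb s t (v, rcons l e) =
  pathb s t (v, l) && (s e == pend t (v, l)).
Proof. by rewrite -cats1 pathb_cat pathb_cons andbT. Qed.

(* The pairs of paths [(x1, x2)] with concatenation the path [(v, l)]. *)
Fixpoint splits v (l : seq E) : seq ((V * seq E) * (V * seq E)) :=
  if l is a :: l' then
    ((v, l), (v, [::])) :: [seq (x.1, (v, a :: x.2.2)) | x <- splits (t a) l']
  else [:: ((v, [::]), (v, [::]))].

Lemma splitsE v l : splits v l =
  [seq ((pend t (v, take i l), drop i l), (v, take i l)) | i <- iota 0 (size l).+1].
Proof.
elim: l v => [|a l IH] v //; rewrite [LHS]/= IH.
rewrite -[X in _ = map _ X]/(0%N :: iota (1 + 0) (size l).+1) iotaDl map_cons -!map_comp.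
by congr (_ :: _); apply: eq_map.
Qed.

Lemma splitsP v l x : x \in splits v l ->
  [/\ x.2.1 = v, x.2.2 ++ x.1.2 = l & x.1.1 = pend t x.2].
Proof.
elim: l v x => [|a l IH] v x /=; first by rewrite inE => /eqP ->.
rewrite inE => /predU1P[-> //|/mapP[y /IH[y1 y2 y3] ->]] /=; split => //.
  by rewrite y2.
by rewrite y3 pend_cons -y1; case: (y.2).
Qed.

Lemma splits_path v l x : pathb s t (v, l) -> x \in splits v l ->
  pathb s t x.1 /\ pathb s t x.2.
Proof.
case: x => [[v1 l1] [v2 l2]] Pp /splitsP[/= v2v El ->]; move: Pp.
by rewrite -El v2v pathb_cat => /andP[-> ->].
Qed.

Lemma splits_coassoc (M : nmodType) (T : V * seq E -> V * seq E -> V * seq E -> M) v l :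
  \sum_(x <- splits v l) \sum_(y <- splits x.2.1 x.2.2) T x.1 y.1 y.2 =
  \sum_(x <- splits v l) \sum_(y <- splits x.1.1 x.1.2) T y.1 y.2 x.2.
Proof.
elim: l v T => [|a l IH] v T /=; first by rewrite !big_seq1.
rewrite big_cons big_map /= big_seq1 [RHS]big_cons big_map /= big_cons big_map -addrA /=;
  congr (_ + _).
under eq_bigr do rewrite big_cons big_map /=.
rewrite big_split /=; congr (_ + _).
rewrite -(IH (t a) (fun x y z => T x y (v, a :: z.2))).
by apply: eq_big_seq => x /splitsP[-> _ _].
Qed.

Lemma splits_counitl (M : nmodType) (T : V * seq E -> V * seq E -> M) v l :
  \sum_(x <- splits v l | nilp x.1.2) T x.1 x.2 = T (pend t (v, l), [::]) (v, l).
Proof.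
elim: l v T => [|a l IH] v T /=; first by rewrite big_cons big_nil /= addr0.
rewrite big_cons big_map /= (IH _ (fun x y => T x (v, a :: y.2))) //.
Qed.

Lemma splits_counitr (M : nmodType) (T : V * seq E -> V * seq E -> M) v l :
  \sum_(x <- splits v l | nilp x.2.2) T x.1 x.2 = T (v, l) (v, [::]).
Proof.
case: l => [|a l] /=; first by rewrite big_cons big_nil /= addr0.
by rewrite big_cons big_map /= big_pred0 ?addr0.
Qed.

End Paths.

Section PathCoalgebra.
Variables (k : fieldType) (V E : choiceType) (s t : E -> V).
Implicit Types (v w : V) (e a b : E) (p q : V * seq E).
Notation kQ := (kQ s t k).
Notation pathb := (pathb s t).
Notation pend := (pend t).
Notation splits := (splits t).
Notation pb := (@pb V E s t k).
Notation pcop := (@pcop V E s t k).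
Implicit Types (z : kQ).

(** Coefficients are indexed by all pairs, with value 0 off the paths, which keeps subtypes out of
    inductions on lists of arrows. *)
Definition co z p : k := if insub p is Some q then z@_(q : pathT s t) else 0.

Lemma coE z (q : pathT s t) : z@_q = co z (val q).
Proof. by rewrite /co valK. Qed.

Lemma islinf_co p : islinf (co^~ p).
Proof.
rewrite /co; case: insubP => [q _ _|_]; first exact: islinf_mcoeff.
by move=> a x y; rewrite mulr0 addr0.
Qed.

Lemma pb_path p (Pp : pathb p) : pb p = << (Sub p Pp : pathT s t) >>.
Proof. by rewrite /Defs.pb insubT. Qed.

Lemma pb_nonpath p : ~~ pathb p -> pb p = 0.
Proof. by move=> np; rewrite /Defs.pb insubN. Qed.

Lemma malgU_pb (q : pathT s t) : << q >> = pb (val q).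
Proof. by rewrite (pb_path (valP q)); congr (<< _ >>); apply: val_inj. Qed.

Lemma co_pb p q : pathb p -> co (pb q) p = (q == p)%:R.
Proof.
move=> Pp; rewrite /co insubT; have [Pq|nPq] := boolP (pathb q).
  by rewrite pb_path mcoeffU.
rewrite pb_nonpath // mcoeff0; case: eqP => // qp; by rewrite qp Pp in nPq.
Qed.

Lemma co_inj (x y : kQ) : (forall p, pathb p -> co x p = co y p) -> x = y.
Proof. by move=> H; apply/malgP => q; rewrite !coE; apply: H; apply: valP. Qed.

Definition kext (W : lmodType k) (f : V * seq E -> W) : kQ -> W :=
  mext (fun q : pathT s t => f (val q)).

Lemma islin_kext (W : lmodType k) (f : V * seq E -> W) : islin (kext f).
Proof. exact: islin_mext. Qed.

Lemma kext_pb (W : lmodType k) (f : V * seq E -> W) p : pathb p -> kext f (pb p) = f p.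
Proof. by move=> Pp; rewrite pb_path /kext mextU. Qed.

Lemma kextE (W : lmodType k) (f : V * seq E -> W) z :
  kext f z = \sum_(q <- msupp z) z@_q *: f (val q).
Proof. by []. Qed.

Lemma islin_kextf (U W : lmodType k) (f : V * seq E -> U -> W) z :
  (forall p, islin (f p)) -> islin (fun y => kext (f^~ y) z).
Proof. by move=> lf; apply: islin_bigsum => q; apply: islin_scale; apply: lf. Qed.

Lemma kQ_lin_eq (W : lmodType k) (F G : kQ -> W) z : islin F -> islin G ->
  (forall p, pathb p -> co z p != 0 -> F (pb p) = G (pb p)) -> F z = G z.
Proof.
move=> lF lG FG; apply: malg_lin_eq => // q zq.
by rewrite malgU_pb; apply: FG; [apply: valP | rewrite -coE].
Qed.

Lemma pcop_path_splits (q : pathT s t) :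
  pcop_path k q = [seq (pb x.1, pb x.2) | x <- splits (val q).1 (val q).2].
Proof. by rewrite splitsE -map_comp. Qed.

Lemma copsumE (W : lmodType k) (B : kQ -> kQ -> W) z : isbilin B ->
  \sum_(x <- pcop z) B x.1 x.2 =
  kext (fun p => \sum_(x <- splits p.1 p.2) B (pb x.1) (pb x.2)) z.
Proof.
move=> [B1 _]; rewrite /Defs.pcop big_allpairs_dep /=; apply: eq_bigr => q _.
rewrite pcop_path_splits big_map scaler_sumr; apply: eq_bigr => x _.
by rewrite (islinZ (B1 _)).
Qed.

Lemma copsum_pb (W : lmodType k) (B : kQ -> kQ -> W) p : isbilin B -> pathb p ->
  \sum_(x <- pcop (pb p)) B x.1 x.2 =
  \sum_(x <- splits p.1 p.2) B (pb x.1) (pb x.2).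
Proof. by move=> bB Pp; rewrite copsumE // kext_pb. Qed.

Lemma pepsE z : peps z = kext (fun p => (nilp p.2)%:R : k^o) z.
Proof.
rewrite /peps /kext /mext big_mkcond /=; apply: eq_bigr => q _.
by rewrite /plen /nilp; case: ifP => _; rewrite /GRing.scale /= ?mulr1 ?mulr0.
Qed.

Local Opaque Defs.pcop Defs.peps mext kext.

Lemma peps_pb p : pathb p -> peps (pb p) = (nilp p.2)%:R.
Proof. by move=> Pp; rewrite pepsE kext_pb. Qed.

Lemma islinf_peps : islinf (@peps V E s t k).
Proof. by move=> a x y; rewrite !pepsE; exact: (@islin_kext k^o _ a x y). Qed.

Lemma islin_kcopsum (W : lmodType k) (B : kQ -> kQ -> W) : isbilin B ->
  islin (fun z => \sum_(x <- pcop z) B x.1 x.2).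
Proof.
move=> bB; rewrite (funext (fun z => copsumE z bB)); exact: islin_kext.
Qed.

Lemma kQ_coalgebra : is_coalgebra pcop (@peps V E s t k).
Proof.
split.
- move=> a x y f g lf lg; have bfg := isbilin_mulf lf lg.
  have := islin_kcopsum bfg a x y => /= ->.
  rewrite big_cat big_map /= scaler_sumr; congr (_ + _).
  by apply: eq_bigr => p _; rewrite (islinfZ lf) -mulrA.
- exact: islinf_peps.
- move=> z; apply: coassoc_teq3 => f g h lf lg lh.
  have b01 y : isbilin (fun u w : kQ => f y * g u * h w : k^o).
    by split=> u a x z0; rewrite ?lg ?lh /GRing.scale /=; ring.
  have b02 y : isbilin (fun u w : kQ => f u * g w * h y : k^o).
    by split=> u a x z0; rewrite ?lf ?lg /GRing.scale /=; ring.
  have b1 : isbilin (fun x y => \sum_(q <- pcop y) (f x * g q.1 * h q.2) : k^o).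
    split=> y; last exact: (islin_kcopsum (b01 y)).
    by apply: islin_bigsum => q a u v; rewrite lf /GRing.scale /=; ring.
  have b2 : isbilin (fun x y => \sum_(q <- pcop x) (f q.1 * g q.2 * h y) : k^o).
    split=> y; first exact: (islin_kcopsum (b02 y)).
    by apply: islin_bigsum => q a u v; rewrite lh /GRing.scale /=; ring.
  apply: etrans (copsumE z b1) _; apply: etrans _ (esym (copsumE z b2)).
  apply: (@kQ_lin_eq k^o); try exact: islin_kext.
  move=> [v l] Pp _; rewrite !kext_pb //=.
  transitivity (\sum_(x <- splits v l) \sum_(y <- splits x.2.1 x.2.2)
     f (pb x.1) * g (pb y.1) * h (pb y.2)).
    apply: eq_big_seq => x /(splits_path Pp)[_ P2].
    exact: (copsum_pb (b01 (pb x.1)) P2).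
  rewrite (splits_coassoc t (fun x1 x2 x3 => f (pb x1) * g (pb x2) * h (pb x3))).
  apply: eq_big_seq => x /(splits_path Pp)[P1 _].
  exact: (esym (copsum_pb (b02 (pb x.2)) P1)).
move=> z; split.
  have b1 : isbilin (fun x y : kQ => peps x *: y).
    by apply: isbilin_ract; apply: islinf_peps.
  apply: etrans (copsumE z b1) _; apply: (@kQ_lin_eq kQ _ id) => //; first exact: islin_kext.
  move=> [v l] Pp _; rewrite kext_pb //=.
  rewrite (eq_big_seq (fun x => if nilp x.1.2 then pb x.2 else 0)).
    by rewrite -big_mkcond (splits_counitl t (fun x y => pb y)).
  move=> x /(splits_path Pp)[P1 _]; rewrite peps_pb //.
  by case: ifP => _; rewrite ?scale1r ?scale0r.
have b1 : isbilin (fun x y : kQ => peps y *: x).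
  by apply: isbilin_hit; apply: islinf_peps.
apply: etrans (copsumE z b1) _; apply: (@kQ_lin_eq kQ _ id) => //; first exact: islin_kext.
move=> [v l] Pp _; rewrite kext_pb //=.
rewrite (eq_big_seq (fun x => if nilp x.2.2 then pb x.1 else 0)).
  by rewrite -big_mkcond (splits_counitr t (fun x y => pb x)).
move=> x /(splits_path Pp)[_ P2]; rewrite peps_pb //.
by case: ifP => _; rewrite ?scale1r ?scale0r.
Qed.

(** ** Adding arrows at both ends of paths *)

Notation M := {malg k[E]}.
Implicit Types (m : M).

(** Paths are listed from their source: [prep e] adds an arrow before the start and [app e] one
    after the end, and paths that do not fit are sent to 0. *)
Definition prep e : kQ -> kQ := kext (fun p => if p.1 == t e then pb (s e, e :: p.2) else 0).
Definition app e : kQ -> kQ := kext (fun p => if pend p == s e then pb (p.1, rcons p.2 e) else 0).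
Definition Prep m z : kQ := mext (prep^~ z) m.
Definition App m z : kQ := mext (app^~ z) m.

Lemma lin_prep e : islin (prep e). Proof. exact: islin_kext. Qed.
Lemma lin_app e : islin (app e). Proof. exact: islin_kext. Qed.
Lemma lin_Prep m : islin (Prep m). Proof. by apply: islin_mextf => e; apply: lin_prep. Qed.
Lemma lin_App m : islin (App m). Proof. by apply: islin_mextf => e; apply: lin_app. Qed.
Lemma lin_Prepl z : islin (Prep^~ z). Proof. exact: islin_mext. Qed.
Lemma lin_Appl z : islin (App^~ z). Proof. exact: islin_mext. Qed.
Hint Resolve lin_prep lin_app lin_Prep lin_App lin_Prepl lin_Appl : core.

Lemma PrepU e z : Prep << e >> z = prep e z. Proof. exact: mextU. Qed.
Lemma AppU e z : App << e >> z = app e z. Proof. exact: mextU. Qed.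

Lemma prep_pb e v l : pathb (v, l) -> v = t e -> prep e (pb (v, l)) = pb (s e, e :: l).
Proof. by move=> Pp ve; rewrite /prep kext_pb //= ve eqxx. Qed.

Lemma app_pb e v l : pathb (v, l) -> pend (v, l) = s e -> app e (pb (v, l)) = pb (v, rcons l e).
Proof. by move=> Pp ve; rewrite /app kext_pb //= ve eqxx. Qed.

Lemma co_prep e z v c l : pathb (v, c :: l) ->
  co (prep e z) (v, c :: l) = (e == c)%:R * co z (t c, l).
Proof.
move=> Pp; apply: (@kQ_lin_eq k^o (fun z => co (prep e z) (v, c :: l))
  (fun z => (e == c)%:R * co z (t c, l))).
- exact: (islinf_comp (islinf_co _) (lin_prep e)).
- exact: islinf_mull (islinf_co _).
have := Pp; rewrite pathb_cons => /andP[/eqP sc Pl].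
move=> [w l'] Pq _; rewrite /prep kext_pb //= co_pb //.
case: ifP => [/eqP ->|wt].
  rewrite co_pb // !xpair_eqE eqseq_cons.
  have [->|_] := eqVneq e c; first by rewrite sc !eqxx mul1r.
  by rewrite /= andbF mul0r.
rewrite (islinf0 (islinf_co _)).
rewrite xpair_eqE; case: (eqVneq e c) => [<-|_]; last by rewrite mul0r.
by rewrite wt mulr0.
Qed.

Lemma co_prep_nil e z v : co (prep e z) (v, [::]) = 0.
Proof.
apply: (@kQ_lin_eq k^o (fun z => co (prep e z) (v, [::])) (fun z => 0)).
- exact: (islinf_comp (islinf_co _) (lin_prep e)).
- by move=> a x y; rewrite scaler0 addr0.
move=> [w l'] Pq _; rewrite /prep kext_pb //=; case: ifP => _;
  first by rewrite co_pb // xpair_eqE andbF.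
exact: (islinf0 (islinf_co _)).
Qed.

Lemma co_app e z v c l : pathb (v, rcons l c) ->
  co (app e z) (v, rcons l c) = (e == c)%:R * co z (v, l).
Proof.
move=> Pp; apply: (@kQ_lin_eq k^o (fun z => co (app e z) (v, rcons l c))
  (fun z => (e == c)%:R * co z (v, l))).
- exact: (islinf_comp (islinf_co _) (lin_app e)).
- exact: islinf_mull (islinf_co _).
have := Pp; rewrite pathb_rcons => /andP[Pl /eqP sc].
move=> [w l'] Pq _; rewrite /app kext_pb //= co_pb //.
case: ifP => [/eqP Ep|wt].
  rewrite co_pb // !xpair_eqE eqseq_rcons.
  by case: (w == v); case: (l' == l); case: (e == c); rewrite /= ?mul1r ?mul0r.
rewrite (islinf0 (islinf_co _)).
rewrite xpair_eqE; case: (eqVneq e c) => [ec|_]; last by rewrite mul0r.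
case: eqP => [wv|_] /=; last by rewrite mulr0.
case: eqP => [ll|_] /=; last by rewrite mulr0.
by move: wt; rewrite wv ll ec sc eqxx.
Qed.

Lemma co_app_nil e z v : co (app e z) (v, [::]) = 0.
Proof.
apply: (@kQ_lin_eq k^o (fun z => co (app e z) (v, [::])) (fun z => 0)).
- exact: (islinf_comp (islinf_co _) (lin_app e)).
- by move=> a x y; rewrite scaler0 addr0.
move=> [w l'] Pq _; rewrite /app kext_pb //=; case: ifP => _.
  by rewrite co_pb // xpair_eqE; case: l' {Pq} => [|? ?]; rewrite andbF.
exact: (islinf0 (islinf_co _)).
Qed.

Lemma co_mext_delta (c : E) m (a : k) :
  \sum_(e <- msupp m) m@_e * ((e == c)%:R * a) = m@_c * a.
Proof.
have lc : islinf (fun m : M => m@_c * a) by apply: islinf_mulr; apply: islinf_mcoeff.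
rewrite [in RHS](malg_sum m) (islinf_sum lc); apply: eq_bigr => e _.
by rewrite (islinfZ lc) mcoeffU.
Qed.

Lemma co_Prep m z v c l : pathb (v, c :: l) ->
  co (Prep m z) (v, c :: l) = m@_c * co z (t c, l).
Proof.
move=> Pp; rewrite /Prep mextE (islinf_sum (islinf_co _)).
rewrite -co_mext_delta; apply: eq_bigr => e _.
by rewrite (islinfZ (islinf_co _)) co_prep.
Qed.

Lemma co_Prep_nil m z v : co (Prep m z) (v, [::]) = 0.
Proof.
rewrite /Prep mextE (islinf_sum (islinf_co _)) big1 // => e _.
by rewrite (islinfZ (islinf_co _)) co_prep_nil mulr0.
Qed.

Lemma co_App m z v c l : pathb (v, rcons l c) ->
  co (App m z) (v, rcons l c) = m@_c * co z (v, l).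
Proof.
move=> Pp; rewrite /App mextE (islinf_sum (islinf_co _)).
rewrite -co_mext_delta; apply: eq_bigr => e _.
by rewrite (islinfZ (islinf_co _)) co_app.
Qed.

Lemma co_App_nil m z v : co (App m z) (v, [::]) = 0.
Proof.
rewrite /App mextE (islinf_sum (islinf_co _)) big1 // => e _.
by rewrite (islinfZ (islinf_co _)) co_app_nil mulr0.
Qed.

Lemma prep_app e e' z : prep e (app e' z) = app e' (prep e z).
Proof.
apply: (@kQ_lin_eq kQ (fun z => prep e (app e' z)) (fun z => app e' (prep e z))).
- exact: (islin_comp (lin_prep e) (lin_app e')).
- exact: (islin_comp (lin_app e') (lin_prep e)).
move=> [w l] Pq _; rewrite /prep /app !(kext_pb _ Pq) /=.
have [Ee|Ne] := eqVneq (pend (w, l)) (s e'); have [Ew|Nw] := eqVneq w (t e).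
- have Pr : pathb (w, rcons l e') by rewrite pathb_rcons Pq Ee eqxx.
  have Pc : pathb (s e, e :: l) by rewrite pathb_cons eqxx -Ew.
  by rewrite !kext_pb //= Ew eqxx pend_cons -Ew Ee eqxx.
- have Pr : pathb (w, rcons l e') by rewrite pathb_rcons Pq Ee eqxx.
  by rewrite kext_pb //= (negPf Nw) (islin0 (islin_kext _)).
- have Pc : pathb (s e, e :: l) by rewrite pathb_cons eqxx -Ew.
  by rewrite [RHS]kext_pb //= pend_cons -Ew (negPf Ne) (islin0 (islin_kext _)).
by rewrite !(islin0 (islin_kext _)).
Qed.

Local Opaque Prep App.

Lemma Prep_App m m' z : Prep m (App m' z) = App m' (Prep m z).
Proof.
apply: (@malg_lin_eq _ _ kQ (fun m => Prep m (App m' z)) (fun m => App m' (Prep m z))).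
- exact: lin_Prepl.
- exact: (islin_comp (lin_App m') (lin_Prepl z)).
move=> e _.
apply: (@malg_lin_eq _ _ kQ (fun m' => Prep << e >> (App m' z))
  (fun m' => App m' (Prep << e >> z))).
- exact: (islin_comp (lin_Prep _) (lin_Appl z)).
- exact: lin_Appl.
by move=> e' _; rewrite !PrepU !AppU prep_app.
Qed.

Local Opaque prep app Defs.pb.

(** The span of the arrows from [h] to [g], target first as in P_{g,h}. *)
Definition inM (g h : V) m := forall e, m@_e != 0 -> t e = g /\ s e = h.
Definition starts v z := forall p, pathb p -> co z p != 0 -> p.1 = v.
Definition ends v z := forall p, pathb p -> co z p != 0 -> pend p = v.
Definition deg n z := forall p, pathb p -> co z p != 0 -> size p.2 = n.

Lemma deg_homog n z : deg n z <-> homog n z.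
Proof.
split=> H.
  by move=> q; rewrite -mcoeff_neq0 coE; apply: H; apply: valP.
move=> p Pp; rewrite /co insubT => zp.
by apply: (H (Sub p Pp : pathT s t)); rewrite -mcoeff_neq0.
Qed.

Lemma inMU e : inM (t e) (s e) << e >>.
Proof. by move=> e'; rewrite mcoeffU; have [->|_] := eqVneq e e'; rewrite ?eqxx. Qed.

Lemma starts_pb v l : starts v (pb (v, l)).
Proof. by move=> q Pq; rewrite co_pb //; have [<-|_] := eqVneq _ q; rewrite ?eqxx. Qed.

Lemma ends_pb p : ends (pend p) (pb p).
Proof. by move=> q Pq; rewrite co_pb //; have [<-|_] := eqVneq _ q; rewrite ?eqxx. Qed.

Lemma deg_pb v l : deg (size l) (pb (v, l)).
Proof. by move=> q Pq; rewrite co_pb //; have [<-|_] := eqVneq _ q; rewrite ?eqxx. Qed.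

Lemma subspace_prop (Q : V * seq E -> Prop) :
  subspace (fun z => forall p, pathb p -> co z p != 0 -> Q p).
Proof.
split=> [p Pp|a x y Hx Hy p Pp]; first by rewrite (islinf0 (islinf_co _)) eqxx.
rewrite islinf_co; have [x0|/(Hx p Pp) //] := eqVneq (co x p) 0.
by rewrite x0 mulr0 add0r; apply: Hy.
Qed.

Lemma subspace_starts v : subspace (starts v).
Proof. exact: (subspace_prop (fun p => p.1 = v)). Qed.
Lemma subspace_deg n : subspace (deg n).
Proof. exact: (subspace_prop (fun p => size p.2 = n)). Qed.

Lemma starts_Prep g h m z : inM g h m -> starts h (Prep m z).
Proof.
move=> Hm [v [|c l]] Pp; first by rewrite co_Prep_nil eqxx.
rewrite co_Prep //; have := Pp; rewrite pathb_cons => /andP[/eqP <- _].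
by rewrite mulf_eq0 negb_or => /andP[/Hm[_ ->]].
Qed.

Lemma deg_Prep n m z : deg n z -> deg n.+1 (Prep m z).
Proof.
move=> Hz [v [|c l]] Pp; first by rewrite co_Prep_nil eqxx.
rewrite co_Prep //; have := Pp; rewrite pathb_cons => /andP[/eqP <- Pl].
by rewrite mulf_eq0 negb_or => /andP[_ /(Hz _ Pl) /= ->].
Qed.

Lemma ends_App g h m z : inM g h m -> ends g (App m z).
Proof.
move=> Hm [v l]; case/lastP: l => [|l c] Pp; first by rewrite co_App_nil eqxx.
by rewrite co_App // pend_rcons mulf_eq0 negb_or => /andP[/Hm[-> _]].
Qed.

Lemma starts_App v m z : starts v z -> starts v (App m z).
Proof.
move=> Hz [w l]; case/lastP: l => [|l c] Pp; first by rewrite co_App_nil eqxx.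
have := Pp; rewrite pathb_rcons => /andP[Pl _].
by rewrite co_App // mulf_eq0 negb_or => /andP[_ /(Hz _ Pl)].
Qed.

Lemma deg_App n m z : deg n z -> deg n.+1 (App m z).
Proof.
move=> Hz [w l]; case/lastP: l => [|l c] Pp; first by rewrite co_App_nil eqxx.
have := Pp; rewrite pathb_rcons => /andP[Pl _].
by rewrite co_App // mulf_eq0 negb_or size_rcons => /andP[_ /(Hz _ Pl) /= ->].
Qed.

Lemma islin_bilinr (W : lmodType k) (B : kQ -> kQ -> W) (f : kQ -> kQ) : isbilin B ->
  islin f -> isbilin (fun x y => B x (f y)).
Proof. by move=> [B1 B2] lf; split=> y; [apply: B1 | apply: (islin_comp (B2 _))]. Qed.

Lemma islin_bilinl (W : lmodType k) (B : kQ -> kQ -> W) (f : kQ -> kQ) : isbilin B ->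
  islin f -> isbilin (fun x y => B (f x) y).
Proof. by move=> [B1 B2] lf; split=> y; [apply: (islin_comp (B1 _)) | apply: B2]. Qed.

(** A path lengthened at its source is cut either at the new source [h] or at an old place, the
    initial part being lengthened in the latter case. This recursion carries the proof that the
    product respects coproducts. *)
Lemma copsum_Prep (W : lmodType k) (B : kQ -> kQ -> W) g h m z : isbilin B ->
  inM g h m -> starts g z ->
  \sum_(x <- pcop (Prep m z)) B x.1 x.2 =
  B (Prep m z) (pb (h, [::])) + \sum_(x <- pcop z) B x.1 (Prep m x.2).
Proof.
move=> bB Hm Hz; have [B1 B2] := bB.
apply: (@malg_lin_eq _ _ W (fun m => \sum_(x <- pcop (Prep m z)) B x.1 x.2)
  (fun m => B (Prep m z) (pb (h, [::])) + \sum_(x <- pcop z) B x.1 (Prep m x.2))).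
- exact: (islin_comp (islin_kcopsum bB) (lin_Prepl z)).
- apply: islin_add; first exact: (islin_comp (B1 _) (lin_Prepl z)).
  by apply: islin_bigsum => x; exact: (islin_comp (B2 _) (lin_Prepl _)).
move=> e /Hm[te se]; rewrite PrepU.
under [in X in _ = _ + X]eq_bigr do rewrite PrepU.
apply: (@kQ_lin_eq W (fun z => \sum_(x <- pcop (prep e z)) B x.1 x.2)
  (fun z => B (prep e z) (pb (h, [::])) + \sum_(x <- pcop z) B x.1 (prep e x.2))).
- exact: (islin_comp (islin_kcopsum bB) (lin_prep e)).
- apply: islin_add; first exact: (islin_comp (B1 _) (lin_prep e)).
  by apply: (islin_kcopsum (islin_bilinr bB (lin_prep e))).
move=> [v l] Pp zp; have := Hz _ Pp zp; rewrite /= => vg.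
have vt : v = t e by rewrite te vg.
have Pc : pathb (s e, e :: l) by rewrite pathb_cons eqxx -vt.
rewrite (prep_pb Pp vt); apply: etrans (copsum_pb bB Pc) _.
rewrite /= big_cons big_map se /=; congr (_ + _); apply: esym.
apply: etrans (copsum_pb (islin_bilinr bB (lin_prep e)) Pp) _.
rewrite /= -vt; apply: eq_big_seq => x xs; have [x1 _ _] := splitsP xs.
have [_ P2] := splits_path Pp xs.
case: (x.2) x1 P2 => v' l' /= v'v P2.
by rewrite prep_pb ?se // v'v.
Qed.

Lemma copsum_App (W : lmodType k) (B : kQ -> kQ -> W) g h m z : isbilin B ->
  inM g h m -> ends h z ->
  \sum_(x <- pcop (App m z)) B x.1 x.2 =
  B (pb (g, [::])) (App m z) + \sum_(x <- pcop z) B (App m x.1) x.2.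
Proof.
move=> bB Hm Hz; have [B1 B2] := bB.
apply: (@malg_lin_eq _ _ W (fun m => \sum_(x <- pcop (App m z)) B x.1 x.2)
  (fun m => B (pb (g, [::])) (App m z) + \sum_(x <- pcop z) B (App m x.1) x.2)).
- exact: (islin_comp (islin_kcopsum bB) (lin_Appl z)).
- apply: islin_add; first exact: (islin_comp (B2 _) (lin_Appl z)).
  by apply: islin_bigsum => x; exact: (islin_comp (B1 _) (lin_Appl _)).
move=> e /Hm[te se]; rewrite AppU.
under [in X in _ = _ + X]eq_bigr do rewrite AppU.
apply: (@kQ_lin_eq W (fun z => \sum_(x <- pcop (app e z)) B x.1 x.2)
  (fun z => B (pb (g, [::])) (app e z) + \sum_(x <- pcop z) B (app e x.1) x.2)).
- exact: (islin_comp (islin_kcopsum bB) (lin_app e)).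
- apply: islin_add; first exact: (islin_comp (B2 _) (lin_app e)).
  by apply: (islin_kcopsum (islin_bilinl bB (lin_app e))).
move=> [v l] Pp zp; have pe := Hz _ Pp zp.
have Pc : pathb (v, rcons l e) by rewrite pathb_rcons Pp se pe eqxx.
have ps : pend (v, l) = s e by rewrite se.
rewrite (app_pb Pp ps); apply: etrans (copsum_pb bB Pc) _.
apply: esym; apply: etrans (congr1 _ (copsum_pb (islin_bilinl bB (lin_app e)) Pp)) _.
(* The induction generalizes [B], into whose second argument the first arrow of the path is
   absorbed. *)
rewrite /= -te; elim: l v B bB B1 B2 Pp {zp pe} ps Pc => [|a l IH] v B bB B1 B2 Pp ps Pc.
  by rewrite /= big_seq1 big_cons big_seq1 /= (app_pb Pp ps) addrC.
have := Pp; rewrite pathb_cons => /andP[/eqP sa Pl].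
have Pc' : pathb (t a, rcons l e) by rewrite pathb_rcons Pl -ps pend_cons eqxx.
have bB' : isbilin (fun x y => B x (Prep << a >> y)) by apply: (islin_bilinr bB (lin_Prep _)).
have prE l0 x : pathb (t a, l0) -> x \in splits (t a) l0 ->
    pb (v, a :: x.2.2) = Prep << a >> (pb x.2).
  move=> Pl0 xs; have [x1 _ _] := splitsP xs; have [_ P2] := splits_path Pl0 xs.
  by case: (x.2) x1 P2 => v' l' /= -> P2; rewrite PrepU prep_pb // sa.
rewrite /= !big_cons !big_map /= (app_pb Pp ps) addrCA; congr (_ + _).
rewrite [RHS](eq_big_seq (fun x => B (pb x.1) (Prep << a >> (pb x.2)))); last first.
  by move=> x /(prE _ _ Pc') <-.
case: (bB') => B1' B2'; rewrite -(IH _ _ bB' B1' B2' Pl ps Pc'); congr (_ + _).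
  by rewrite PrepU (prep_pb Pc' erefl) sa.
by apply: eq_big_seq => x /(prE _ _ Pl) <-.
Qed.

End PathCoalgebra.
Arguments inMU k {V E} s t e [e'] _ : rename.

(* Unification should never unfold elements of the path coalgebra. *)
Local Opaque Defs.pcop Defs.peps Defs.pb kext prep app Prep App.

Lemma islinf_malgE (k : fieldType) (K : choiceType) (D : {fset K}) (f : {malg k[K]} -> k) z :
  islinf f -> (msupp z `<=` D)%fset -> f z = \sum_(i <- D) z@_i * f << i >>.
Proof.
move=> lf sD; rewrite -[RHS](@mextEw k K k^o D (fun i => f << i >>) z sD).
apply: (@malg_lin_eq k K k^o f _ z lf (@islin_mext _ _ _ _)) => e _.
exact: (esym (@mextU k K k^o (fun i => f << i >>) e)).
Qed.

Lemma malg_teq2 (k : fieldType) (K : choiceType) (s t : seq ({malg k[K]} * {malg k[K]})) :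
  (forall i j, \sum_(p <- s) p.1@_i * p.2@_j = \sum_(p <- t) p.1@_i * p.2@_j) -> teq2 s t.
Proof.
move=> H f g lf lg.
pose xs := flatten [seq (enum_fset (msupp p.1) ++ enum_fset (msupp p.2)) | p <- s ++ t].
pose D : {fset K} := [fset i in xs]%fset.
have HD p : p \in s ++ t -> (msupp p.1 `<=` D)%fset /\ (msupp p.2 `<=` D)%fset.
  move=> pst; split; apply/fsubsetP => i ip; rewrite in_fset.
    by apply/flatten_mapP; exists p => //; rewrite mem_cat ip.
  by apply/flatten_mapP; exists p => //; rewrite mem_cat ip orbT.
suff E r : {subset r <= s ++ t} -> \sum_(p <- r) f p.1 * g p.2 =
    \sum_(i <- D) \sum_(j <- D) (\sum_(p <- r) p.1@_i * p.2@_j) * (f << i >> * g << j >>).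
  rewrite (E s) ?(E t); try by move=> p pr; rewrite mem_cat pr ?orbT.
  by apply: eq_bigr => i _; apply: eq_bigr => j _; rewrite H.
move=> rst.
under [RHS]eq_bigr do under eq_bigr do rewrite mulr_suml.
under [RHS]eq_bigr do rewrite exchange_big /=.
rewrite exchange_big /=; apply: eq_big_seq => p /rst /HD[D1 D2].
rewrite (islinf_malgE lf D1) (islinf_malgE lg D2) mulr_suml; apply: eq_bigr => i _.
by rewrite mulr_sumr; apply: eq_bigr => j _; ring.
Qed.

(** The arrows satisfying [Q] span the independent family, so the exchange lemma injects its index
    set into them. Sets of arrows of any cardinality are compared in this way. *)
Lemma fiber_inj (k : fieldType) (E : choiceType) (Q : E -> Prop) (I : Type) (b : I -> {malg k[E]}) :
  (forall i e, (b i)@_e != 0 -> Q e) ->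
  (forall i, ~ spn (fun v => v = 0) (fun v => exists j, j <> i /\ v = b j) (b i)) ->
  exists f : I -> {e | Q e}, injective f.
Proof.
move=> bQ indep; have s0 := @subspace_eq0 k {malg k[E]}.
apply: (steinitz s0 (b' := fun x : {e | Q e} => << proj1_sig x >> : {malg k[E]}) indep) => i.
rewrite [b i]malg_sum; apply: (subspace_sum (subspace_spn _ s0)) => e.
rewrite -mcoeff_neq0 => /bQ Qe; apply: (subspaceZ (subspace_spn _ s0)).
by apply: spn_gen => //; exists (exist _ e Qe).
Qed.

(** * Coefficients of coproducts of paths *)

Section PathCoefficients.
Variables (k : fieldType) (V E : choiceType) (s t : E -> V).
Notation kQ := (kQ s t k).
Notation pathb := (pathb s t).
Notation pend := (pend t).
Notation splits := (splits t).
Notation pcop := (@pcop V E s t k).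

Lemma splits_coef v l (P Q : V * seq E) :
  \sum_(x <- splits v l) ((x.1 == P)%:R * (x.2 == Q)%:R : k) =
  (pend Q == P.1)%:R * ((v, l) == (Q.1, Q.2 ++ P.2))%:R.
Proof.
case: P => p l1; elim: l v Q => [|a l IH] v [q l2].
  rewrite /= big_seq1 /= !xpair_eqE /= -!natrM !mulnb; congr (_%:R); congr nat_of_bool.
  case: l2 => [|c l2]; last by rewrite !andbF.
  rewrite /= andbT /Defs.pend /=; have [->|_] := eqVneq v q; last by rewrite !andbF.
  by rewrite andbT.
rewrite /= big_cons big_map /=; case: l2 => [|c l2].
  rewrite big1 ?addr0 => [|x _]; last by rewrite [(v, _) == _]xpair_eqE andbF mulr0.
  rewrite !xpair_eqE /= andbT -!natrM !mulnb /Defs.pend /=; congr (_%:R); congr nat_of_bool.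
  have [->|_] := eqVneq v q; first by rewrite andbT.
  by rewrite !andbF.
rewrite [(v, [::]) == _]xpair_eqE andbF mulr0 add0r.
have E1 : \sum_(x <- splits (t a) l)
  ((x.1 == (p, l1))%:R * ((v, a :: x.2.2) == (q, c :: l2))%:R : k) =
    ((v == q) && (a == c))%:R *
    \sum_(x <- splits (t a) l) (x.1 == (p, l1))%:R * (x.2 == (t a, l2))%:R.
  rewrite mulr_sumr; apply: eq_big_seq => x /splitsP[x1 _ _].
  rewrite [in RHS](surjective_pairing x.2) x1 !xpair_eqE eqxx eqseq_cons /= andbA.
  by rewrite -!natrM !mulnb; congr (_%:R); congr nat_of_bool; rewrite andbCA.
rewrite E1 (IH (t a) (t a, l2)) /= !xpair_eqE eqxx eqseq_cons /= pend_cons.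
rewrite -!natrM !mulnb; congr (_%:R); congr nat_of_bool.
by have [->|_] := eqVneq a c; rewrite ?andbF //= andbT andbCA.
Qed.

(** Two composable paths form a cut of exactly one path, their concatenation. Together with
    [kQ_teq2] this reduces the coalgebra map property of the embedding to coefficients. *)
Lemma copsum_co (z : kQ) (P Q : V * seq E) : pathb P -> pathb Q ->
  \sum_(x <- pcop z) co x.1 P * co x.2 Q = (pend Q == P.1)%:R * co z (Q.1, Q.2 ++ P.2).
Proof.
move=> PP PQ.
have bc : isbilin (fun x y : kQ => co x P * co y Q : k^o).
  exact: (isbilin_mulf (islinf_co P) (islinf_co Q)).
apply: (@kQ_lin_eq k V E s t k^o (fun z => \sum_(x <- pcop z) co x.1 P * co x.2 Q)
  (fun z => (pend Q == P.1)%:R * co z (Q.1, Q.2 ++ P.2))).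
- exact: (islin_kcopsum bc).
- exact: (islinf_mull _ (islinf_co _)).
move=> [v l] Pp _; apply: etrans (copsum_pb bc Pp) _.
transitivity (\sum_(x <- splits v l) ((x.1 == P)%:R * (x.2 == Q)%:R : k)).
  by apply: eq_big_seq => x /(splits_path Pp)[P1 P2]; rewrite !co_pb.
rewrite splits_coef; have [E0|_] := eqVneq (pend Q) P.1; last by rewrite !mul0r.
rewrite co_pb // pathb_cat -surjective_pairing PQ E0 -surjective_pairing; exact: PP.
Qed.

Lemma kQ_teq2 (r r' : seq (kQ * kQ)) : (forall P Q, pathb P -> pathb Q ->
    \sum_(x <- r) co x.1 P * co x.2 Q = \sum_(x <- r') co x.1 P * co x.2 Q) ->
  teq2 r r'.
Proof.
move=> H; apply: malg_teq2 => i j.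
under eq_bigr do rewrite !coE.
under [RHS]eq_bigr do rewrite !coE.
by apply: H; apply: valP.
Qed.

Definition arrows : kQ -> {malg k[E]} :=
  kext (fun p => if p.2 is [:: a] then << a >> else 0).

Lemma lin_arrows : islin arrows. Proof. exact: (@islin_kext k V E s t). Qed.

Lemma arrowsE z a : (arrows z)@_a = co z (s a, [:: a]).
Proof.
apply: (@kQ_lin_eq k V E s t k^o (fun z => (arrows z)@_a) (fun z => co z (s a, [:: a]))).
- exact: (islinf_comp (islinf_mcoeff a) lin_arrows).
- exact: islinf_co.
move=> [w l] Pp _; rewrite /arrows kext_pb // co_pb; last by rewrite pathb_cons eqxx.
rewrite xpair_eqE /=; case: l Pp => [|b [|b' l]] Pp.
- by rewrite mcoeff0 andbF.
- move: Pp; rewrite pathb_cons => /andP[/eqP <- _].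
  rewrite mcoeffU eqseq_cons andbT.
  by have [->|_] := eqVneq b a; rewrite ?eqxx ?andbF.
by rewrite mcoeff0 eqseq_cons !andbF.
Qed.

End PathCoefficients.

(** * The Majid algebra structure defined by a bimodule of arrows *)

Local Opaque mext.

Lemma scale_sum4_eq (k : fieldType) (U : lmodType k) (a b : k) (x1 x2 x3 x4 y1 y2 y3 y4 : U) :
  a *: x1 = b *: y1 -> a *: x2 = b *: y2 -> a *: x3 = b *: y3 -> a *: x4 = b *: y4 ->
  a *: (x1 + x2 + x3 + x4) = b *: (y1 + y2 + y3 + y4).
Proof. by move=> E1 E2 E3 E4; rewrite !scalerDr E1 E2 E3 E4. Qed.

Lemma add3_eq (U : zmodType) (x1 x2 x3 y1 y2 y3 : U) :
  x1 = y1 -> x2 = y2 -> x3 = y3 -> x1 + x2 + x3 = y1 + y2 + y3.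
Proof. by move=> -> -> ->. Qed.

(** Meant for sums over the cuts of a path, where a term of one family cancels the term of the other
    at the next cut. *)
Lemma sum_cancel_shift (U : zmodType) (A C : nat -> U) n : A n = 0 -> C 0%N = 0 ->
  (forall i, (i < n)%N -> A i + C i.+1 = 0) ->
  \sum_(0 <= i < n.+1) A i + \sum_(0 <= i < n.+1) C i = 0.
Proof.
move=> An C0 AC; rewrite big_nat_recr //= [X in _ + X]big_nat_recl //= An C0 addr0 add0r.
by rewrite -big_split big_nat big1 // => i /AC.
Qed.

Section ArrowBimodule.
Variables (k : fieldType) (V E : choiceType) (s t : E -> V).
Implicit Types (v w u g h : V) (e a b : E) (l : seq E).
Notation kQ := (kQ s t k).
Notation pathb := (pathb s t).
Notation pend := (pend t).
Notation splits := (splits t).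
Notation pb := (@pb V E s t k).
Notation pcop := (@pcop V E s t k).
Notation M := {malg k[E]}.
Notation inM := (@inM k V E s t).
Notation inMU := (inMU k s t).
Notation Prep := (@Prep k V E s t).
Notation App := (@App k V E s t).
Implicit Types (z : kQ) (m : M).

Lemma big_splits_cons (N : nmodType) (T : (V * seq E) -> (V * seq E) -> N) v a l :
  \sum_(x <- splits v (a :: l)) T x.1 x.2 =
  T (v, a :: l) (v, [::]) + \sum_(x <- splits (t a) l) T x.1 (v, a :: x.2.2).
Proof. by rewrite /= big_cons big_map. Qed.

Lemma splits_rcons v l b : splits v (rcons l b) =
  rcons [seq ((x.1.1, rcons x.1.2 b), x.2) | x <- splits v l] ((t b, [::]), (v, rcons l b)).
Proof.
elim: l v => [|a l IH] v //=; rewrite IH map_rcons -!map_comp /=; congr (_ :: rcons _ _).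
Qed.

Lemma pb_Prep a v l : pathb (v, a :: l) -> pb (v, a :: l) = Prep << a >> (pb (t a, l)).
Proof.
by rewrite pathb_cons => /andP[/eqP <- Pl]; rewrite PrepU (prep_pb k Pl).
Qed.

(** A group [gm] of vertices, with right and left translations [ar], [al] and an antipode [sg] on
    combinations of arrows; [ph], [av], [bv] stand for Phi, alpha, beta on vertices. The hypotheses
    [arar], [aral], [alal] compare the two bracketings of an arrow with two vertices through the
    values of [ph] at its target and at its source; [sga] and [sgb] are axiom (v) for one arrow. *)
Variables (gm : V -> V -> V) (g1 : V) (gi : V -> V).
Variables (ar : M -> V -> M) (al : V -> M -> M) (sg : M -> M).
Variables (ph : V -> V -> V -> k) (av bv : V -> k).
Hypothesis gmA : forall u v w, gm u (gm v w) = gm (gm u v) w.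
Hypothesis gm1 : forall x, gm g1 x = x.
Hypothesis gx1 : forall x, gm x g1 = x.
Hypothesis gmV : forall x, gm (gi x) x = g1.
Hypothesis gVm : forall x, gm x (gi x) = g1.
Hypothesis lin_ar : forall w, islin (ar^~ w).
Hypothesis lin_al : forall w, islin (al w).
Hypothesis lin_sg : islin sg.
Hypothesis ar_in : forall g h w m, inM g h m -> inM (gm g w) (gm h w) (ar m w).
Hypothesis al_in : forall g h w m, inM g h m -> inM (gm w g) (gm w h) (al w m).
Hypothesis sg_in : forall g h m, inM g h m -> inM (gi h) (gi g) (sg m).
Hypothesis ar1 : forall m, ar m g1 = m.
Hypothesis al1 : forall m, al g1 m = m.
Hypothesis arar : forall g h m w u, inM g h m ->
  ph g w u *: ar (ar m w) u = ph h w u *: ar m (gm w u).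
Hypothesis aral : forall g h m w u, inM g h m ->
  ph w g u *: ar (al w m) u = ph w h u *: al w (ar m u).
Hypothesis alal : forall g h m w u, inM g h m ->
  ph w u g *: al (gm w u) m = ph w u h *: al w (al u m).
Hypothesis sga : forall g h m, inM g h m ->
  av g *: al (gi g) m + av h *: ar (sg m) h = 0.
Hypothesis sgb : forall g h m, inM g h m ->
  bv g *: al g (sg m) + bv h *: ar m (gi h) = 0.

Let linP m : islin (Prep m) := @lin_Prep k V E s t m.
Let linPl z : islin (Prep^~ z) := @lin_Prepl k V E s t z.
Let linA m : islin (App m) := @lin_App k V E s t m.
Let linAl z : islin (App^~ z) := @lin_Appl k V E s t z.

(** ** The quantum shuffle product *)

Section Kext2.
Variables (W : lmodType k).
Implicit Types (f : V * seq E -> V * seq E -> W).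

Definition kext2 f (x y : kQ) : W := kext (fun p => kext (f p) y) x.

Lemma kext_in (F : V * seq E -> W) (Q : W -> Prop) z : subspace Q ->
  (forall p, pathb p -> co z p != 0 -> Q (F p)) -> Q (@kext k V E s t W F z).
Proof.
move=> sQ H; rewrite kextE; apply: subspace_sum => // q; rewrite -mcoeff_neq0 coE => zq.
by apply: subspaceZ => //; apply: H => //; apply: valP.
Qed.

Lemma bilin_kext2 f : isbilin (kext2 f).
Proof.
split=> [y|x]; first exact: (@islin_kext k V E s t W (fun p => kext (f p) y)).
exact: (@islin_kextf k V E s t kQ W (fun p (y : kQ) => kext (f p) y) x
  (fun p => @islin_kext k V E s t W (f p))).
Qed.

Lemma kext2_pb f p q : pathb p -> pathb q -> kext2 f (pb p) (pb q) = f p q.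
Proof. by move=> Pp Pq; rewrite /kext2 (kext_pb _ Pp) (kext_pb _ Pq). Qed.

Lemma kext2_in f (Q : W -> Prop) x y : subspace Q ->
  (forall p q, pathb p -> pathb q -> co x p != 0 -> co y q != 0 -> Q (f p q)) ->
  Q (kext2 f x y).
Proof.
by move=> sQ H; apply: kext_in => // p Pp xp; apply: kext_in => // q Pq yq; apply: H.
Qed.

Lemma kQ_bilin_eq (F G : kQ -> kQ -> W) x y : isbilin F -> isbilin G ->
  (forall p q, pathb p -> pathb q -> co x p != 0 -> co y q != 0 ->
     F (pb p) (pb q) = G (pb p) (pb q)) -> F x y = G x y.
Proof.
move=> [F1 F2] [G1 G2] H.
apply: (kQ_lin_eq (F1 y) (G1 y)) => p Pp xp.
by apply: (kQ_lin_eq (F2 _) (G2 _)) => q Pq yq; apply: H.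
Qed.

End Kext2.

(* The first arrow of a product comes either from the left or from the right factor. *)
Fixpoint mulp v l : V -> seq E -> kQ :=
  fix mulr w l' : kQ :=
    (if l is a :: l1 then Prep (ar << a >> w) (mulp (t a) l1 w l') else 0) +
    (if l' is b :: l2 then Prep (al v << b >>) (mulr (t b) l2) else 0) +
    (if nilp l && nilp l' then pb (gm v w, [::]) else 0).

(** The product is cut into three by the origin of its first arrow: left factor, right factor, or
    none. The antipode identities treat the first two kinds of terms separately. *)
Definition mulpR v l w l' : kQ :=
  if l is a :: l1 then Prep (ar << a >> w) (mulp (t a) l1 w l') else 0.
Definition mulpL v l w l' : kQ :=
  if l' is b :: l2 then Prep (al v << b >>) (mulp v l (t b) l2) else 0.
Definition mulp0 v l w l' : kQ :=
  if nilp l && nilp l' then pb (gm v w, [::]) else 0.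

Lemma mulpE v l w l' : mulp v l w l' = mulpR v l w l' + mulpL v l w l' + mulp0 v l w l'.
Proof. by case: l => [|a l]; case: l'. Qed.

Lemma mulp_nn v w : mulp v [::] w [::] = pb (gm v w, [::]).
Proof. by rewrite mulpE /mulpR /mulpL /mulp0 /= !add0r. Qed.

Lemma mulp_cn v a l w : mulp v (a :: l) w [::] = Prep (ar << a >> w) (mulp (t a) l w [::]).
Proof. by rewrite mulpE /mulpR /mulpL /mulp0 /= !addr0. Qed.

Lemma mulp_nc v w b l : mulp v [::] w (b :: l) = Prep (al v << b >>) (mulp v [::] (t b) l).
Proof. by rewrite mulpE /mulpR /mulpL /mulp0 /= add0r addr0. Qed.

Lemma mulp_cc v a l w b l' : mulp v (a :: l) w (b :: l') =
  Prep (ar << a >> w) (mulp (t a) l w (b :: l')) + Prep (al v << b >>) (mulp v (a :: l) (t b) l').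
Proof. by rewrite mulpE /mulpR /mulpL /mulp0 /= addr0. Qed.

Local Opaque mulp.

Definition mulQ := kext2 (fun p q => mulp p.1 p.2 q.1 q.2).
Definition mulRQ := kext2 (fun p q => mulpR p.1 p.2 q.1 q.2).
Definition mulLQ := kext2 (fun p q => mulpL p.1 p.2 q.1 q.2).
Definition mul0Q := kext2 (fun p q => mulp0 p.1 p.2 q.1 q.2).

Lemma bilin_mulQ : isbilin mulQ. Proof. exact: bilin_kext2. Qed.
Lemma bilin_mulRQ : isbilin mulRQ. Proof. exact: bilin_kext2. Qed.
Lemma bilin_mulLQ : isbilin mulLQ. Proof. exact: bilin_kext2. Qed.
Lemma bilin_mul0Q : isbilin mul0Q. Proof. exact: bilin_kext2. Qed.

Lemma lin_mulQl y : islin (mulQ^~ y). Proof. by case: bilin_mulQ => + _; apply. Qed.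
Lemma lin_mulQr x : islin (mulQ x). Proof. by case: bilin_mulQ => _; apply. Qed.
Lemma lin_mulRQl y : islin (mulRQ^~ y). Proof. by case: bilin_mulRQ => + _; apply. Qed.
Lemma lin_mulRQr x : islin (mulRQ x). Proof. by case: bilin_mulRQ => _; apply. Qed.
Lemma lin_mulLQl y : islin (mulLQ^~ y). Proof. by case: bilin_mulLQ => + _; apply. Qed.
Lemma lin_mulLQr x : islin (mulLQ x). Proof. by case: bilin_mulLQ => _; apply. Qed.
Lemma lin_mul0Ql y : islin (mul0Q^~ y). Proof. by case: bilin_mul0Q => + _; apply. Qed.
Lemma lin_mul0Qr x : islin (mul0Q x). Proof. by case: bilin_mul0Q => _; apply. Qed.

Lemma mulQ_pb p q : pathb p -> pathb q -> mulQ (pb p) (pb q) = mulp p.1 p.2 q.1 q.2.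
Proof. exact: kext2_pb. Qed.
Lemma mulRQ_pb p q : pathb p -> pathb q -> mulRQ (pb p) (pb q) = mulpR p.1 p.2 q.1 q.2.
Proof. exact: kext2_pb. Qed.
Lemma mulLQ_pb p q : pathb p -> pathb q -> mulLQ (pb p) (pb q) = mulpL p.1 p.2 q.1 q.2.
Proof. exact: kext2_pb. Qed.
Lemma mul0Q_pb p q : pathb p -> pathb q -> mul0Q (pb p) (pb q) = mulp0 p.1 p.2 q.1 q.2.
Proof. exact: kext2_pb. Qed.

Lemma mulp_starts v l w l' : pathb (v, l) -> pathb (w, l') ->
  starts (gm v w) (mulp v l w l').
Proof.
move=> Pl Pl'; rewrite mulpE.
have sst := subspaceD (@subspace_starts k V E s t (gm v w)).
have st0 := subspace0 (@subspace_starts k V E s t (gm v w)).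
apply: (sst); first apply: (sst); rewrite /mulpR /mulpL /mulp0.
- case: l Pl => [_|a l]; first exact: st0.
  rewrite pathb_cons => /andP[/eqP <- _]; exact: (starts_Prep (ar_in (w := w) (inMU a))).
- case: l' Pl' => [_|b l']; first exact: st0.
  rewrite pathb_cons => /andP[/eqP <- _]; exact: (starts_Prep (al_in (w := v) (inMU b))).
by case: ifP => _; [apply: starts_pb | apply: st0].
Qed.

Lemma mulp_deg v l w l' : deg (size l + size l') (mulp v l w l').
Proof.
have [n] := ubnP (size l + size l')%N; elim: n => // n IH in v l w l' * => Hn.
rewrite mulpE.
have sst := subspaceD (@subspace_deg k V E s t (size l + size l')).
have st0 := subspace0 (@subspace_deg k V E s t (size l + size l')).
apply: (sst); first apply: (sst); rewrite /mulpR /mulpL /mulp0.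
- case: l Hn {sst} st0 => [_|a l Hn _]; first by apply.
  by apply: deg_Prep; apply: IH.
- case: l' Hn {sst} st0 => [_|b l' Hn _]; first by apply.
  by rewrite addnS; apply: deg_Prep; apply: IH; rewrite /= addnS in Hn.
case: l {Hn sst} st0 => [|? ?]; last by apply.
by case: l' => [_|? ?]; [apply: (@deg_pb k V E s t _ [::]) | apply].
Qed.

Lemma mulQ_deg i j x y : deg i x -> deg j y -> deg (i + j) (mulQ x y).
Proof.
move=> Hx Hy; apply: kext2_in; first exact: subspace_deg.
move=> [v' l] [w' l'] Pp Pq xp yq /=.
by rewrite -(Hx _ Pp xp) -(Hy _ Pq yq); apply: mulp_deg.
Qed.

Lemma mul0Q_Prepl m x y : mul0Q (Prep m x) y = 0.
Proof.
apply: (kext2_in (Q := fun z => z = 0)); first exact: subspace_eq0.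
by move=> [v [|a l]] q Pp _; rewrite ?co_Prep_nil ?eqxx.
Qed.

Lemma mul0Q_Prepr m x y : mul0Q x (Prep m y) = 0.
Proof.
apply: (kext2_in (Q := fun z => z = 0)); first exact: subspace_eq0.
move=> p [v [|a l]] _ Pp; rewrite ?co_Prep_nil ?eqxx // => _ _.
by rewrite /mulp0 /= andbF.
Qed.

Lemma mulRQ_deg0 x y : deg 0 x -> mulRQ x y = 0.
Proof.
move=> Hx; apply: (kext2_in (Q := fun z => z = 0)); first exact: subspace_eq0.
by move=> [v [|a l]] q Pp _ xp _ //; have := Hx _ Pp xp.
Qed.

Lemma mulLQ_deg0 x y : deg 0 y -> mulLQ x y = 0.
Proof.
move=> Hx; apply: (kext2_in (Q := fun z => z = 0)); first exact: subspace_eq0.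
by move=> p [v [|a l]] _ Pp _ xp //; have := Hx _ Pp xp.
Qed.

Lemma mulRQ_nil v y : mulRQ (pb (v, [::])) y = 0.
Proof. by apply: mulRQ_deg0; apply: (@deg_pb k V E s t _ [::]). Qed.

Lemma mulLQ_nil x w : mulLQ x (pb (w, [::])) = 0.
Proof. by apply: mulLQ_deg0; apply: (@deg_pb k V E s t _ [::]). Qed.

Lemma mul0Q_deg i j x y : deg i x -> deg j y -> (0 < i + j)%N -> mul0Q x y = 0.
Proof.
move=> Hx Hy ij; apply: (kext2_in (Q := fun z => z = 0)); first exact: subspace_eq0.
move=> p q Pp Pq xp yq; rewrite /mulp0 /nilp (Hx _ Pp xp) (Hy _ Pq yq).
by rewrite -addn_eq0; case: (i + j)%N ij.
Qed.

Local Opaque mulQ mulRQ mulLQ mul0Q.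

Lemma mulQ_decomp x y : mulQ x y = mulRQ x y + mulLQ x y + mul0Q x y.
Proof.
apply: (kQ_bilin_eq (F := mulQ) (G := fun x y => mulRQ x y + mulLQ x y + mul0Q x y)).
- exact: bilin_mulQ.
- split=> z; first exact: (islin_add (islin_add (lin_mulRQl z) (lin_mulLQl z)) (lin_mul0Ql z)).
  exact: (islin_add (islin_add (lin_mulRQr z) (lin_mulLQr z)) (lin_mul0Qr z)).
move=> p q Pp Pq _ _.
by rewrite (mulQ_pb Pp Pq) (mulRQ_pb Pp Pq) (mulLQ_pb Pp Pq) (mul0Q_pb Pp Pq) mulpE.
Qed.

(** The rule for the first arrow extends to combinations once end points are fixed, as the
    translation [ar m w] depends on the vertex where [y] starts. *)
Lemma mulRQ_Prep g h w m x y : inM g h m -> starts g x -> starts w y ->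
  mulRQ (Prep m x) y = Prep (ar m w) (mulQ x y).
Proof.
move=> Hm Hx Hy.
apply: (malg_lin_eq (F := fun m => mulRQ (Prep m x) y) (G := fun m => Prep (ar m w) (mulQ x y))).
- exact: (islin_comp (lin_mulRQl _) (linPl x)).
- exact: (islin_comp (linPl _) (lin_ar w)).
move=> e /Hm[te _].
apply: (kQ_bilin_eq (F := fun x y => mulRQ (Prep << e >> x) y)
  (G := fun x y => Prep (ar << e >> w) (mulQ x y))).
- split=> z; first exact: (islin_comp (lin_mulRQl _) (linP _)).
  exact: lin_mulRQr.
- split=> z; first exact: (islin_comp (linP _) (lin_mulQl _)).
  exact: (islin_comp (linP _) (lin_mulQr _)).
move=> [v l] [w' l'] Pp Pq xp yq.
have vt : v = t e by exact: etrans (Hx _ Pp xp) (esym te).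
have Pe : pathb (s e, e :: l) by rewrite pathb_cons eqxx -vt.
rewrite vt -(pb_Prep Pe) (mulRQ_pb Pe Pq) /mulpR /= -vt (mulQ_pb Pp Pq) /=.
by have /= -> := Hy _ Pq yq.
Qed.

Lemma mulLQ_Prep g h v m x y : inM g h m -> starts v x -> starts g y ->
  mulLQ x (Prep m y) = Prep (al v m) (mulQ x y).
Proof.
move=> Hm Hx Hy.
apply: (malg_lin_eq (F := fun m => mulLQ x (Prep m y)) (G := fun m => Prep (al v m) (mulQ x y))).
- exact: (islin_comp (lin_mulLQr _) (linPl y)).
- exact: (islin_comp (linPl _) (lin_al v)).
move=> e /Hm[te _].
apply: (kQ_bilin_eq (F := fun x y => mulLQ x (Prep << e >> y))
  (G := fun x y => Prep (al v << e >>) (mulQ x y))).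
- split=> z; first exact: lin_mulLQl.
  exact: (islin_comp (lin_mulLQr _) (linP _)).
- split=> z; first exact: (islin_comp (linP _) (lin_mulQl _)).
  exact: (islin_comp (linP _) (lin_mulQr _)).
move=> [v' l] [w' l'] Pp Pq xp yq.
have wt : w' = t e by exact: etrans (Hy _ Pq yq) (esym te).
have Pe : pathb (s e, e :: l') by rewrite pathb_cons eqxx -wt.
rewrite wt -(pb_Prep Pe) (mulLQ_pb Pp Pe) /mulpL /= -wt (mulQ_pb Pp Pq) /=.
by have /= -> := Hx _ Pp xp.
Qed.

Lemma mulp_unitl w l : pathb (w, l) -> mulp g1 [::] w l = pb (w, l).
Proof.
elim: l w => [|a l IH] w Pl; first by rewrite mulp_nn gm1.
rewrite mulp_nc al1 (pb_Prep Pl).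
by move: Pl; rewrite pathb_cons => /andP[_ /IH ->].
Qed.

Lemma mulp_unitr v l : pathb (v, l) -> mulp v l g1 [::] = pb (v, l).
Proof.
elim: l v => [|a l IH] v Pl; first by rewrite mulp_nn gx1.
rewrite mulp_cn ar1 (pb_Prep Pl).
by move: Pl; rewrite pathb_cons => /andP[_ /IH ->].
Qed.

Lemma mulQ_unitl z : mulQ (pb (g1, [::])) z = z.
Proof.
apply: (kQ_lin_eq (lin_mulQr _) (@islin_id k kQ)) => -[w l] Pl _.
by rewrite mulQ_pb //= mulp_unitl.
Qed.

Lemma mulQ_unitr z : mulQ z (pb (g1, [::])) = z.
Proof.
apply: (kQ_lin_eq (lin_mulQl _) (@islin_id k kQ)) => -[w l] Pl _.
by rewrite mulQ_pb //= mulp_unitr.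
Qed.

(** ** Multiplicativity of the coproduct *)

Notation mp p q := (mulp p.1 p.2 q.1 q.2).

(** A double induction on the two words by [copsum_Prep]. The statement is for all [B], because the
    arrow put in front is absorbed into the second argument of [B]. *)
Lemma copsum_mulp (W : lmodType k) (B : kQ -> kQ -> W) v l w l' : isbilin B ->
  pathb (v, l) -> pathb (w, l') ->
  \sum_(x <- pcop (mulp v l w l')) B x.1 x.2 =
  \sum_(x <- splits v l) \sum_(y <- splits w l') B (mp x.1 y.1) (mp x.2 y.2).
Proof.
elim: l v w l' B => [|a l IHl] v w l' B.
  elim: l' w B => [|b l' IHl'] w B bB Pl Pl'.
    rewrite mulp_nn; apply: etrans (copsum_pb bB _) _; first by [].
    by rewrite /= !big_seq1 /= !mulp_nn.
  have := Pl'; rewrite pathb_cons => /andP[/eqP sb Pl2].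
  rewrite mulp_nc; have Hin := al_in (w := v) (inMU b).
  apply: etrans (copsum_Prep bB Hin (mulp_starts Pl Pl2)) _.
  rewrite (IHl' _ _ (islin_bilinr bB (linP (al v << b >>))) Pl Pl2) /= !big_seq1 /=.
  rewrite big_cons big_map /= mulp_nn mulp_nc sb; congr (_ + _).
  by apply: eq_big_seq => y /splitsP[-> _ _]; rewrite mulp_nc.
elim: l' w B => [|b l' IHl'] w B bB Pl Pl'.
  have := Pl; rewrite pathb_cons => /andP[/eqP sa Pl2].
  rewrite mulp_cn; have Hin := ar_in (w := w) (inMU a).
  apply: etrans (copsum_Prep bB Hin (mulp_starts Pl2 Pl')) _.
  rewrite (IHl _ _ _ _ (islin_bilinr bB (linP (ar << a >> w))) Pl2 Pl') /=.
  rewrite big_cons big_map /= !big_seq1 /= mulp_nn mulp_cn sa; congr (_ + _).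
  by apply: eq_big_seq => x /splitsP[-> _ _]; rewrite !big_seq1 /= mulp_cn.
have := Pl; rewrite pathb_cons => /andP[/eqP sa Pl2].
have := Pl'; rewrite pathb_cons => /andP[/eqP sb Pl2'].
have Hina := ar_in (w := w) (inMU a); have Hinb := al_in (w := v) (inMU b).
rewrite mulp_cc.
apply: etrans (islinD (islin_kcopsum bB) _ _) _.
have E1 := etrans (copsum_Prep bB Hina (mulp_starts Pl2 Pl'))
  (congr1 (+%R _) (IHl _ _ _ _ (islin_bilinr bB (linP (ar << a >> w))) Pl2 Pl')).
have E2 := etrans (copsum_Prep bB Hinb (mulp_starts Pl Pl2'))
  (congr1 (+%R _) (IHl' _ _ (islin_bilinr bB (linP (al v << b >>))) Pl Pl2')).
apply: etrans (congr2 +%R E1 E2) _ => {E1 E2}.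
case: (bB) => B1 B2.
(* The two terms that cut at the starting vertex add up to the whole product; the others are matched
   with pairs of cuts according to which of the two cuts is trivial. *)
rewrite addrACA sa sb -(islinD (B1 _)) -mulp_cc.
rewrite [splits v (a :: l)]/= [splits w (b :: l')]/= !(big_cons, big_map) /= mulp_nn.
rewrite -addrA; congr (_ + _); rewrite addrCA; congr (_ + _).
  by apply: eq_big_seq => y /splitsP[-> _ _]; rewrite mulp_nc.
rewrite -big_split /=; apply: eq_big_seq => x /splitsP[-> _ _] /=.
rewrite !(big_cons, big_map) /= mulp_cn -!addrA; congr (_ + _).
rewrite -big_split /=; apply: eq_big_seq => y /splitsP[-> _ _] /=.
by rewrite mulp_cc (islinD (B2 _)).
Qed.

Lemma cop_mulQ x y : teq2 (pcop (mulQ x y))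
  [seq (mulQ p.1 q.1, mulQ p.2 q.2) | p <- pcop x, q <- pcop y].
Proof.
apply: teq2_allpairs => f g lf lg; have bfg := isbilin_mulf lf lg.
have b1 x' y' : isbilin (fun u v : kQ => f (mulQ x' u) * g (mulQ y' v) : k^o).
  exact: (isbilin_mulf (islinf_comp lf (lin_mulQr _)) (islinf_comp lg (lin_mulQr _))).
have b2 y' : isbilin (fun u v : kQ => \sum_(q <- pcop y') f (mulQ u q.1) * g (mulQ v q.2) : k^o).
  split=> z; apply: islin_bigsum => q.
    exact: (islinf_mulr _ (islinf_comp lf (lin_mulQl _))).
  exact: (islinf_mull _ (islinf_comp lg (lin_mulQl _))).
apply: (@kQ_bilin_eq k^o (fun x y => \sum_(p <- pcop (mulQ x y)) f p.1 * g p.2)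
  (fun x y => \sum_(p <- pcop x) \sum_(q <- pcop y) f (mulQ p.1 q.1) * g (mulQ p.2 q.2))).
- split=> z; first exact: (islin_comp (islin_kcopsum bfg) (lin_mulQl _)).
  exact: (islin_comp (islin_kcopsum bfg) (lin_mulQr _)).
- split=> z; first exact: (islin_kcopsum (b2 z)).
  by apply: islin_bigsum => p; exact: (islin_kcopsum (b1 _ _)).
move=> [v l] [w l'] Pp Pq _ _; rewrite (mulQ_pb Pp Pq).
apply: etrans (copsum_mulp bfg Pp Pq) _; apply: esym.
apply: etrans (copsum_pb (b2 _) Pp) _; apply: eq_big_seq => x1 /(splits_path Pp)[P1 P2].
apply: etrans (copsum_pb (b1 _ _) Pq) _; apply: eq_big_seq => y1 /(splits_path Pq)[Q1 Q2].
by rewrite (mulQ_pb P1 Q1) (mulQ_pb P2 Q2).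
Qed.

(** ** Quasi-associativity *)

(** The first arrow of a triple product comes from one of the three factors and is translated by the
    starting vertices of the other two. [mulQ3r] is the same recursion for the other bracketing. *)
Lemma mulQ3l v l w l' u l'' : pathb (v, l) -> pathb (w, l') -> pathb (u, l'') ->
  mulQ (mulp v l w l') (pb (u, l'')) =
    (if l is a :: l1 then Prep (ar (ar << a >> w) u) (mulQ (mulp (t a) l1 w l')
      (pb (u, l''))) else 0)
  + (if l' is b :: l2 then Prep (ar (al v << b >>) u) (mulQ (mulp v l (t b) l2)
    (pb (u, l''))) else 0)
  + (if l'' is c :: l3 then Prep (al (gm v w) << c >>) (mulQ (mulp v l w l') (pb (t c, l3))) else 0)
  + (if [&& nilp l, nilp l' & nilp l''] then pb (gm (gm v w) u, [::]) else 0).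
Proof.
move=> Pl Pl' Pl''.
have EL : mulLQ (mulp v l w l') (pb (u, l'')) =
    (if l'' is c :: l3 then Prep (al (gm v w) << c >>) (mulQ (mulp v l w l')
      (pb (t c, l3))) else 0).
  case: l'' Pl'' => [|c l3] Pl''; first exact: mulLQ_nil.
  rewrite (pb_Prep Pl''); apply: (mulLQ_Prep (inMU c) (mulp_starts Pl Pl')).
  exact: starts_pb.
have Su := @starts_pb k V E s t u l''.
rewrite mulQ_decomp EL addrAC [RHS]addrAC; congr (_ + _).
rewrite mulpE !(islinD (lin_mulRQl _)) !(islinD (lin_mul0Ql _)).
have -> : mul0Q (mulpR v l w l') (pb (u, l'')) = 0.
  rewrite /mulpR; case: (l) => [|a l1]; [exact: (islin0 (lin_mul0Ql _)) | exact: mul0Q_Prepl].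
have -> : mul0Q (mulpL v l w l') (pb (u, l'')) = 0.
  rewrite /mulpL; case: (l') => [|a l1]; [exact: (islin0 (lin_mul0Ql _)) | exact: mul0Q_Prepl].
have -> : mulRQ (mulp0 v l w l') (pb (u, l'')) = 0.
  rewrite /mulp0; case: ifP => _; [exact: mulRQ_nil | exact: (islin0 (lin_mulRQl _))].
rewrite addr0 !add0r; apply: add3_eq.
- rewrite /mulpR; case: l Pl {EL} => [|a l] Pl; first exact: (islin0 (lin_mulRQl _)).
  have := Pl; rewrite pathb_cons => /andP[_ Pl2].
  exact: (mulRQ_Prep (ar_in (w := w) (inMU a)) (mulp_starts Pl2 Pl') Su).
- rewrite /mulpL; case: l' Pl' {EL} => [|b l'] Pl'; first exact: (islin0 (lin_mulRQl _)).
  have := Pl'; rewrite pathb_cons => /andP[_ Pl2].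
  exact: (mulRQ_Prep (al_in (w := v) (inMU b)) (mulp_starts Pl Pl2) Su).
rewrite /mulp0; case: l {Pl EL} => [|? ?] /=; last exact: (islin0 (lin_mul0Ql _)).
case: l' {Pl'} => [|? ?] /=; last exact: (islin0 (lin_mul0Ql _)).
by rewrite mul0Q_pb.
Qed.

Lemma mulQ3r v l w l' u l'' : pathb (v, l) -> pathb (w, l') -> pathb (u, l'') ->
  mulQ (pb (v, l)) (mulp w l' u l'') =
    (if l is a :: l1 then Prep (ar << a >> (gm w u)) (mulQ (pb (t a, l1)) (mulp w l' u l'')) else 0)
  + (if l' is b :: l2 then Prep (al v (ar << b >> u)) (mulQ (pb (v, l))
    (mulp (t b) l2 u l'')) else 0)
  + (if l'' is c :: l3 then Prep (al v (al w << c >>)) (mulQ (pb (v, l))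
    (mulp w l' (t c) l3)) else 0)
  + (if [&& nilp l, nilp l' & nilp l''] then pb (gm v (gm w u), [::]) else 0).
Proof.
move=> Pl Pl' Pl''.
have ER : mulRQ (pb (v, l)) (mulp w l' u l'') =
    (if l is a :: l1 then Prep (ar << a >> (gm w u)) (mulQ (pb (t a, l1))
      (mulp w l' u l'')) else 0).
  case: l Pl => [|c l3] Pl; first exact: mulRQ_nil.
  rewrite (pb_Prep Pl); apply: (mulRQ_Prep (inMU c) _ (mulp_starts Pl' Pl'')).
  exact: starts_pb.
have Su := @starts_pb k V E s t v l.
rewrite mulQ_decomp ER -!addrA; congr (_ + _).
rewrite mulpE !(islinD (lin_mulLQr _)) !(islinD (lin_mul0Qr _)).
have -> : mul0Q (pb (v, l)) (mulpR w l' u l'') = 0.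
  rewrite /mulpR; case: (l') => [|a l1]; [exact: (islin0 (lin_mul0Qr _)) | exact: mul0Q_Prepr].
have -> : mul0Q (pb (v, l)) (mulpL w l' u l'') = 0.
  rewrite /mulpL; case: (l'') => [|a l1]; [exact: (islin0 (lin_mul0Qr _)) | exact: mul0Q_Prepr].
have -> : mulLQ (pb (v, l)) (mulp0 w l' u l'') = 0.
  rewrite /mulp0; case: ifP => _; [exact: mulLQ_nil | exact: (islin0 (lin_mulLQr _))].
rewrite addr0 !add0r addrA; apply: add3_eq.
- rewrite /mulpR; case: l' Pl' {ER} => [|b l'] Pl'; first exact: (islin0 (lin_mulLQr _)).
  have := Pl'; rewrite pathb_cons => /andP[_ Pl2].
  exact: (mulLQ_Prep (ar_in (w := u) (inMU b)) Su (mulp_starts Pl2 Pl'')).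
- rewrite /mulpL; case: l'' Pl'' {ER} => [|c l''] Pl''; first exact: (islin0 (lin_mulLQr _)).
  have := Pl''; rewrite pathb_cons => /andP[_ Pl2].
  exact: (mulLQ_Prep (al_in (w := w) (inMU c)) Su (mulp_starts Pl' Pl2)).
rewrite /mulp0; case: l' {Pl' ER} => [|? ?] /=; last by rewrite andbF (islin0 (lin_mul0Qr _)).
case: l'' {Pl''} => [|? ?] /=; last by rewrite andbF (islin0 (lin_mul0Qr _)).
by rewrite andbT mul0Q_pb // /mulp0 /= andbT.
Qed.

(** Axiom (i) on paths, where [phi] only sees end points on one side and starting points on the
    other. By induction on the total length: removing the first arrow moves the starting point to
    its target, and the bimodule identities trade the value of [ph] there for the value at its
    source. *)
Lemma mulp_quasi_assoc v l w l' u l'' : pathb (v, l) -> pathb (w, l') -> pathb (u, l'') ->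
  ph (pend (v, l)) (pend (w, l')) (pend (u, l'')) *: mulQ (mulp v l w l') (pb (u, l'')) =
  ph v w u *: mulQ (pb (v, l)) (mulp w l' u l'').
Proof.
suff H n : (size l + size l' + size l'' < n)%N -> pathb (v, l) -> pathb (w, l') -> pathb (u, l'') ->
    ph (pend (v, l)) (pend (w, l')) (pend (u, l'')) *: mulQ (mulp v l w l') (pb (u, l'')) =
    ph v w u *: mulQ (pb (v, l)) (mulp w l' u l'') by exact: (H _ (ltnSn _)).
elim: n v l w l' u l'' => [|n IH] v l w l' u l'' Hn Pl Pl' Pl''.
  exact: (False_ind _ (notF Hn)).
apply: etrans (congr1 ( *:%R _) (mulQ3l Pl Pl' Pl'')) _.
apply: etrans _ (esym (congr1 ( *:%R _) (mulQ3r Pl Pl' Pl''))).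
apply: scale_sum4_eq.
- case: l Hn Pl => [|a l] Hn Pl; first by rewrite !scaler0.
  have := Pl; rewrite pathb_cons => /andP[/eqP sa Pl2].
  rewrite -(islinZ (linP _)) pend_cons (IH _ _ _ _ _ _ _ Pl2 Pl' Pl''); last by [].
  rewrite (islinZ (linP _)) -(islinZ (linPl _)) -(islinZ (linPl _)).
  by rewrite (arar _ _ (inMU a)) sa.
- case: l' Hn Pl' => [|b l'] Hn Pl'; first by rewrite !scaler0.
  have := Pl'; rewrite pathb_cons => /andP[/eqP sb Pl2].
  rewrite -(islinZ (linP _)) pend_cons (IH _ _ _ _ _ _ _ Pl Pl2 Pl''); last first.
    by move: Hn; rewrite /= addnS.
  rewrite (islinZ (linP _)) -(islinZ (linPl _)) -(islinZ (linPl _)).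
  by rewrite (aral _ _ (inMU b)) sb.
- case: l'' Hn Pl'' => [|c l''] Hn Pl''; first by rewrite !scaler0.
  have := Pl''; rewrite pathb_cons => /andP[/eqP sc Pl2].
  rewrite -(islinZ (linP _)) pend_cons (IH _ _ _ _ _ _ _ Pl Pl' Pl2); last first.
    by move: Hn; rewrite /= addnS.
  rewrite (islinZ (linP _)) -(islinZ (linPl _)) -(islinZ (linPl _)).
  by rewrite (alal _ _ (inMU c)) sc.
case: l {Hn Pl} => [|? ?]; last by rewrite /= !scaler0.
case: l' {Pl'} => [|? ?]; last by rewrite /= !scaler0.
case: l'' {Pl''} => [|? ?]; last by rewrite /= !scaler0.
by rewrite /= gmA.
Qed.

(** ** The antipode *)

Fixpoint Sp v l : kQ :=
  if l is a :: l' then App (sg << a >>) (Sp (t a) l') else pb (gi v, [::]).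

Definition SQ : kQ -> kQ := kext (fun p => Sp p.1 p.2).

Lemma lin_SQ : islin SQ. Proof. exact: (@islin_kext k V E s t kQ). Qed.

Lemma SQ_pb p : pathb p -> SQ (pb p) = Sp p.1 p.2. Proof. exact: kext_pb. Qed.

Lemma Sp_starts v l : starts (gi (pend (v, l))) (Sp v l).
Proof.
elim: l v => [|a l IH] v /=; first exact: starts_pb.
by apply: starts_App; rewrite pend_cons; apply: IH.
Qed.

Lemma Sp_ends v l : pathb (v, l) -> ends (gi v) (Sp v l).
Proof.
case: l => [|a l] /=; first by move=> _; apply: (@ends_pb k V E s t (gi v, [::])).
rewrite pathb_cons => /andP[/eqP <- _].
exact: (ends_App (sg_in (inMU a))).
Qed.

Lemma Sp_deg v l : deg (size l) (Sp v l).
Proof.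
elim: l v => [|a l IH] v /=; first exact: (@deg_pb k V E s t _ [::]).
exact: deg_App.
Qed.

Lemma SQ_deg n z : deg n z -> deg n (SQ z).
Proof.
move=> Hz; apply: kext_in; first exact: subspace_deg.
by move=> [v l] Pp zp /=; rewrite -(Hz _ Pp zp); apply: Sp_deg.
Qed.

Local Opaque SQ.

Lemma App_Prep1 g h m : inM g h m -> App m (pb (h, [::])) = Prep m (pb (g, [::])).
Proof.
move=> Hm; apply: (malg_lin_eq (linAl _) (linPl _)) => e /Hm[te se].
rewrite AppU PrepU -se -te; apply: etrans (app_pb k _ _) _ => //.
exact: esym (prep_pb k _ _).
Qed.

(** [Sp] is defined through the last arrow of its value; as [Prep] and [App] commute, its first
    arrow becomes accessible too, and the product is a recursion on first arrows. *)
Lemma Sp_rcons v l b : pathb (v, rcons l b) -> Sp v (rcons l b) = Prep (sg << b >>) (Sp v l).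
Proof.
elim: l v => [|a l IH] v /=.
  rewrite pathb_cons => /andP[/eqP <- _].
  exact: App_Prep1 (sg_in (inMU b)).
by rewrite pathb_cons => /andP[_ /IH ->]; rewrite Prep_App.
Qed.

Lemma SQ_Prep g h m z : inM g h m -> starts g z -> SQ (Prep m z) = App (sg m) (SQ z).
Proof.
move=> Hm Hz.
apply: (malg_lin_eq (F := fun m => SQ (Prep m z)) (G := fun m => App (sg m) (SQ z))).
- exact: (islin_comp lin_SQ (linPl z)).
- exact: (islin_comp (linAl _) lin_sg).
move=> e /Hm[te _].
apply: (kQ_lin_eq (F := fun z => SQ (Prep << e >> z)) (G := fun z => App (sg << e >>) (SQ z))).
- exact: (islin_comp lin_SQ (linP _)).
- exact: (islin_comp (linA _) lin_SQ).
move=> [v l] Pp zp.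
have vt : v = t e by exact: etrans (Hz _ Pp zp) (esym te).
have Pe : pathb (s e, e :: l) by rewrite pathb_cons eqxx -vt.
by rewrite vt -(pb_Prep Pe) (SQ_pb Pe) -vt (SQ_pb Pp) /= vt.
Qed.

Lemma copsum_Sp (W : lmodType k) (B : kQ -> kQ -> W) v l : isbilin B -> pathb (v, l) ->
  \sum_(x <- pcop (Sp v l)) B x.1 x.2 =
  \sum_(x <- splits v l) B (Sp x.2.1 x.2.2) (Sp x.1.1 x.1.2).
Proof.
elim: l v B => [|a l IH] v B bB Pl.
  by apply: etrans (copsum_pb bB _) _; rewrite //= !big_seq1.
have := Pl; rewrite pathb_cons => /andP[/eqP sa Pl2].
apply: etrans (copsum_App bB (sg_in (inMU a)) (Sp_ends Pl2)) _.
apply: etrans (congr1 (+%R _) (IH _ _ (islin_bilinl bB (linA _)) Pl2)) _.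
apply: etrans _ (esym (big_splits_cons (fun x y => B (Sp y.1 y.2) (Sp x.1 x.2)) v a l)).
apply: congr2; first by rewrite sa.
by apply: eq_big_seq => x /splitsP[-> _ _].
Qed.

Lemma cop_SQ x : teq2 (pcop (SQ x)) [seq (SQ p.2, SQ p.1) | p <- pcop x].
Proof.
move=> f g lf lg; have bfg := isbilin_mulf lf lg; rewrite big_map /=.
have b1 : isbilin (fun u v : kQ => f (SQ v) * g (SQ u) : k^o).
  split=> z; first exact: (islinf_mull _ (islinf_comp lg lin_SQ)).
  exact: (islinf_mulr _ (islinf_comp lf lin_SQ)).
apply: (@kQ_lin_eq k V E s t k^o (fun x => \sum_(p <- pcop (SQ x)) f p.1 * g p.2)
  (fun x => \sum_(p <- pcop x) f (SQ p.2) * g (SQ p.1))).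
- exact: (islin_comp (islin_kcopsum bfg) lin_SQ).
- exact: (islin_kcopsum b1).
move=> [v l] Pp _; rewrite (SQ_pb Pp); apply: etrans (copsum_Sp bfg Pp) _.
apply: esym; apply: etrans (copsum_pb b1 Pp) _.
by apply: eq_big_seq => y /(splits_path Pp)[P1 P2]; rewrite (SQ_pb P1) (SQ_pb P2).
Qed.

Notation ppair := ((V * seq E) * (V * seq E))%type.

Lemma sum_mulQ_split (r : seq ppair) (c : ppair -> k) (X Y : ppair -> kQ) :
  (forall x, x \in r -> mul0Q (X x) (Y x) = 0) ->
  \sum_(x <- r) c x *: mulQ (X x) (Y x) =
  \sum_(x <- r) c x *: mulRQ (X x) (Y x) + \sum_(x <- r) c x *: mulLQ (X x) (Y x).
Proof.
move=> H; rewrite -big_split /=; apply: eq_big_seq => x /H E0.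
by rewrite mulQ_decomp E0 addr0 scalerDr.
Qed.

Notation alpha_sum v l :=
  (\sum_(x <- splits v l) av x.1.1 *: mulQ (Sp x.1.1 x.1.2) (pb x.2)).

(* Recursion on both ends of the path: the first arrow of each product is either
   the image of the last arrow of the path or its first arrow. *)
Lemma alpha_sum_rec v a l0 l1 b : a :: l0 = rcons l1 b -> pathb (v, a :: l0) ->
  alpha_sum v (a :: l0) =
    Prep (ar (sg << b >>) v) (alpha_sum v l1)
  + Prep (al (gi (pend (v, a :: l0))) << a >>) (alpha_sum (t a) l0).
Proof.
move=> El Pl; have := Pl; rewrite pathb_cons => /andP[/eqP sa Pl0].
have Pr1 : pathb (v, rcons l1 b) by rewrite -El.
have := Pr1; rewrite pathb_rcons => /andP[Pl1 /eqP sb].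
have Z x : x \in splits v (a :: l0) -> mul0Q (Sp x.1.1 x.1.2) (pb x.2) = 0.
  move=> /splitsP[_ x2 _]; rewrite [x.2]surjective_pairing.
  apply: (mul0Q_deg (@Sp_deg x.1.1 x.1.2) (@deg_pb k V E s t x.2.1 x.2.2)).
  by rewrite addnC -size_cat x2.
have EZ := @sum_mulQ_split _ (fun x => av x.1.1) (fun x => Sp x.1.1 x.1.2) (fun x => pb x.2) Z.
cbv beta in EZ; rewrite EZ; apply: congr2.
  rewrite El splits_rcons -cats1 big_cat big_seq1 big_map /=.
  rewrite mulRQ_nil scaler0 addr0 (islin_sum (linP _)).
  apply: eq_big_seq => x xs; have [x1 x2 x3] := splitsP xs.
  have [P1 _] := splits_path Pl1 xs.
  have Ex : pend (x.1.1, x.1.2) = s b.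
    by rewrite sb -x2 pend_cat x3 -x1 -surjective_pairing.
  have Pr : pathb (x.1.1, rcons x.1.2 b).
    by rewrite pathb_rcons Ex eqxx andbT -surjective_pairing.
  rewrite (islinZ (linP _)) (Sp_rcons Pr); congr (_ *: _).
  apply: (mulRQ_Prep (sg_in (inMU b))).
    by rewrite -Ex; apply: Sp_starts.
  by rewrite -x1 [x.2]surjective_pairing; apply: starts_pb.
rewrite /= big_cons big_map /= mulLQ_nil scaler0 add0r (islin_sum (linP _)).
apply: eq_big_seq => x xs; have [x1 x2 x3] := splitsP xs.
have [_ P2] := splits_path Pl0 xs.
have E2 : x.2 = (t a, x.2.2) by rewrite -x1 -surjective_pairing.
have Pa : pathb (v, a :: x.2.2) by rewrite pathb_cons sa eqxx -E2.
rewrite (islinZ (linP _)) (pb_Prep Pa) -E2; congr (_ *: _).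
apply: (mulLQ_Prep (inMU a)).
  have -> : pend (v, a :: l0) = pend (x.1.1, x.1.2).
    by rewrite pend_cons -x2 pend_cat -E2 -x3.
  exact: Sp_starts.
by rewrite E2; apply: starts_pb.
Qed.

(** The arrow removed by the recursion is the same for every cut, so both terms are sums for shorter
    paths. They vanish by induction from length two on, and at length one they cancel by [sga]. *)
Lemma alpha_sumE v l : pathb (v, l) ->
  alpha_sum v l = if nilp l then av v *: pb (g1, [::]) else 0.
Proof.
have EN v' : alpha_sum v' [::] = av v' *: pb (g1, [::]).
  rewrite /= big_seq1 /=; congr (_ *: _).
  exact: (etrans (@mulQ_pb (gi v', [::]) (v', [::]) isT isT) (etrans (mulp_nn _ _) (congr1
    (fun g => pb (g, [::])) (gmV v')))).
suff H n : (size l < n)%N -> pathb (v, l) ->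
    alpha_sum v l = if nilp l then av v *: pb (g1, [::]) else 0 by exact: (H _ (ltnSn _)).
elim: n v l => [|n IH] v l Hn Pl; first exact: (False_ind _ (notF Hn)).
case: l Hn Pl => [_ _|a l0 Hn Pl]; first exact: EN.
have [l1 [b El]] : exists l1 b, a :: l0 = rcons l1 b.
  by exists (belast a l0), (last a l0); rewrite lastI.
rewrite (alpha_sum_rec El Pl).
have := Pl; rewrite pathb_cons => /andP[/eqP sa Pl0].
have Pr1 : pathb (v, rcons l1 b) by rewrite -El.
have := Pr1; rewrite pathb_rcons => /andP[Pl1 /eqP sb].
have sz : size l1 = size l0 by have := congr1 size El; rewrite size_rcons /= => -[].
rewrite (IH _ _ _ Pl1) ?sz // (IH _ _ _ Pl0) //.
clear Pr1; case: l0 El Hn Pl0 Pl sz => [|c l0] El Hn Pl0 Pl sz; last first.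
  have -> : nilp l1 = false by rewrite /nilp sz.
  by rewrite /= !(islin0 (linP _)) addr0.
have l10 : l1 = [::] by apply/nilP; rewrite /nilp sz.
rewrite {}l10 in El *; case: El => <-.
rewrite /=.
have swap c m z : Prep m (c *: z) = Prep (c *: m) z.
  exact: etrans (islinZ (linP m) c z) (esym (islinZ (linPl z) c m)).
rewrite swap [X in _ + X]swap -(islinD (linPl _)) addrC.
have -> : pend (v, [:: a]) = t a by [].
by have := sga (inMU a); rewrite sa => ->; rewrite (islin0 (linPl _)).
Qed.

(** In contrast with the sum for alpha, the first arrows of the two factors are those adjacent to
    the cut and vary with it. The sum telescopes: moving the cut past an arrow [a] replaces a
    product beginning with [a] by one beginning with the antipode of [a], and the two cancel by
    [sgb]. *)
Lemma beta_sumE v l : pathb (v, l) ->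
  \sum_(x <- splits v l) bv x.1.1 *: mulQ (pb x.1) (Sp x.2.1 x.2.2) =
  if nilp l then bv v *: pb (g1, [::]) else 0.
Proof.
case: l => [_|a0 l0].
  rewrite /= big_seq1 /=.
  congr (_ *: _).
  exact: (etrans (@mulQ_pb (v, [::]) (gi v, [::]) isT isT) (etrans (mulp_nn _ _) (congr1
    (fun g => pb (g, [::])) (gVm v)))).
move: (a0 :: l0) (isT : (0 < size (a0 :: l0))%N) => {a0 l0} l l_gt0 Pl.
have -> : nilp l = false by case: (l) l_gt0.
have Z x : x \in splits v l -> mul0Q (pb x.1) (Sp x.2.1 x.2.2) = 0.
  move=> /splitsP[_ x2 _]; rewrite [x.1]surjective_pairing.
  apply: (mul0Q_deg (@deg_pb k V E s t x.1.1 x.1.2) (@Sp_deg x.2.1 x.2.2)).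
  by rewrite addnC -size_cat x2.
have EZ := @sum_mulQ_split _ (fun x => bv x.1.1) (fun x => pb x.1) (fun x => Sp x.2.1 x.2.2) Z.
cbv beta in EZ; rewrite EZ.
have ES (T : ppair -> kQ) : \sum_(x <- splits v l) T x =
    \sum_(0 <= i < (size l).+1) T ((pend (v, take i l), drop i l), (v, take i l)).
  by rewrite splitsE big_map /index_iota subn0.
apply: etrans (congr2 +%R (ES (fun x => bv x.1.1 *: mulRQ (pb x.1) (Sp x.2.1 x.2.2)))
  (ES (fun x => bv x.1.1 *: mulLQ (pb x.1) (Sp x.2.1 x.2.2)))) _.
apply: sum_cancel_shift.
- by rewrite [in X in mulRQ X _]/= drop_size mulRQ_nil scaler0.
- by rewrite [in X in mulLQ _ X]/= take0 mulLQ_nil scaler0.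
move=> i il.
have [a Ea] : exists a, nth a l i = a.
  by case: (l) il => [|a0 l' il']; [rewrite ltn0 | exists (nth a0 (a0 :: l') i);
    apply: set_nth_default].
set dr := drop i.+1 l.
have Ed : drop i l = a :: dr by rewrite (drop_nth a il) Ea.
have Et1 : take i.+1 l = rcons (take i l) a by rewrite (take_nth a il) Ea.
set tk := take i l.
have Plt : pathb (v, tk ++ a :: dr) by rewrite -Ed cat_take_drop.
have := Plt; rewrite pathb_cat => /andP[Ptk Pad].
have := Pad; rewrite pathb_cons => /andP[/eqP sa Pdr].
have Prt : pathb (v, rcons tk a) by rewrite pathb_rcons Ptk sa eqxx.
rewrite Ed Et1 -/tk -/dr.
have ER : mulRQ (pb (pend (v, tk), a :: dr)) (Sp v tk) =
    Prep (ar << a >> (gi (s a))) (mulQ (pb (t a, dr)) (Sp v tk)).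
  rewrite (pb_Prep Pad); apply: (mulRQ_Prep (inMU a) (@starts_pb k V E s t (t a) dr)).
  by rewrite sa; apply: Sp_starts.
have EL : mulLQ (pb (pend (v, rcons tk a), dr)) (Sp v (rcons tk a)) =
    Prep (al (t a) (sg << a >>)) (mulQ (pb (t a, dr)) (Sp v tk)).
  rewrite (Sp_rcons Prt) pend_rcons.
  apply: (mulLQ_Prep (sg_in (inMU a)) (@starts_pb k V E s t (t a) dr)).
  by rewrite sa; apply: Sp_starts.
apply: etrans (congr2 (fun x y => bv _ *: x + bv _ *: y) ER EL) _.
rewrite pend_rcons -sa -(islinZ (linPl _)) -[X in _ + X](islinZ (linPl _)) -(islinD (linPl _)) addrC.
by rewrite (sgb (inMU a)) (islin0 (linPl _)).
Qed.

End ArrowBimodule.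

Lemma asbool_sig (T : choiceType) (P : T -> Prop) (x : {x : T | `[< P x >]}) : P (val x).
Proof. exact: (asboolW (valP x)). Qed.

(** * The bimodule of arrows of a pointed Majid algebra *)

Section SkewPrimitives.
Variables (k : fieldType) (H : lmodType k).
Variables (cop : H -> seq (H * H)) (eps : H -> k) (mul : H -> H -> H) (one : H)
          (phi phiinv : H -> H -> H -> k) (S : H -> H) (alpha beta : H -> k).
Hypothesis HM : is_majid cop eps mul one phi phiinv S alpha beta.
Hypothesis Hp : pointed cop.
Notation F := (corad_filt cop).
Notation gl := (grouplike cop).
Notation Fs := (Fs cop).
Notation sprim := (sprim cop).
Notation hit := (hit cop).
Notation ract := (ract cop).
Let Hc : is_coalgebra cop eps := majid_coalgebra HM.
Variable dl : H -> H -> k.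
Hypothesis ldl : forall g, islinf (dl g).
Hypothesis dlE : forall g h, gl g -> gl h -> dl g h = (g == h)%:R.
Variables (B : H -> Prop) (d : H -> H -> k) (sr tg : H -> H).
Hypotheses (ld : forall b, islinf (d b)) (dP : forall b x, F 0%N x -> d b x = 0)
  (dB : forall b b', B b -> B b' -> d b b' = (b == b')%:R)
  (sB : forall x, F 1%N x -> spn (F 0%N) B x)
  (Bst : forall b, B b -> [/\ gl (sr b), gl (tg b) & sprim (tg b) (sr b) b]).

Let sF n : subspace (F n) := subspace_F Hc n.

(** Vertices are the group-likes, arrows the basis vectors; reflecting both predicates into booleans
    makes them choice types. *)
Definition glT : choiceType := {g : H | `[< gl g >]}.
Definition arT : choiceType := {b : H | `[< B b >]}.

Section ArrowData.
Implicit Types (g h u v w : glT) (e a : arT).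

Definition mkgl (g : H) (gg : gl g) : glT := exist _ g (asboolT gg).
Definition mkar (b : H) (Bb : B b) : arT := exist _ b (asboolT Bb).

Lemma glP g : gl (val g). Proof. exact: asbool_sig. Qed.
Lemma arP e : B (val e). Proof. exact: asbool_sig. Qed.
Hint Resolve glP arP : core.

Definition src e : glT := mkgl (let: And3 P _ _ := Bst (arP e) in P).
Definition tgt e : glT := mkgl (let: And3 _ P _ := Bst (arP e) in P).

Definition gm g h : glT := mkgl (gl_mul HM (glP g) (glP h)).
Definition g1 : glT := mkgl (gl_one HM).
Definition gi g : glT := mkgl (gl_S HM (glP g)).

Lemma gmA u v w : gm u (gm v w) = gm (gm u v) w.
Proof. by apply: val_inj; apply: (gl_mulA HM). Qed.
Lemma gm1 x : gm g1 x = x. Proof. by apply: val_inj; apply: (mul1x HM). Qed.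
Lemma gx1 x : gm x g1 = x. Proof. by apply: val_inj; apply: (mulx1 HM). Qed.
Lemma gmV x : gm (gi x) x = g1. Proof. by apply: val_inj; apply: (gl_mulVx HM). Qed.
Lemma gVm x : gm x (gi x) = g1. Proof. by apply: val_inj; apply: (gl_mulxV HM). Qed.

Notation M := {malg k[arT]}.
Notation inM := (@inM k glT arT src tgt).
Implicit Types (m : M).

Lemma cl_exists x : exists m : M, F 1%N x -> forall e, m@_e = d (val e) x.
Proof.
have [Fx|nFx] := pselect (F 1%N x); last by exists 0.
have [es Hes Ex] := spn_expands ld dP dB (sB Fx); have [ues Bes] := Hes.
exists (\sum_(e <- pmap insub es : seq arT) d (val e) x *: << e >>) => _ e.
rewrite (islinf_sum (islinf_mcoeff e)).
rewrite (eq_bigr (fun e' : arT => if e' == e then d (val e) x else 0)); last first.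
  move=> e' _; rewrite (islinfZ (islinf_mcoeff e)) mcoeffU.
  by have [->|_] := eqVneq e' e; rewrite ?mulr1 ?mulr0.
have ue : uniq (pmap insub es : seq arT) by apply: pmap_sub_uniq.
have [ees|nes] := boolP (e \in (pmap insub es : seq arT)).
  by rewrite (bigD1_seq e) //= eqxx big1 ?addr0 // => e' /negPf ->.
rewrite big1_seq; last first.
  by move=> e' /andP[_ e's]; case: eqP => // ee; rewrite -ee e's in nes.
by rewrite (expands_notin ld dP dB Hes Ex) // -mem_pmap_sub.
Qed.

(* The class of [x] in [F 1 / F 0], written in the basis of arrows (junk outside [F 1]). *)
Definition cl x : M := proj1_sig (cid (cl_exists x)).

Lemma clE x e : F 1%N x -> (cl x)@_e = d (val e) x.
Proof. by move=> Fx; rewrite /cl; case: cid => m /= /(_ Fx). Qed.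

(** A linear section of [cl]: operations on arrows are defined by lifting to [H], applying the
    operation there and taking the class. *)
Definition lam m : H := mext (fun e => val e) m.

Lemma lin_lam : islin lam. Proof. exact: islin_mext. Qed.

Lemma lam_F1 m : F 1%N (lam m).
Proof.
apply: (subspace_sum (sF 1)) => e _; apply: (subspaceZ (sF 1)).
by case: (Bst (arP e)) => _ _ [].
Qed.
Hint Resolve lam_F1 : core.

Lemma d_lam e m : d (val e) (lam m) = m@_e.
Proof.
apply: (@malg_lin_eq k arT k^o (fun m => d (val e) (lam m)) (fun m => m@_e)).
- exact: (islinf_comp (ld _) lin_lam).
- exact: islinf_mcoeff.
move=> e' _; rewrite /lam mextU mcoeffU dB //.
by rewrite [val e == _]eq_sym.
Qed.

Lemma cl_lam m : cl (lam m) = m.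
Proof. by apply/malgP => e; rewrite clE // d_lam. Qed.

Lemma cl_eqP x y : F 1%N x -> F 1%N y -> cl x = cl y <-> F 0%N (x - y).
Proof.
move=> Fx Fy; split=> [E|Fxy].
  apply: (F1_d_eq0 ld dP dB sB); first exact: (subspaceB (sF 1)).
  move=> b Bb; have := congr1 (fun m => m@_(mkar Bb)) E; rewrite !clE //= => {}E.
  by rewrite (islinfB (ld b)) E subrr.
apply/malgP => e; rewrite !clE //; apply/eqP; rewrite -subr_eq0 -(islinfB (ld _)).
by rewrite dP.
Qed.

Lemma cl_lin (c : k) x y : F 1%N x -> F 1%N y -> cl (c *: x + y) = c *: cl x + cl y.
Proof.
move=> Fx Fy; apply/malgP => e; rewrite mcoeffD mcoeffZ !clE ?ld //.
by apply: (subspaceD (sF 1)) => //; apply: (subspaceZ (sF 1)).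
Qed.

Lemma clZ (c : k) x : F 1%N x -> cl (c *: x) = c *: cl x.
Proof.
by move=> Fx; apply/malgP => e; rewrite mcoeffZ !clE ?(islinfZ (ld _)) //;
  apply: (subspaceZ (sF 1)).
Qed.

Lemma clD x y : F 1%N x -> F 1%N y -> cl (x + y) = cl x + cl y.
Proof. by move=> Fx Fy; have := cl_lin 1 Fx Fy; rewrite !scale1r. Qed.

Lemma F0_F1 x : F 0%N x -> F 1%N x.
Proof. exact: (@FsS _ _ _ _ Hc Hp 1). Qed.

Lemma cl_F0 x : F 0%N x -> cl x = 0.
Proof. by move=> Fx; apply/malgP => e; rewrite mcoeff0 clE ?dP //; apply: F0_F1. Qed.

Lemma lam_cl x : F 1%N x -> F 0%N (lam (cl x) - x).
Proof. by move=> Fx; apply/cl_eqP; rewrite ?cl_lam. Qed.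

Lemma inM_sprim g h m : inM g h m <-> sprim (val g) (val h) (lam m).
Proof.
have P := @sprim_dP _ _ _ _ Hc Hp _ _ _ _ ld dP dB sB Bst (val g) (val h) _ (lam_F1 m).
split=> [Hm|/P H' e me].
  apply/P => b Bb; rewrite -[b]/(val (mkar Bb)) d_lam => /Hm[<- <-]; by [].
have := H' _ (arP e); rewrite d_lam => /(_ me)[E1 E2].
by split; apply: val_inj.
Qed.

Lemma sprim_cl g h x : sprim (val g) (val h) x -> inM g h (cl x).
Proof.
move=> Hx; have Fx : F 1%N x by case: Hx.
apply/inM_sprim; apply: (subspace_eqmod (subspace_sprim Hc (val g) (val h)) _ Hx).
by apply: (sprim_F0 Hc Hp); apply: lam_cl.
Qed.

Let FmulR x w : F 1%N x -> F 1%N (mul x (val w)).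
Proof. by move=> Fx; apply: (F_mul HM Hp Fx (gl_F0 Hc Hp (glP w))). Qed.
Let FmulL x w : F 1%N x -> F 1%N (mul (val w) x).
Proof. by move=> Fx; apply: (F_mul HM Hp (gl_F0 Hc Hp (glP w)) Fx). Qed.
Let F0mulR x w : F 0%N x -> F 0%N (mul x (val w)).
Proof. by move=> Fx; apply: (F0_mul HM Hp Fx (gl_F0 Hc Hp (glP w))). Qed.
Let F0mulL x w : F 0%N x -> F 0%N (mul (val w) x).
Proof. by move=> Fx; apply: (F0_mul HM Hp (gl_F0 Hc Hp (glP w)) Fx). Qed.
Let FS x : F 1%N x -> F 1%N (S x).
Proof. exact: (Fs_S HM Hp (n := 2)). Qed.
Hint Resolve FmulR FmulL F0mulR F0mulL FS : core.

Definition ar m w : M := cl (mul (lam m) (val w)).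
Definition al w m : M := cl (mul (val w) (lam m)).
Definition sg m : M := cl (S (lam m)).

(** Independence of the lift: [lam (cl x) - x] lies in [F 0], the kernel of [cl], and translations
    preserve [F 0]. *)
Lemma cl_mulr x w : F 1%N x -> cl (mul x (val w)) = ar (cl x) w.
Proof.
move=> Fx; apply/esym/cl_eqP; rewrite -?(islinB (lin_mull HM _)); auto.
by apply: F0mulR; apply: lam_cl.
Qed.

Lemma cl_mull x w : F 1%N x -> cl (mul (val w) x) = al w (cl x).
Proof.
move=> Fx; apply/esym/cl_eqP; rewrite -?(islinB (lin_mulr HM _)); auto.
by apply: F0mulL; apply: lam_cl.
Qed.

Lemma cl_S x : F 1%N x -> cl (S x) = sg (cl x).
Proof.
move=> Fx; apply/esym/cl_eqP; rewrite -?(islinB (lin_S HM)); auto.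
by apply: (F0_S HM Hp); apply: lam_cl.
Qed.

Lemma lin_ar w : islin (ar^~ w).
Proof. by move=> c x y; rewrite /ar lin_lam (lin_mull HM) cl_lin; auto. Qed.
Lemma lin_al w : islin (al w).
Proof. by move=> c x y; rewrite /al lin_lam (lin_mulr HM) cl_lin; auto. Qed.
Lemma lin_sg : islin sg.
Proof. by move=> c x y; rewrite /sg lin_lam (lin_S HM) cl_lin; auto. Qed.

Lemma ar_in g h w m : inM g h m -> inM (gm g w) (gm h w) (ar m w).
Proof. by move=> /inM_sprim Hm; apply: sprim_cl; apply: (sprim_mulr HM Hp). Qed.
Lemma al_in g h w m : inM g h m -> inM (gm w g) (gm w h) (al w m).
Proof. by move=> /inM_sprim Hm; apply: sprim_cl; apply: (sprim_mull HM Hp). Qed.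
Lemma sg_in g h m : inM g h m -> inM (gi h) (gi g) (sg m).
Proof. by move=> /inM_sprim Hm; apply: sprim_cl; apply: (sprim_S HM Hp). Qed.

Lemma ar1 m : ar m g1 = m. Proof. by rewrite /ar (mulx1 HM) cl_lam. Qed.
Lemma al1 m : al g1 m = m. Proof. by rewrite /al (mul1x HM) cl_lam. Qed.

Definition ph u v w : k := phi (val u) (val v) (val w).
Definition av v : k := alpha (val v).
Definition bv v : k := beta (val v).

Let clZ_eq (c c' : k) x y : F 1%N x -> F 1%N y -> F 0%N (c *: x - c' *: y) ->
  c *: cl x = c' *: cl y.
Proof.
move=> Fx Fy Fxy; rewrite -!clZ //; apply/cl_eqP => //; exact: (subspaceZ (sF 1)).
Qed.

Lemma arar g h m w u : inM g h m ->
  ph g w u *: ar (ar m w) u = ph h w u *: ar m (gm w u).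
Proof.
move=> /inM_sprim Hm; rewrite /ar -[cl (mul (lam (cl _)) _)]cl_mulr; auto.
by apply: clZ_eq; auto; apply: (sprim_assocRR HM Hp).
Qed.

Lemma aral g h m w u : inM g h m ->
  ph w g u *: ar (al w m) u = ph w h u *: al w (ar m u).
Proof.
move=> /inM_sprim Hm; rewrite /al /ar -[cl (mul (lam (cl _)) _)]cl_mulr; auto.
rewrite -[cl (mul _ (lam (cl _)))]cl_mull; auto.
by apply: clZ_eq; auto; apply: (sprim_assocLR HM Hp).
Qed.

Lemma alal g h m w u : inM g h m ->
  ph w u g *: al (gm w u) m = ph w u h *: al w (al u m).
Proof.
move=> /inM_sprim Hm; rewrite /al -[cl (mul _ (lam (cl _)))]cl_mull; auto.
by apply: clZ_eq; auto; apply: (sprim_assocLL HM Hp).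
Qed.

Lemma sga g h m : inM g h m -> av g *: al (gi g) m + av h *: ar (sg m) h = 0.
Proof.
move=> /inM_sprim Hm; rewrite /al /ar /sg -[cl (mul (lam _) _)]cl_mulr; auto.
rewrite -!clZ -?clD; auto; try by apply: (subspaceZ (sF 1)); auto.
by apply: cl_F0; apply: (sprim_alpha HM Hp).
Qed.

Lemma sgb g h m : inM g h m -> bv g *: al g (sg m) + bv h *: ar m (gi h) = 0.
Proof.
move=> /inM_sprim Hm; rewrite /al /ar /sg -[cl (mul _ (lam (cl _)))]cl_mull; auto.
rewrite -!clZ -?clD; auto; try by apply: (subspaceZ (sF 1)); auto.
by apply: cl_F0; apply: (sprim_beta HM Hp).
Qed.

End ArrowData.
Hint Resolve glP arP : core.

(** ** The graded Majid algebra of paths *)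

Notation kQ := (kQ src tgt k).
Notation pathb := (pathb src tgt).
Notation pend := (pend tgt).
Notation splits := (splits tgt).
Notation pb := (@pb glT arT src tgt k).
Notation pcop := (@pcop glT arT src tgt k).
Notation peps := (@peps glT arT src tgt k).
Implicit Types (v : glT).

Definition mQ : kQ -> kQ -> kQ := mulQ gm ar al.
Definition oQ : kQ := pb (g1, [::]).
Definition sQ : kQ -> kQ := SQ gi sg.

(* The projection onto degree 0, followed by the inclusion of [k G] in [H]: the axioms
   involving [phi], [alpha] and [beta] are pulled back along this map. *)
Definition pi : kQ -> H := kext (fun p => if nilp p.2 then val p.1 else 0).

Lemma lin_pi : islin pi. Proof. exact: (@islin_kext k glT arT src tgt H). Qed.

Lemma pi_pb p : pathb p -> pi (pb p) = if nilp p.2 then val p.1 else 0.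
Proof. exact: (@kext_pb k glT arT src tgt H). Qed.

Lemma pi_nil v : pi (pb (v, [::])) = val v.
Proof. by rewrite pi_pb. Qed.

Local Opaque pi.

Lemma pi_deg n (z : kQ) : deg n z -> (0 < n)%N -> pi z = 0.
Proof.
move=> Hz n0; apply: (@kQ_lin_eq k glT arT src tgt H pi (fun=> 0)).
- exact: lin_pi.
- by move=> c x y; rewrite scaler0 addr0.
by move=> [v l] Pp zp; rewrite pi_pb // /nilp (Hz _ Pp zp) -(prednK n0).
Qed.

Lemma pi_F0 (z : kQ) : F 0%N (pi z).
Proof.
Local Transparent pi.
apply: kext_in; first exact: (sF 0).
move=> [v l] _ _ /=; case: ifP => _; first exact: (gl_F0 Hc Hp (glP v)).
exact: (subspace0 (sF 0)).
Qed.
Local Opaque pi.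

Lemma splits_nonnil v l x : x \in splits v l -> ~~ nilp l -> ~~ (nilp x.1.2 && nilp x.2.2).
Proof. by move=> /splitsP[_ <- _]; apply: contra => /andP[/nilP-> /nilP->]. Qed.

(** Any cut of a path of positive length has a side of positive length, which [pi] kills; on a
    vertex the claim is the coproduct of a group-like. *)
Lemma cop_pi (z : kQ) : teq2 (cop (pi z)) [seq (pi p.1, pi p.2) | p <- pcop z].
Proof.
move=> f g lf lg; rewrite big_map /=.
have b1 : isbilin (fun x y : kQ => f (pi x) * g (pi y) : k^o).
  exact: (isbilin_mulf (islinf_comp lf lin_pi) (islinf_comp lg lin_pi)).
apply: (@kQ_lin_eq k glT arT src tgt k^o (fun z => \sum_(p <- cop (pi z)) f p.1 * g p.2)
   (fun z => \sum_(p <- pcop z) f (pi p.1) * g (pi p.2))).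
- exact: (islin_comp (islin_copsum Hc (isbilin_mulf lf lg)) lin_pi).
- exact: (islin_kcopsum b1).
move=> [v l] Pp _; apply: etrans _ (esym (copsum_pb b1 Pp)).
rewrite pi_pb //=; case: ifP => [/nilP ->|l0].
  by rewrite /= big_seq1 /= pi_nil (gl_copsum (isbilin_mulf lf lg) (glP v)).
rewrite [LHS](islin0 (islin_copsum Hc (isbilin_mulf lf lg))).
rewrite big1_seq // => x /andP[_ xs]; have [P1 P2] := splits_path Pp xs.
have := splits_nonnil xs (negbT l0); rewrite !pi_pb //.
by case: (nilp x.1.2) => /= [/negPf ->|_]; rewrite (islinf0 lf, islinf0 lg) ?mulr0 ?mul0r.
Qed.

(** Moves Sweedler sums from paths to [H]. As [pi] also respects products, unit and antipode, the
    scalar axioms on paths become those of [H] at images under [pi]. *)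
Lemma pi_copsum (W : lmodType k) (T : H -> H -> W) (z : kQ) : isbilin T ->
  \sum_(p <- pcop z) T (pi p.1) (pi p.2) = \sum_(p <- cop (pi z)) T p.1 p.2.
Proof. by move=> bT; rewrite (teq2_bilin bT (cop_pi z)) big_map. Qed.

Lemma eps_pi (z : kQ) : eps (pi z) = peps z.
Proof.
apply: (@kQ_lin_eq k glT arT src tgt k^o (fun z => eps (pi z)) (fun z => peps z)).
- exact: (islinf_comp (islinf_eps Hc) lin_pi).
- exact: islinf_peps.
move=> [v l] Pp _; rewrite pi_pb // peps_pb //=; case: ifP => _.
  by rewrite (gl_eps Hc (glP v)).
by rewrite (islinf0 (islinf_eps Hc)).
Qed.

Lemma bilin_mQ : isbilin mQ. Proof. exact: bilin_mulQ. Qed.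

Lemma pi_mul x y : pi (mQ x y) = mul (pi x) (pi y).
Proof.
apply: (@kQ_bilin_eq k glT arT src tgt H (fun x y => pi (mQ x y)) (fun x y => mul (pi x) (pi y))).
- case: bilin_mQ => m1 m2; split=> z; exact: (islin_comp lin_pi).
- split=> z; first exact: (islin_comp (lin_mull HM _) lin_pi).
  exact: (islin_comp (lin_mulr HM _) lin_pi).
move=> [v l] [w l'] Pp Pq _ _; rewrite /mQ mulQ_pb // (pi_pb Pp) (pi_pb Pq) /=.
have D := @mulp_deg k glT arT src tgt gm ar al v l w l'.
case: l Pp D => [|a l] Pp D; last by rewrite (pi_deg D) // (islin0 (lin_mull HM _)).
case: l' Pq D => [|b l'] Pq D; last by rewrite (pi_deg D) // (islin0 (lin_mulr HM _)).
by rewrite mulp_nn pi_nil.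
Qed.

Lemma pi_one : pi oQ = one. Proof. exact: pi_nil. Qed.

Lemma lin_sQ : islin sQ. Proof. exact: lin_SQ. Qed.

Lemma pi_S (z : kQ) : pi (sQ z) = S (pi z).
Proof.
apply: (@kQ_lin_eq k glT arT src tgt H (fun z => pi (sQ z)) (fun z => S (pi z))).
- exact: (islin_comp lin_pi lin_sQ).
- exact: (islin_comp (lin_S HM) lin_pi).
move=> [v l] Pp _; rewrite /sQ SQ_pb // (pi_pb Pp).
have D := @Sp_deg k glT arT src tgt gi sg v l.
case: l Pp D => [|a l] Pp D; last by rewrite (pi_deg D) // (islin0 (lin_S HM)).
exact: pi_nil.
Qed.

Lemma pi_swe2 (W : lmodType k) (T : H -> H -> H -> W) (z : kQ) : istrilin T ->
  \sum_(l <- swe pcop 2 z) T (pi l`_0) (pi l`_1) (pi l`_2) =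
  \sum_(l <- swe cop 2 (pi z)) T l`_0 l`_1 l`_2.
Proof.
move=> [T1 T2 T3]; apply: etrans (swe2E _ _ _) _; apply: etrans _ (esym (swe2E _ _ _)).
have b2 y : isbilin (fun x w => T x w y) by split=> w; [apply: T1 | apply: T2].
transitivity (\sum_(p <- pcop z) \sum_(q <- cop (pi p.1)) T q.1 q.2 (pi p.2)).
  by apply: eq_bigr => p _; exact: (@pi_copsum W (fun x y => T x y (pi p.2)) p.1 (b2 _)).
apply: (pi_copsum (T := fun x y => \sum_(q <- cop x) T q.1 q.2 y)).
split=> y; first exact: (islin_copsum Hc (b2 y)).
by apply: islin_bigsum => q; apply: T3.
Qed.

Lemma pi_swe4 (W : lmodType k) (T : H -> H -> H -> H -> H -> W) (z : kQ) :
  (forall b c d e, islin (fun a => T a b c d e)) ->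
  (forall a c d e, islin (fun b => T a b c d e)) ->
  (forall a b d e, islin (fun c => T a b c d e)) ->
  (forall a b c e, islin (fun d => T a b c d e)) ->
  (forall a b c d, islin (T a b c d)) ->
  \sum_(l <- swe pcop 4 z) T (pi l`_0) (pi l`_1) (pi l`_2) (pi l`_3) (pi l`_4) =
  \sum_(l <- swe cop 4 (pi z)) T l`_0 l`_1 l`_2 l`_3 l`_4.
Proof.
move=> T1 T2 T3 T4 T5.
apply: etrans (swe4E _ _ _) _; apply: etrans _ (esym (swe4E _ _ _)).
have B1 c d' e : isbilin (fun a b => T a b c d' e) by [].
have B2 d' e : isbilin (fun x c => \sum_(u <- cop x) T u.1 u.2 c d' e).
  by split=> y; [apply: (islin_copsum Hc (B1 y d' e)) | apply: islin_bigsum => ?; apply: T3].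
have B3 e : isbilin (fun x d => \sum_(r <- cop x) \sum_(u <- cop r.1) T u.1 u.2 r.2 d e).
  split=> y; first by apply: (islin_copsum Hc (B2 y e)).
  by do 2 (apply: islin_bigsum => ?).
have B4 : isbilin (fun x e => \sum_(q <- cop x) \sum_(r <- cop q.1)
    \sum_(u <- cop r.1) T u.1 u.2 r.2 q.2 e).
  split=> y; first by apply: (islin_copsum Hc (B3 y)).
  by do 3 (apply: islin_bigsum => ?).
apply: etrans _ (pi_copsum _ B4); apply: eq_bigr => p _.
apply: etrans _ (pi_copsum _ (B3 _)); apply: eq_bigr => q _.
apply: etrans _ (pi_copsum _ (B2 _ _)); apply: eq_bigr => r _.
exact: (@pi_copsum W (fun a b => T a b (pi r.2) (pi q.2) (pi p.2)) r.1 (B1 _ _ _)).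
Qed.

Lemma pi_copsum3 (W : lmodType k) (T : H -> H -> H -> H -> H -> H -> W) a b c :
  (forall q q' r r', isbilin (fun p p' => T p p' q q' r r')) ->
  (forall p p' r r', isbilin (fun q q' => T p p' q q' r r')) ->
  (forall p p' q q', isbilin (fun r r' => T p p' q q' r r')) ->
  \sum_(p <- pcop a) \sum_(q <- pcop b) \sum_(r <- pcop c)
    T (pi p.1) (pi p.2) (pi q.1) (pi q.2) (pi r.1) (pi r.2) =
  \sum_(p <- cop (pi a)) \sum_(q <- cop (pi b)) \sum_(r <- cop (pi c))
    T p.1 p.2 q.1 q.2 r.1 r.2.
Proof.
move=> T1 T2 T3.
have B2 p p' : isbilin (fun q q' => \sum_(r <- cop (pi c)) T p p' q q' r.1 r.2).
  by split=> y; apply: islin_bigsum => r; case: (T2 p p' r.1 r.2).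
have B1 : isbilin (fun p p' => \sum_(q <- cop (pi b)) \sum_(r <- cop (pi c)) T p p' q.1 q.2 r.1 r.2).
  split=> y; apply: islin_bigsum => q; apply: islin_bigsum => r.
    by case: (T1 q.1 q.2 r.1 r.2).
  by case: (T1 q.1 q.2 r.1 r.2).
apply: etrans _ (pi_copsum _ B1); apply: eq_bigr => p _.
apply: etrans _ (pi_copsum _ (B2 _ _)); apply: eq_bigr => q _.
exact: (@pi_copsum W (T (pi p.1) (pi p.2) (pi q.1) (pi q.2)) c (T3 _ _ _ _)).
Qed.

Definition phiQ (x y z : kQ) := phi (pi x) (pi y) (pi z).
Definition phiinvQ (x y z : kQ) := phiinv (pi x) (pi y) (pi z).
Definition alphaQ (z : kQ) := alpha (pi z).
Definition betaQ (z : kQ) := beta (pi z).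

Let lf1 y z : islinf (fun x => phi x y z) := lin_phi1 HM y z.
Let lf2 x z : islinf (fun y => phi x y z) := lin_phi2 HM x z.
Let lf3 x y : islinf (phi x y) := lin_phi3 HM x y.
Let li1 y z : islinf (fun x => phiinv x y z). Proof. by case: (trilin_phiinv HM). Qed.
Let li2 x z : islinf (fun y => phiinv x y z). Proof. by case: (trilin_phiinv HM). Qed.
Let li3 x y : islinf (phiinv x y). Proof. by case: (trilin_phiinv HM). Qed.
Let lm1 y : islin (mul^~ y) := lin_mull HM y.
Let lm2 x : islin (mul x) := lin_mulr HM x.
Hint Resolve lf1 lf2 lf3 li1 li2 li3 lm1 lm2 : core.

Lemma trilin_pi (f : H -> H -> H -> k) : istrilinf f ->
  istrilinf (fun x y z : kQ => f (pi x) (pi y) (pi z)).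
Proof.
by move=> [f1 f2 f3]; split=> x y; [apply: (islinf_comp (f1 _ _) lin_pi)
  | apply: (islinf_comp (f2 _ _) lin_pi) | apply: (islinf_comp (f3 _ _) lin_pi)].
Qed.

Lemma phiQK a b c :
  \sum_(p <- pcop a) \sum_(q <- pcop b) \sum_(r <- pcop c)
     phiQ p.1 q.1 r.1 * phiinvQ p.2 q.2 r.2 = peps a * peps b * peps c.
Proof.
apply: etrans (pi_copsum3 (W := k^o) (T :=
  fun p p' q q' r r' => phi p q r * phiinv p' q' r') a b c _ _ _) _.
- by move=> q q' r r'; apply: isbilin_mulf.
- by move=> q q' r r'; apply: isbilin_mulf.
- by move=> q q' r r'; apply: isbilin_mulf.
by rewrite -!eps_pi; case: HM => _ [_ _ [_ _ + _] _] _; apply.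
Qed.

Lemma phiinvQK a b c :
  \sum_(p <- pcop a) \sum_(q <- pcop b) \sum_(r <- pcop c)
     phiinvQ p.1 q.1 r.1 * phiQ p.2 q.2 r.2 = peps a * peps b * peps c.
Proof.
apply: etrans (pi_copsum3 (W := k^o) (T :=
  fun p p' q q' r r' => phiinv p q r * phi p' q' r') a b c _ _ _) _.
- by move=> q q' r r'; apply: isbilin_mulf.
- by move=> q q' r r'; apply: isbilin_mulf.
- by move=> q q' r r'; apply: isbilin_mulf.
by rewrite -!eps_pi; case: HM => _ [_ _ [_ _ _ +] _] _; apply.
Qed.

Lemma phiQ_pentagon a b c d' :
  \sum_(p <- pcop a) \sum_(q <- pcop b) \sum_(r <- pcop c) \sum_(u <- pcop d')
      phiQ p.1 q.1 (mQ r.1 u.1) * phiQ (mQ p.2 q.2) r.2 u.2 =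
  \sum_(p <- pcop a) \sum_(lb <- swe pcop 2 b) \sum_(lc <- swe pcop 2 c)
    \sum_(u <- pcop d')
      phiQ lb`_0 lc`_0 u.1 * phiQ p.1 (mQ lb`_1 lc`_1) u.2 * phiQ p.2 lb`_2 lc`_2.
Proof.
have E : \sum_(p <- cop (pi a)) \sum_(q <- cop (pi b)) \sum_(r <- cop (pi c))
      \sum_(u <- cop (pi d'))
        phi p.1 q.1 (mul r.1 u.1) * phi (mul p.2 q.2) r.2 u.2 =
    \sum_(p <- cop (pi a)) \sum_(lb <- swe cop 2 (pi b)) \sum_(lc <- swe cop 2 (pi c))
      \sum_(u <- cop (pi d'))
        phi lb`_0 lc`_0 u.1 * phi p.1 (mul lb`_1 lc`_1) u.2 * phi p.2 lb`_2 lc`_2.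
  by case: HM => _ _ [].
have lmr (f : H -> k) (g : H -> H) : islinf f -> islin g -> islinf
  (fun x : H => f (g x)) by exact: islinf_comp.
apply: etrans _ (etrans E _).
  pose T (p p' q q' r r' u u' : H) := phi p q (mul r u) * phi (mul p' q') r' u'.
  have T4 p p' q q' r r' : isbilin (fun u u' => T p p' q q' r r' u u' : k^o).
    exact: (isbilin_mulf (lmr (phi p q) (mul r) (lf3 _ _) (lm2 _)) (lf3 _ _)).
  have T3 p p' q q' : isbilin (fun r r' => \sum_(u <- cop (pi d')) T p p' q q' r r' u.1 u.2 : k^o).
    split=> y; apply: islin_bigsum => u.
      by apply: islinf_mulr; apply: (lmr (phi p q) (mul^~ u.1)).
    exact: islinf_mull.
  have T2 p p' : isbilin (fun q q' => \sum_(r <- cop (pi c)) \sum_(u <- cop (pi d')) T p p' q q' r.1 r.2 u.1 u.2 : k^o).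
    split=> y; apply: islin_bigsum => r; apply: islin_bigsum => u; first exact: islinf_mulr.
    by apply: islinf_mull; apply: (lmr (fun x => phi x r.2 u.2) (mul p')).
  have T1 : isbilin (fun p p' => \sum_(q <- cop (pi b)) \sum_(r <- cop (pi c)) \sum_(u <- cop (pi d')) T p p' q.1 q.2 r.1 r.2 u.1 u.2 : k^o).
    split=> y; apply: islin_bigsum => q; apply: islin_bigsum => r; apply: islin_bigsum => u;
      first exact: islinf_mulr.
    by apply: islinf_mull; apply: (lmr (fun x => phi x r.2 u.2) (mul^~ q.2)).
  apply: etrans _ (pi_copsum _ T1); apply: eq_bigr => p _.
  apply: etrans _ (pi_copsum _ (T2 _ _)); apply: eq_bigr => q _.
  apply: etrans _ (pi_copsum _ (T3 _ _ _ _)); apply: eq_bigr => r _.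
  apply: etrans _ (pi_copsum _ (T4 _ _ _ _ _ _)); apply: eq_bigr => u _.
  exact: (congr2 *%R (congr1 (phi _ _) (pi_mul _ _)) (congr1 (fun x => phi x _ _) (pi_mul _ _))).
pose T (p p' b0 b1 b2 c0 c1 c2 u u' : H) := phi b0 c0 u * phi p (mul b1 c1) u' * phi p' b2 c2.
have T4 p p' b0 b1 b2 c0 c1 c2 : isbilin (fun u u' => T p p' b0 b1 b2 c0 c1 c2 u u' : k^o).
  by split=> y; apply: islinf_mulr; [apply: islinf_mulr | apply: islinf_mull].
have T3 p p' b0 b1 b2 : istrilin
  (fun c0 c1 c2 => \sum_(u <- cop (pi d')) T p p' b0 b1 b2 c0 c1 c2 u.1 u.2 : k^o).
  split=> y y'; apply: islin_bigsum => u.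
  - by apply: islinf_mulr; apply: islinf_mulr.
  - by apply: islinf_mulr; apply: islinf_mull; apply: (lmr (fun x => phi p x u.2) (mul b1)).
  - exact: islinf_mull.
have T2 p p' : istrilin (fun b0 b1 b2 => \sum_(lc <- swe cop 2 (pi c))
    \sum_(u <- cop (pi d')) T p p' b0 b1 b2 lc`_0 lc`_1 lc`_2 u.1 u.2 : k^o).
  split=> y y'; apply: islin_bigsum => lc; apply: islin_bigsum => u.
  - by apply: islinf_mulr; apply: islinf_mulr.
  - by apply: islinf_mulr; apply: islinf_mull; apply: (lmr (fun x => phi p x u.2) (mul^~ lc`_1)).
  - by apply: islinf_mull.
have T1 : isbilin (fun p p' => \sum_(lb <- swe cop 2 (pi b)) \sum_(lc <- swe cop 2 (pi c))
    \sum_(u <- cop (pi d')) T p p' lb`_0 lb`_1 lb`_2 lc`_0 lc`_1 lc`_2 u.1 u.2 : k^o).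
  split=> y; apply: islin_bigsum => lb; apply: islin_bigsum => lc; apply: islin_bigsum => u.
    by apply: islinf_mulr; apply: islinf_mull.
  by apply: islinf_mull.
apply/esym; apply: etrans _ (pi_copsum _ T1); apply: eq_bigr => p _.
apply: etrans _ (pi_swe2 _ (T2 _ _)); apply: eq_bigr => lb _.
apply: etrans _ (pi_swe2 _ (T3 _ _ _ _ _)); apply: eq_bigr => lc _.
apply: etrans _ (pi_copsum _ (T4 _ _ _ _ _ _ _ _)); apply: eq_bigr => u _.
exact: (congr1 (fun x => phi _ _ _ * phi _ x _ * phi _ _ _) (pi_mul _ _)).
Qed.

Lemma phiQ_one a b : phiQ a oQ b = peps a * peps b.
Proof. by rewrite /phiQ pi_one -!eps_pi; case: HM => _ _ [_ _ _ + _]; apply. Qed.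

Lemma phiQ_S a : \sum_(l <- swe pcop 4 a)
  phiQ l`_0 (sQ l`_2) l`_4 * betaQ l`_1 * alphaQ l`_3 = peps a.
Proof.
have E : \sum_(l <- swe cop 4 (pi a)) phi l`_0 (S l`_2) l`_4 * beta l`_1 * alpha l`_3 = peps a.
  by rewrite -eps_pi; case: HM => _ _ [_ _ _ _ [_ /(_ (pi a))[]]].
apply: etrans _ E.
apply: etrans _ (pi_swe4 (T :=
  fun x0 x1 x2 x3 x4 => phi x0 (S x2) x4 * beta x1 * alpha x3 : k^o) a _ _ _ _ _).
- by apply: eq_bigr => l _; exact: (congr1 (fun x => phi _ x _ * _ * _) (pi_S _)).
- by move=> b c e e'; do 2 apply: islinf_mulr.
- by move=> b c e e'; apply: islinf_mulr; apply: islinf_mull; apply: (lin_beta HM).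
- by move=> b c e e'; do 2 apply: islinf_mulr; apply: (islinf_comp (lf2 _ _) (lin_S HM)).
- by move=> b c e e'; apply: islinf_mull; apply: (lin_alpha HM).
- by move=> b c e e'; do 2 apply: islinf_mulr.
Qed.

Lemma phiinvQ_S a : \sum_(l <- swe pcop 4 a)
  phiinvQ (sQ l`_0) l`_2 (sQ l`_4) * alphaQ l`_1 * betaQ l`_3 = peps a.
Proof.
have E : \sum_(l <- swe cop 4 (pi a)) phiinv (S l`_0) l`_2 (S l`_4) * alpha l`_1 * beta l`_3 =
  peps a.
  by rewrite -eps_pi; case: HM => _ _ [_ _ _ _ [_ /(_ (pi a))[]]].
apply: etrans _ E.
apply: etrans _ (pi_swe4 (T :=
  fun x0 x1 x2 x3 x4 => phiinv (S x0) x2 (S x4) * alpha x1 * beta x3 : k^o) a _ _ _ _ _).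
- by apply: eq_bigr => l _; exact: (congr2 (fun x y => phiinv x _ y * _ * _) (pi_S _) (pi_S _)).
- by move=> b c e e'; do 2 apply: islinf_mulr; apply: (islinf_comp (li1 _ _) (lin_S HM)).
- by move=> b c e e'; apply: islinf_mulr; apply: islinf_mull; apply: (lin_alpha HM).
- by move=> b c e e'; do 2 apply: islinf_mulr.
- by move=> b c e e'; apply: islinf_mull; apply: (lin_beta HM).
- by move=> b c e e'; do 2 apply: islinf_mulr; apply: (islinf_comp (li3 _ _) (lin_S HM)).
Qed.

(** An expression that depends on its second argument through [pi] only sees the cut at the source;
    [copsum_end] is the mirror statement for the target. Each side of axiom (i) on paths thus
    reduces to one term. *)
Lemma copsum_src (W : lmodType k) (T : kQ -> kQ -> W) p : isbilin T ->
  (forall x y, pi y = 0 -> T x y = 0) -> pathb p ->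
  \sum_(x <- pcop (pb p)) T x.1 x.2 = T (pb p) (pb (p.1, [::])).
Proof.
move=> bT T0 Pp; apply: etrans (copsum_pb bT Pp) _; case: p Pp => v l Pp /=.
rewrite -(splits_counitr tgt (fun x y => T (pb x) (pb y))) [RHS]big_mkcond /=.
apply: eq_big_seq => x /(splits_path Pp)[_ P2]; case: ifP => // nx.
by apply: T0; rewrite pi_pb // nx.
Qed.

Lemma copsum_end (W : lmodType k) (T : kQ -> kQ -> W) p : isbilin T ->
  (forall x y, pi x = 0 -> T x y = 0) -> pathb p ->
  \sum_(x <- pcop (pb p)) T x.1 x.2 = T (pb (pend p, [::])) (pb p).
Proof.
move=> bT T0 Pp; apply: etrans (copsum_pb bT Pp) _; case: p Pp => v l Pp /=.
rewrite -(splits_counitl tgt (fun x y => T (pb x) (pb y))) [RHS]big_mkcond /=.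
apply: eq_big_seq => x /(splits_path Pp)[P1 _]; case: ifP => // nx.
by apply: T0; rewrite pi_pb // nx.
Qed.

Section QuasiAssociativity.

Let mQ1 y : islin (mQ^~ y). Proof. by case: bilin_mQ => + _; apply. Qed.
Let mQ2 x : islin (mQ x). Proof. by case: bilin_mQ => _; apply. Qed.
Let pf1 y z : islinf (fun x => phiQ x y z) := islinf_comp (lf1 _ _) lin_pi.
Let pf2 x z : islinf (fun y => phiQ x y z) := islinf_comp (lf2 _ _) lin_pi.
Let pf3 x y : islinf (phiQ x y) := islinf_comp (lf3 _ _) lin_pi.

Let BL (f : kQ -> k) (m : kQ -> kQ) : islinf f -> islin m -> isbilin (fun x y => f y *: m x).
Proof. by move=> lc lm; split=> y; [apply: islin_scale | apply: islin_scalel]. Qed.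
Let BR (f : kQ -> k) (m : kQ -> kQ) : islinf f -> islin m -> isbilin (fun x y => f x *: m y).
Proof. by move=> lc lm; split=> y; [apply: islin_scalel | apply: islin_scale]. Qed.
Let bilin_sum I (r : seq I) (T : I -> kQ -> kQ -> kQ) :
  (forall i, isbilin (T i)) -> isbilin (fun x y => \sum_(i <- r) T i x y).
Proof. by move=> HT; split=> y; apply: islin_bigsum => i; case: (HT i). Qed.

Let LQ a b c := \sum_(p <- pcop a) \sum_(q <- pcop b) \sum_(r <- pcop c)
      phiQ p.2 q.2 r.2 *: mQ p.1 (mQ q.1 r.1).
Let RQ a b c := \sum_(p <- pcop a) \sum_(q <- pcop b) \sum_(r <- pcop c)
      phiQ p.1 q.1 r.1 *: mQ (mQ p.2 q.2) r.2.

Let L3 p p' q q' : isbilin (fun r r' => phiQ p' q' r' *: mQ p (mQ q r)) :=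
  BL (pf3 _ _) (islin_comp (mQ2 _) (mQ2 _)).
Let L2 c p p' : isbilin (fun q q' => \sum_(r <- pcop c) phiQ p' q' r.2 *: mQ p (mQ q r.1)).
Proof. by apply: bilin_sum => r; exact: (BL (pf2 _ _) (islin_comp (mQ2 _) (mQ1 _))). Qed.
Let L1 b c : isbilin (fun p p' => \sum_(q <- pcop b) \sum_(r <- pcop c) phiQ p' q.2 r.2 *: mQ p (mQ q.1 r.1)).
Proof. by apply: bilin_sum => q; apply: bilin_sum => r; exact: (BL (pf1 _ _) (mQ1 _)). Qed.
Let R3 p p' q q' : isbilin (fun r r' => phiQ p q r *: mQ (mQ p' q') r') :=
  BR (pf3 _ _) (mQ2 _).
Let R2 c p p' : isbilin (fun q q' => \sum_(r <- pcop c) phiQ p q r.1 *: mQ (mQ p' q') r.2).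
Proof. by apply: bilin_sum => r; exact: (BR (pf2 _ _) (islin_comp (mQ1 _) (mQ2 _))). Qed.
Let R1 b c : isbilin (fun p p' => \sum_(q <- pcop b) \sum_(r <- pcop c) phiQ p q.1 r.1 *: mQ (mQ p' q.2) r.2).
Proof. by apply: bilin_sum => q; apply: bilin_sum => r; exact: (BR (pf1 _ _) (islin_comp (mQ1 _)
  (mQ1 _))). Qed.

Let ph1 x y z : pi x = 0 -> phiQ x y z = 0.
Proof. by move=> x0; rewrite /phiQ x0; apply: (islinf0 (lf1 _ _)). Qed.
Let ph2 x y z : pi y = 0 -> phiQ x y z = 0.
Proof. by move=> x0; rewrite /phiQ x0; apply: (islinf0 (lf2 _ _)). Qed.
Let ph3 x y z : pi z = 0 -> phiQ x y z = 0.
Proof. by move=> x0; rewrite /phiQ x0; apply: (islinf0 (lf3 _ _)). Qed.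
Let sc0 (x : k) (y : kQ) : x = 0 -> x *: y = 0.
Proof. by move=> ->; exact: scale0r. Qed.

Let LQ_pb p q r : pathb p -> pathb q -> pathb r -> LQ (pb p) (pb q) (pb r) =
  ph p.1 q.1 r.1 *: mQ (pb p) (mQ (pb q) (pb r)).
Proof.
move=> Pp Pq Pr.
apply: etrans (copsum_src (L1 _ _) _ Pp) _.
  by move=> x y y0; apply: big1 => q' _; apply: big1 => r' _; apply: sc0; apply: ph1.
apply: etrans (copsum_src (L2 _ _ _) _ Pq) _.
  by move=> x y y0; apply: big1 => r' _; apply: sc0; apply: ph2.
apply: etrans (copsum_src (L3 _ _ _ _) _ Pr) _.
  by move=> x y y0; apply: sc0; apply: ph3.
by rewrite /phiQ !pi_nil.
Qed.

Let RQ_pb p q r : pathb p -> pathb q -> pathb r -> RQ (pb p) (pb q) (pb r) =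
  ph (pend p) (pend q) (pend r) *: mQ (mQ (pb p) (pb q)) (pb r).
Proof.
move=> Pp Pq Pr.
apply: etrans (copsum_end (R1 _ _) _ Pp) _.
  by move=> x y y0; apply: big1 => q' _; apply: big1 => r' _; apply: sc0; apply: ph1.
apply: etrans (copsum_end (R2 _ _ _) _ Pq) _.
  by move=> x y y0; apply: big1 => r' _; apply: sc0; apply: ph2.
apply: etrans (copsum_end (R3 _ _ _ _) _ Pr) _.
  by move=> x y y0; apply: sc0; apply: ph3.
by rewrite /phiQ !pi_nil.
Qed.

Lemma mQ_quasi_assoc a b c : LQ a b c = RQ a b c.
Proof.
apply: (@kQ_lin_eq k glT arT src tgt kQ (fun a => LQ a b c) (fun a => RQ a b c)).
- exact: (islin_kcopsum (L1 _ _)).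
- exact: (islin_kcopsum (R1 _ _)).
move=> p Pp _.
apply: (@kQ_lin_eq k glT arT src tgt kQ (fun b => LQ (pb p) b c) (fun b => RQ (pb p) b c)).
- by apply: islin_bigsum => p'; exact: (islin_kcopsum (L2 _ _ _)).
- by apply: islin_bigsum => p'; exact: (islin_kcopsum (R2 _ _ _)).
move=> q Pq _.
apply: (@kQ_lin_eq k glT arT src tgt kQ (fun c => LQ (pb p) (pb q) c) (fun c => RQ (pb p)
  (pb q) c)).
- by apply: islin_bigsum => p'; apply: islin_bigsum => q'; exact: (islin_kcopsum (L3 _ _ _ _)).
- by apply: islin_bigsum => p'; apply: islin_bigsum => q'; exact: (islin_kcopsum (R3 _ _ _ _)).
move=> r Pr _; apply: etrans (LQ_pb Pp Pq Pr) _; apply: etrans _ (esym (RQ_pb Pp Pq Pr)).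
case: p Pp => v l Pp; case: q Pq => w l' Pq; case: r Pr => u l'' Pr.
rewrite /mQ (mulQ_pb _ _ _ Pp Pq) (mulQ_pb _ _ _ Pq Pr).
exact: (esym (mulp_quasi_assoc gmA lin_ar lin_al ar_in al_in arar aral alal Pp Pq Pr)).
Qed.

(** The middle Sweedler factor, contracted with [alphaQ], reduces to the vertex between the two
    outer parts of the path, and the sum becomes the one of [alpha_sumE]. *)
Lemma sQ_alpha a : \sum_(l <- swe pcop 2 a) alphaQ l`_1 *: mQ (sQ l`_0) l`_2 = alphaQ a *: oQ.
Proof.
apply: etrans (swe2E _ _ _) _.
have la : islinf alphaQ := islinf_comp (lin_alpha HM) lin_pi.
have b1 y : isbilin (fun x x' => alphaQ x' *: mQ (sQ x) y).
  exact: (BL la (islin_comp (mQ1 _) lin_sQ)).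
have b2 : isbilin (fun x y => \sum_(q <- pcop x) alphaQ q.2 *: mQ (sQ q.1) y).
  split=> y; first exact: (islin_kcopsum (b1 y)).
  by apply: islin_bigsum => q; apply: islin_scale.
apply: (@kQ_lin_eq k glT arT src tgt kQ
  (fun a => \sum_(p <- pcop a) \sum_(q <- pcop p.1) alphaQ q.2 *: mQ (sQ q.1) p.2)
    (fun a => alphaQ a *: oQ)).
- exact: (islin_kcopsum b2).
- exact: (islin_scalel _ la).
move=> [v l] Pp _; apply: etrans (copsum_pb b2 Pp) _.
have E := alpha_sumE gmV lin_ar lin_al sg_in sga Pp.
apply: etrans (etrans _ E) _.
  apply: eq_big_seq => x /(splits_path Pp)[P1 P2].
  apply: etrans (copsum_src (b1 _) _ P1) _.
    move=> y z z0; apply: sc0; rewrite /alphaQ z0; exact: (islinf0 (lin_alpha HM)).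
  rewrite /alphaQ pi_nil; apply: congr1; rewrite /sQ (SQ_pb _ _ P1); exact: erefl.
rewrite /alphaQ pi_pb //=; case: ifP => // _.
exact: (esym (sc0 _ (islinf0 (lin_alpha HM)))).
Qed.

Lemma sQ_beta a : \sum_(l <- swe pcop 2 a) betaQ l`_1 *: mQ l`_0 (sQ l`_2) = betaQ a *: oQ.
Proof.
apply: etrans (swe2E _ _ _) _.
have la : islinf betaQ := islinf_comp (lin_beta HM) lin_pi.
have b1 y : isbilin (fun x x' => betaQ x' *: mQ x (sQ y)).
  exact: (BL la (mQ1 _)).
have b2 : isbilin (fun x y => \sum_(q <- pcop x) betaQ q.2 *: mQ q.1 (sQ y)).
  split=> y; first exact: (islin_kcopsum (b1 y)).
  by apply: islin_bigsum => q; apply: islin_scale; exact: (islin_comp (mQ2 _) lin_sQ).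
apply: (@kQ_lin_eq k glT arT src tgt kQ
  (fun a => \sum_(p <- pcop a) \sum_(q <- pcop p.1) betaQ q.2 *: mQ q.1 (sQ p.2))
    (fun a => betaQ a *: oQ)).
- exact: (islin_kcopsum b2).
- exact: (islin_scalel _ la).
move=> [v l] Pp _; apply: etrans (copsum_pb b2 Pp) _.
have E := beta_sumE gVm lin_ar lin_al sg_in sgb Pp.
apply: etrans (etrans _ E) _.
  apply: eq_big_seq => x /(splits_path Pp)[P1 P2].
  apply: etrans (copsum_src (b1 _) _ P1) _.
    move=> y z z0; apply: sc0; rewrite /betaQ z0; exact: (islinf0 (lin_beta HM)).
  rewrite /betaQ pi_nil; apply: congr1; rewrite /sQ (SQ_pb _ _ P2); exact: erefl.
rewrite /betaQ pi_pb //=; case: ifP => // _.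
exact: (esym (sc0 _ (islinf0 (lin_beta HM)))).
Qed.

Lemma kQ_graded_majid : graded_majid mQ oQ phiQ phiinvQ sQ alphaQ betaQ.
Proof.
split.
- split; first exact: kQ_coalgebra.
    split.
    + split; [exact: bilin_mQ | exact: (cop_mulQ ar_in al_in) |].
      move=> a b; exact: (etrans (esym (eps_pi _)) (etrans (congr1 eps (pi_mul a b))
        (etrans (eps_mul HM _ _) (congr2 *%R (eps_pi _) (eps_pi _))))).
    + split; last exact: peps_pb.
      move=> f g lf lg; apply: etrans (@copsum_pb k _ _ src tgt k^o _ (g1, [::])
        (isbilin_mulf lf lg) isT) _.
      by rewrite /= !big_seq1.
    + split; [exact: (trilin_pi (trilin_phi HM)) | exact: (trilin_pi (trilin_phiinv HM)) | exact: phiQK | exact: phiinvQK].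
    + split; [exact: lin_sQ | exact: (cop_SQ sg_in) | | exact: (islinf_comp (lin_alpha HM) lin_pi)
        | exact: (islinf_comp (lin_beta HM) lin_pi)].
      move=> a; exact: (etrans (esym (eps_pi _)) (etrans (congr1 eps (pi_S a))
        (etrans (eps_S HM _) (eps_pi _)))).
  split.
  + exact: mQ_quasi_assoc.
  + by move=> a; split; [apply: (mulQ_unitl ar gm1 al1) | apply: (mulQ_unitr al gx1 ar1)].
  + exact: phiQ_pentagon.
  + exact: phiQ_one.
  + split=> a; split; [exact: sQ_alpha | exact: sQ_beta | exact: phiQ_S | exact: phiinvQ_S].
- move=> i j x y /deg_homog Hx /deg_homog Hy; apply/deg_homog; exact: mulQ_deg Hx Hy.
- apply/deg_homog; exact: (@deg_pb k glT arT src tgt g1 [::]).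
- move=> n x /deg_homog Hx; apply/deg_homog; exact: SQ_deg Hx.
split.
- move=> i j l x y z /deg_homog Hx /deg_homog Hy /deg_homog Hz ijl.
  case: (posnP i) => [i0|i0]; last exact: ph1 (pi_deg Hx i0).
  case: (posnP j) => [j0|j0]; last exact: ph2 (pi_deg Hy j0).
  by apply: ph3; apply: pi_deg Hz _; move: ijl; rewrite i0 j0.
- move=> n x /deg_homog Hx n0; rewrite /alphaQ (pi_deg Hx n0); exact: (islinf0 (lin_alpha HM)).
- move=> n x /deg_homog Hx n0; rewrite /betaQ (pi_deg Hx n0); exact: (islinf0 (lin_beta HM)).
Qed.

End QuasiAssociativity.

(** ** The embedding of the associated graded coalgebra *)

Notation Prep := (@Prep k glT arT src tgt).
Notation App := (@App k glT arT src tgt).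

Notation conv := (conv cop).

(* The coefficient of the path [(v, l)] in the image of an element of degree [size l]. *)
Fixpoint cq v (l : seq arT) : H -> k :=
  if l is a :: l' then conv (cq (tgt a) l') (d (val a)) else dl (val v).

Lemma lin_cq v l : islinf (cq v l).
Proof. by elim: l v => [|a l IH] v //=; apply: (islinf_conv Hc). Qed.
Hint Resolve lin_cq : core.

(** The annihilators of the filtration multiply like powers of [J]. Consequently, in the next two
    lemmas, a factor of a convolution may be replaced by a form that agrees with it on a lower
    step. *)
Lemma conv_kill i j f f' x : islinf f -> islinf f' ->
  (forall y, Fs i y -> f y = 0) -> (forall y, Fs j y -> f' y = 0) ->
  Fs (i + j) x -> conv f f' x = 0.
Proof.
move=> lf lf' Hf Hf' Hx; rewrite -apply_ract //; apply: Hf'.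
exact: (Fs_ract_kill Hc Hp (m := i)).
Qed.

Lemma conv_eql i j f f1 f' x : islinf f -> islinf f1 -> islinf f' ->
  (forall y, Fs i y -> f y = f1 y) -> (forall y, Fs j y -> f' y = 0) ->
  Fs (i + j) x -> conv f f' x = conv f1 f' x.
Proof.
move=> lf lff lf' E Hf' Hx; apply/eqP; rewrite -subr_eq0.
rewrite -!apply_ract // -(islinfB lf') -(ractB cop).
rewrite apply_ract //; apply/eqP; apply: (conv_kill (i := i) (j := j)) => //.
  exact: islinf_sub.
by move=> y Hy; rewrite E // subrr.
Qed.

Lemma conv_eqr i j f f' f1 x : islinf f -> islinf f' -> islinf f1 ->
  (forall y, Fs i y -> f y = 0) -> (forall y, Fs j y -> f' y = f1 y) ->
  Fs (i + j) x -> conv f f' x = conv f f1 x.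
Proof.
move=> lf lf' lff Hf E Hx; apply/eqP; rewrite -subr_eq0.
rewrite -!apply_hit // -(islinfB lf) -(hitB cop).
rewrite apply_hit //; apply/eqP; apply: (conv_kill (i := i) (j := j)) => //.
  exact: islinf_sub.
by move=> y Hy; rewrite E // subrr.
Qed.

Lemma cq_kill v l x : Fs (size l) x -> cq v l x = 0.
Proof.
elim: l v x => [|a l IH] v x /=; first by move=> ->; apply: islinf0.
move=> Hx; apply: (conv_kill (i := size l) (j := 1)) => //; last by rewrite addn1.
- by move=> y; apply: IH.
- by move=> y; apply: dP.
Qed.

Lemma conv_d_src a f x : islinf f -> F 1%N x -> conv (d (val a)) f x =
  f (val (src a)) * d (val a) x.
Proof. by move=> lf Fx; rewrite -apply_hit // (d_hit Hc Hp ld dP dB sB Bst (arP a)). Qed.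

Lemma conv_d_tgt a f x : islinf f -> F 1%N x -> conv f (d (val a)) x =
  f (val (tgt a)) * d (val a) x.
Proof. by move=> lf Fx; rewrite -apply_ract // (d_ract Hc Hp ld dP dB sB Bst (arP a)). Qed.

Lemma conv_dl v f x : islinf f -> F 0%N x ->
  conv (dl (val v)) f x = f (val v) * dl (val v) x /\
  conv f (dl (val v)) x = f (val v) * dl (val v) x.
Proof.
move=> lf /(coradical_spn Hc Hp); elim=> [y ->|c g y gg _ [IH1 IH2]].
  by rewrite !islinf0 ?mulr0 //; apply: (islinf_conv Hc).
rewrite !(islinf_conv Hc _ _) // !(ldl _) !(gl_conv gg) // IH1 IH2 !mulrDr (dlE (glP v) gg).
by have [->|_] := eqVneq (val v) g; rewrite ?(mulr1, mul1r, mulr0, mul0r); split; ring.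
Qed.

(** Convolving with [f] on the right only touches the form of the first arrow, which is an
    eigenvector on [F 1]; values elsewhere do not count because the other factor kills the lower
    steps. *)
Lemma cq_start v l f x : islinf f -> pathb (v, l) -> F (size l) x ->
  conv (cq v l) f x = f (val v) * cq v l x.
Proof.
move=> lf; case: l => [|a l] Pl /= Fx; first by case: (conv_dl v lf Fx).
rewrite -(convA Hc) //; have := Pl; rewrite pathb_cons => /andP[/eqP <- _].
have lc : islinf (conv (d (val a)) f) by apply: (islinf_conv Hc).
rewrite -!apply_hit // -(islinfZ (lin_cq _ _)) -(hitZ cop).
rewrite !apply_hit //; apply: (conv_eqr (i := size l) (j := 2)) => //.
- exact: islinf_mull.
- by move=> y; apply: cq_kill.
- by move=> y Fy; rewrite conv_d_src.
by rewrite addn2.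
Qed.

Lemma cq_end v l f x : islinf f -> F (size l) x ->
  conv f (cq v l) x = f (val (pend (v, l))) * cq v l x.
Proof.
move=> lf; elim: l v x => [|a l IH] v x /= Fx; first by case: (conv_dl v lf Fx).
have lc : islinf (conv f (cq (tgt a) l)) by apply: (islinf_conv Hc).
rewrite (convA Hc) // -[conv (conv _ _) _ _]apply_hit // -[conv (cq _ _) _ _]apply_hit // pend_cons; apply: IH.
by apply: (@Fs_hit_kill _ _ _ _ Hc Hp 1 (size l).+1) => // y; apply: dP.
Qed.

(** Convolution of path forms is concatenation, with the later path on the left: the dual of cutting
    paths. *)
Lemma cq_cat v l l' x : pathb (v, l ++ l') -> F (size l + size l') x ->
  cq v (l ++ l') x = conv (cq (pend (v, l)) l') (cq v l) x.
Proof.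
elim: l v x => [|a l IH] v x Pl Fx.
  by rewrite /= cq_start // dlE ?eqxx ?mul1r //; apply: glP.
move: Pl; rewrite cat_cons pathb_cons => /andP[_ Pl];
  rewrite /= (convA Hc) // -[conv (conv _ _) _ _]apply_hit //.
  rewrite -[conv (cq _ (l ++ _)) _ _]apply_hit //.
  rewrite IH //; apply: (@Fs_hit_kill _ _ _ _ Hc Hp 1 (size l + size l').+1) => // y; exact: dP.
exact: (islinf_conv Hc).
Qed.

(** The idempotent [dl w] of the starting vertex can be inserted between the two forms, since it
    fixes the left one in the relevant degree; absorbed by the right one it gives 0, because that
    path ends elsewhere. *)
Lemma cq_noncomp w l' v l x : w != pend (v, l) -> pathb (w, l') -> F (size l + size l') x ->
  conv (cq w l') (cq v l) x = 0.
Proof.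
move=> ne Pl' Fx.
have -> : conv (cq w l') (cq v l) x = conv (conv (cq w l') (dl (val w))) (cq v l) x.
  apply: (conv_eql (i := (size l').+1) (j := size l)) => //.
  - exact: (islinf_conv Hc).
  - by move=> y Fy; rewrite cq_start // dlE ?eqxx ?mul1r //; apply: glP.
  - by move=> y; apply: cq_kill.
  by rewrite addSn addnC.
rewrite -(convA Hc) //; apply: (conv_kill (i := size l') (j := (size l).+1)) => //.
- exact: (islinf_conv Hc).
- by move=> y; apply: cq_kill.
- move=> y Fy; rewrite cq_end // dlE; [|exact: glP|exact: glP].
  by rewrite (inj_eq val_inj) (negPf ne) mul0r.
by rewrite addnS addnC.
Qed.

Lemma cq_arrow v a x : F 1%N x -> cq v [:: a] x = d (val a) x.
Proof.
by move=> Fx; rewrite /= conv_d_tgt // dlE ?eqxx ?mul1r //; apply: (glP (tgt a)).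
Qed.

Lemma conv_cq_d w l a x : pathb (w, l) -> F (size l).+1 x ->
  conv (cq w l) (d (val a)) x = (w == tgt a)%:R * cq (src a) (a :: l) x.
Proof.
move=> Pl Fx; have [->|ne] := eqVneq w (tgt a); first by rewrite mul1r.
rewrite mul0r -(@cq_noncomp w l (src a) [:: a] x) //.
apply: (conv_eqr (i := size l) (j := 2)) => //.
- by move=> y; apply: cq_kill.
- by move=> y Fy; rewrite cq_arrow.
by rewrite addn2.
Qed.

Lemma cq_rcons v l a x : pathb (v, rcons l a) -> F (size l).+1 x ->
  cq v (rcons l a) x = conv (d (val a)) (cq v l) x.
Proof.
move=> Pl Fx; rewrite -cats1 cq_cat ?cats1 ?addn1 //.
apply: (conv_eql (i := 2) (j := size l)) => //.
- by move=> y Fy; rewrite cq_arrow.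
- by move=> y; apply: cq_kill.
Qed.

Lemma cop_splitT n x : F n x -> exists (As : seq arT) (Gs : seq glT) (Ua : arT -> H)
    (Ug : glT -> H) (rest : seq (H * H)),
  [/\ uniq As, uniq Gs, (forall a, Fs n (Ua a)) /\ (forall g, F n (Ug g)),
      forall p, p \in rest -> Fs n.-1 p.1 &
      teq2 (cop x) ([seq (Ua a, val a) | a <- As] ++ [seq (Ug g, val g) | g <- Gs] ++ rest)].
Proof.
move=> /(cop_split Hc Hp ldl dlE ld dP dB sB)[As [Gs [Ua [Ug [rest [[uA BA] [uG BG] [Fa Fg] Hr E]]]]]].
have valK (K : H -> Prop) (xs : seq H) (T := {y : H | `[< K y >]} : choiceType) :
    (forall y, y \in xs -> K y) -> map val (pmap insub xs : seq T) = xs.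
  move=> Kx; rewrite pmap_filter; last by move=> y; exact: insubK.
  by apply/all_filterP/allP => y /Kx Ky; rewrite isSome_insub; apply/asboolP.
exists (pmap insub As), (pmap insub Gs), (fun a => Ua (val a)), (fun g => Ug (val g)), rest.
split => //; try exact: pmap_sub_uniq.
have -> : [seq (Ua (val a), val a) | a <- (pmap insub As : seq arT)] = [seq (Ua a, a) | a <- As].
  by rewrite -[in RHS](valK _ _ BA) -map_comp.
have -> : [seq (Ug (val a), val a) | a <- (pmap insub Gs : seq glT)] = [seq (Ug a, a) | a <- Gs].
  by rewrite -[in RHS](valK _ _ BG) -map_comp.
exact: E.
Qed.

Lemma FsS' n x : Fs n x -> F n x. Proof. exact: (FsS Hc Hp). Qed.

(* Summands [p.1 (x) p.2] of a coproduct whose contribution in degree [n.+1] is determined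
   by the class of [p.2] in degree 1 and that of [p.1] in degree [n]. *)
Definition gr_split n (p : H * H) := [\/ F n p.1 /\ F 1%N p.2, F 0%N p.2 | Fs n p.1].

Lemma splitT_gr_split n As Gs Ua Ug (rest : seq (H * H)) :
  (forall a : arT, Fs n.+1 (Ua a)) -> (forall p, p \in rest -> Fs n p.1) ->
  forall p, p \in [seq (Ua a, val a) | a <- As] ++ [seq (Ug g, val g) | g : glT <- Gs] ++ rest ->
  gr_split n p.
Proof.
move=> Fa Fr p; rewrite !mem_cat => /or3P[/mapP[a _ ->]|/mapP[g _ ->]|/Fr Hp'].
- by apply: Or31; split; [apply: Fa | apply: (basis_F1 Bst (arP a))].
- by apply: Or32; apply: (gl_F0 Hc Hp (glP g)).
exact: Or33.
Qed.

Definition is_gr_image n x (z : kQ) :=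
  forall p, pathb p -> co z p = (size p.2 == n)%:R * cq p.1 p.2 x.

(** The coefficient on a path with first arrow [c] is a convolution with [d (val c)], so any
    representative of the coproduct computes it. In each case of [gr_split] the term agrees with the
    lengthened image: both are given by leading classes, or both vanish. *)
Lemma gr_image_split n x s (fz : H -> kQ) :
  (forall y, F n y -> is_gr_image n y (fz y)) -> teq2 (cop x) s ->
  (forall p, p \in s -> gr_split n p) ->
  is_gr_image n.+1 x (\sum_(q <- s) Prep (cl q.2) (fz q.1)).
Proof.
move=> Hf E Hs [v l] Pp; rewrite (islinf_sum (islinf_co _)).
case: l Pp => [|c l] Pp.
  by rewrite mul0r big1 // => q _; exact: co_Prep_nil.
have := Pp; rewrite pathb_cons => /andP[_ Pl]; rewrite /= eqSS.
have -> : (size l == n)%:R * conv (cq (tgt c) l) (d (val c)) x =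
    \sum_(q <- s) (size l == n)%:R * (cq (tgt c) l q.1 * d (val c) q.2).
  by rewrite (convE (lin_cq _ _) (ld _) E) mulr_sumr.
apply: eq_big_seq => q /Hs qs; apply: etrans (co_Prep _ _ Pp) _.
case: qs => [[F1q F2q]|Fq|Fq].
- by rewrite (Hf _ F1q (_, l) Pl) clE //=; ring.
- by rewrite cl_F0 // mcoeff0 dP //; ring.
rewrite (Hf _ (FsS' Fq) (_, l) Pl) /=; case: eqP => [ln|_]; last by rewrite !mul0r mulr0.
by rewrite cq_kill ?ln //; ring.
Qed.

(** The point is finite support of the prescribed coefficients, although the quiver may be infinite:
    the split coproduct is a finite list, and lengthening the images of its left factors produces
    the element. *)
Lemma gr_image_exists n x : exists z, F n x -> is_gr_image n x z.
Proof.
elim: n x => [|n IH] x.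
  have [Fx|nFx] := pselect (F 0%N x); last by exists 0.
  elim: (proj1 (coradical_spn Hc Hp x) Fx) => [y ->|c g y gg _ [z Hz]].
    exists 0 => _ p Pp; rewrite (islinf0 (islinf_co _)).
    by rewrite islinf0 ?mulr0.
  have Fy' : F 0%N (c *: g + y) -> F 0%N y.
    move=> Fcy; rewrite -[y](addKr (c *: g)) addrC; apply: (subspaceB (sF 0)) => //.
    by apply: (subspaceZ (sF 0)); apply: (gl_F0 Hc Hp).
  exists (c *: pb (mkgl gg, [::]) + z) => /Fy' Fy p Pp.
  rewrite (islinf_co p) (Hz Fy p Pp) (lin_cq _ _) co_pb //.
  case: p {Pp} => v [|a l] /=; last by rewrite xpair_eqE andbF !mul0r mulr0 addr0.
  rewrite (dlE (glP v) gg) xpair_eqE eqxx andbT.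
  have -> : (mkgl gg == v) = (val v == g) by rewrite -(inj_eq val_inj) eq_sym.
  by rewrite !mul1r.
have [Fx|nFx] := pselect (F n.+1 x); last by exists 0.
have [fz Hf] := choice IH.
have [As [Gs [Ua [Ug [rest [_ _ [Fa Fg] Fr E]]]]]] := cop_splitT Fx.
eexists => _; apply: (gr_image_split Hf E); exact: splitT_gr_split.
Qed.

Definition fQ n x : kQ := proj1_sig (cid (gr_image_exists n x)).

Lemma fQE n x p : F n x -> pathb p -> co (fQ n x) p = (size p.2 == n)%:R * cq p.1 p.2 x.
Proof. by rewrite /fQ; case: cid => z /= Hz /Hz Hx /Hx. Qed.

Local Opaque fQ.

Lemma fQ_unique n x z : F n x -> is_gr_image n x z -> fQ n x = z.
Proof. by move=> Fx Hz; apply: co_inj => p Pp; rewrite fQE // Hz. Qed.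

Lemma fQ_split n x s : F n.+1 x -> teq2 (cop x) s ->
  (forall p, p \in s -> gr_split n p) ->
  fQ n.+1 x = \sum_(q <- s) Prep (cl q.2) (fQ n q.1).
Proof.
move=> Fx E Hs; apply: fQ_unique => //; apply: gr_image_split => //.
by move=> y Fy p Pp; apply: fQE.
Qed.

(** The same recursion at the other end of paths, in the form required by the antipode, which
    reverses coproducts. *)
Lemma fQ_split_app n x s : F n.+1 x -> teq2 (cop x) s ->
  (forall p, p \in s -> gr_split n (p.2, p.1)) ->
  fQ n.+1 x = \sum_(q <- s) App (cl q.1) (fQ n q.2).
Proof.
move=> Fx E Hs; apply: fQ_unique => // -[v l] Pp.
rewrite (islinf_sum (islinf_co _)).
case/lastP: l Pp => [|l c] Pp.
  by rewrite mul0r big1 // => q _; exact: co_App_nil.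
have := Pp; rewrite pathb_rcons => /andP[Pl _]; rewrite /= size_rcons eqSS.
have -> : (size l == n)%:R * cq v (rcons l c) x =
    \sum_(q <- s) (size l == n)%:R * (d (val c) q.1 * cq v l q.2).
  have [ln|_] := eqVneq (size l) n; last by rewrite mul0r big1 // => q _; rewrite mul0r.
  rewrite cq_rcons ?ln // (convE (ld _) (lin_cq _ _) E) mul1r.
  by apply: eq_bigr => q _; rewrite mul1r.
apply: eq_big_seq => q /Hs qs; apply: etrans (co_App _ _ Pp) _.
case: qs => /= [[F1q F2q]|Fq|Fq].
- by rewrite (fQE F1q Pl) clE //=; ring.
- by rewrite cl_F0 // mcoeff0 dP //; ring.
rewrite (fQE (FsS' Fq) Pl) /=; case: eqP => [ln|_]; last by rewrite !mul0r mulr0.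
by rewrite cq_kill ?ln //; ring.
Qed.

Lemma fQ_lin n : islin_on (F n) (fQ n).
Proof.
move=> c x y Fx Fy; apply: fQ_unique.
  by apply: (subspaceD (sF n)) => //; apply: (subspaceZ (sF n)).
by move=> p Pp; rewrite (islinf_co p) !fQE // (lin_cq _ _); ring.
Qed.

Lemma fQ_deg n x : F n x -> deg n (fQ n x).
Proof.
move=> Fx p Pp; rewrite fQE //.
by have [//|_] := eqVneq (size p.2) n; rewrite mul0r eqxx.
Qed.

Lemma fQ_Fs n x : Fs n x -> fQ n x = 0.
Proof.
move=> Fx; apply: fQ_unique; first exact: FsS'.
move=> p Pp; rewrite (islinf0 (islinf_co _)); case: eqP => [ln|_]; last by rewrite mul0r.
by rewrite cq_kill ?ln ?mulr0.
Qed.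

Section SplitCoproduct.
Variables (n : nat) (x : H) (As : seq arT) (Gs : seq glT) (Ua : arT -> H) (Ug : glT -> H).
Variable (rest : seq (H * H)).
Hypotheses (uA : uniq As) (uG : uniq Gs) (Fa : forall a, Fs n (Ua a))
  (Fr : forall p, p \in rest -> Fs n.-1 p.1)
  (E : teq2 (cop x) ([seq (Ua a, val a) | a <- As] ++ [seq (Ug g, val g) | g <- Gs] ++ rest)).

Let sFs m : subspace (Fs m) := subspace_Fs Hc m.

Lemma split_hit f : islinf f ->
  Fs n.-1 (hit f x - (\sum_(a <- As) f (val a) *: Ua a + \sum_(g <- Gs) f (val g) *: Ug g)).
Proof.
move=> lf; rewrite (hitE lf E) !big_cat !big_map /= addrA [X in X - _]addrC addrK.
by apply: (subspace_sum (sFs _)) => p /Fr Hp'; apply: (subspaceZ (sFs _)).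
Qed.

Let Fs_pred y : Fs n.-1 y -> Fs n y.
Proof. by apply: (Fs_le Hc Hp); exact: leq_pred. Qed.

Lemma split_hit_d c : c \in As -> Fs n.-1 (hit (d (val c)) x - Ua c).
Proof.
move=> cA; have := split_hit (ld (val c)).
rewrite [X in _ - (_ + X)]big1 ?addr0; last first.
  by move=> g _; rewrite dP ?scale0r //; apply: (gl_F0 Hc Hp (glP g)).
rewrite (bigD1_seq c) //= dB ?eqxx ?scale1r; [|exact: arP|exact: arP].
rewrite big1 ?addr0 // => a ac; rewrite dB; [|exact: arP|exact: arP].
by rewrite (inj_eq val_inj) eq_sym (negPf ac) scale0r.
Qed.

Lemma split_hit_dl g : g \in Gs -> Fs n (hit (dl (val g)) x - Ug g).
Proof.
move=> gG; have := Fs_pred (split_hit (ldl (val g))).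
rewrite [X in _ - (_ + X)](bigD1_seq g) //= dlE ?eqxx ?scale1r; [|exact: glP|exact: glP].
rewrite [X in _ - (_ + (_ + X))]big1 ?addr0; last first.
  move=> g' gg'; rewrite dlE; [|exact: glP|exact: glP].
  by rewrite (inj_eq val_inj) eq_sym (negPf gg') scale0r.
set SA := \sum_(a <- As) _ => Hx.
have -> : hit (dl (val g)) x - Ug g = hit (dl (val g)) x - (SA + Ug g) + SA.
  by rewrite opprD addrA addrAC subrK.
apply: (subspaceD (sFs n) Hx); apply: (subspace_sum (sFs n)) => a _.
exact: (subspaceZ (sFs n)).
Qed.

End SplitCoproduct.

Lemma fQ_sum n (I : eqType) (r : seq I) (Y : I -> H) : (forall i, i \in r -> F n (Y i)) ->
  fQ n (\sum_(i <- r) Y i) = \sum_(i <- r) fQ n (Y i).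
Proof.
move=> FY; apply: fQ_unique; first exact: (subspace_sum (sF n)).
move=> p Pp; rewrite (islinf_sum (islinf_co _)) (islinf_sum (lin_cq _ _)) mulr_sumr.
by apply: eq_big_seq => i /FY Fi; rewrite fQE.
Qed.

Lemma fQ_eqmod n x y : F n x -> Fs n (x - y) -> fQ n x = fQ n y.
Proof.
move=> Fx Fxy; have Fy : F n y.
  by apply: (subspace_eqmodr (sF n) _ Fx); apply: FsS'.
have := fQ_lin 1 (FsS' Fxy) Fy.
by rewrite !scale1r subrK (fQ_Fs Fxy) add0r.
Qed.

Lemma cl_ar a : cl (val a) = << a >>.
Proof. by rewrite -[RHS]cl_lam /lam mextU. Qed.

Lemma hit_d_F n x (a : arT) : F n.+1 x -> F n (hit (d (val a)) x).
Proof. by apply: (@Fs_hit_kill _ _ _ _ Hc Hp 1 n.+1) => // y; apply: dP. Qed.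

(** Contraction by the form of [a] in [H] amounts to deleting the first arrow [a] in the path
    coalgebra. *)
Lemma co_fQ_hit_d n x a p : F n.+1 x -> pathb p ->
  co (fQ n (hit (d (val a)) x)) p =
  (p.1 == tgt a)%:R * co (fQ n.+1 x) (src a, a :: p.2).
Proof.
case: p => w l Fx Pp.
have Fh := hit_d_F a Fx.
rewrite (fQE Fh Pp) /=; have [ln|nln] := eqVneq (size l) n; last first.
  rewrite mul0r; have [wt|_] := eqVneq w (tgt a); last by rewrite mul0r.
  have Pa : pathb (src a, a :: l) by rewrite pathb_cons eqxx -wt.
  by rewrite (fQE Fx Pa) /= eqSS (negPf nln) mul0r mulr0.
rewrite mul1r apply_hit // conv_cq_d ?ln //.
have [wt|_] := eqVneq w (tgt a); last by rewrite !mul0r.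
have Pa : pathb (src a, a :: l) by rewrite pathb_cons eqxx -wt.
by rewrite (fQE Fx Pa) /= ln eqxx !mul1r.
Qed.

Lemma co_fQ_hit_dl n x (g : glT) p : F n x -> pathb p ->
  co (fQ n (hit (dl (val g)) x)) p = (g == p.1)%:R * co (fQ n x) p.
Proof.
case: p => w l Fx Pp.
have Fh : F n (hit (dl (val g)) x) by apply: (@Fs_hit _ _ _ _ Hc Hp n.+1).
rewrite (fQE Fh Pp) (fQE Fx Pp) /=; have [ln|nln] := eqVneq (size l) n; last first.
  by rewrite !mul0r mulr0.
rewrite !mul1r apply_hit // cq_start ?ln //.
by rewrite (dlE (glP g) (glP w)) (inj_eq val_inj).
Qed.

(** If the image is zero, so are the images of the contractions by arrows, hence by induction the
    left factors [Ua a] drop one degree. A form in [J] kills the group-like terms and the rest is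
    already low, so the criterion for [hit] applies. *)
Lemma fQ_ker n x : F n x -> fQ n x = 0 -> Fs n x.
Proof.
elim: n x => [|n IH] x Fx f0.
  apply: (F0_dl_eq0 Hc Hp ldl dlE Fx) => g gg.
  have := fQE (p := (mkgl gg, [::])) Fx isT.
  by rewrite f0 (islinf0 (islinf_co _)) /= mul1r => <-.
apply/(Fs_hitP Hc Hp) => f [lf ff].
have [As [Gs [Ua [Ug [rest [uA uG [Fa Fg] Fr E]]]]]] := cop_splitT Fx.
have Ha a : a \in As -> Fs n (Ua a).
  move=> aA; apply: (subspace_eqmodr (subspace_Fs Hc n) (split_hit_d uA Fr E aA)).
  apply: IH; first exact: hit_d_F.
  apply: co_inj => p Pp; rewrite co_fQ_hit_d // f0 !(islinf0 (islinf_co _)) mulr0 //.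
apply: (subspace_eqmod (subspace_Fs Hc n) (split_hit Fr E lf)).
apply: (subspaceD (subspace_Fs Hc n)); apply: (subspace_sum (subspace_Fs Hc n)) => y yin.
  by apply: (subspaceZ (subspace_Fs Hc n)); apply: Ha.
rewrite ff ?scale0r; first exact: (subspace0 (subspace_Fs Hc n)).
exact: (gl_F0 Hc Hp (glP y)).
Qed.

(** Adds homogeneity to the split: the image of [Ug g] consists of paths starting at [g], that of
    [Ua a] of paths starting at the target of [a]. The product rules [mulRQ_Prep] and [mulLQ_Prep]
    require such fixed starting points. *)
Lemma fQ_splitT n x : F n x -> exists (As : seq arT) (Gs : seq glT) (Ua : arT -> H)
    (Ug : glT -> H) (rest : seq (H * H)),
  [/\ (forall a, Fs n (Ua a)) /\ (forall g, F n (Ug g)),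
      forall p, p \in rest -> Fs n.-1 p.1,
      teq2 (cop x) ([seq (Ua a, val a) | a <- As] ++ [seq (Ug g, val g) | g <- Gs] ++ rest),
      fQ n x = \sum_(g <- Gs) fQ n (Ug g) /\
        (forall g, g \in Gs -> @starts k glT arT src tgt g (fQ n (Ug g))) &
      forall m, n = m.+1 -> fQ n x = \sum_(a <- As) Prep << a >> (fQ m (Ua a)) /\
        (forall a, a \in As -> @starts k glT arT src tgt (tgt a) (fQ m (Ua a)))].
Proof.
move=> Fx; have [As [Gs [Ua [Ug [rest [uA uG [Fa Fg] Fr E]]]]]] := cop_splitT Fx.
exists As, Gs, Ua, Ug, rest; split => //.
  split.
    (* The counit is applied to the right factors: arrow terms and remainder have left factors of
       degree below [n], invisible to [fQ n], and each group-like counts with weight 1. *)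
    rewrite -(fQ_sum (Y := Ug)) //; apply: fQ_eqmod => //.
    have := split_hit Fr E (islinf_eps Hc); rewrite (hit_eps Hc) => Hx.
    have Hx' : Fs n (x - (\sum_(a <- As) eps (val a) *: Ua a + \sum_(g <- Gs) eps (val g) *: Ug g)).
      by apply: (Fs_le Hc Hp) Hx; exact: leq_pred.
    have Eg : \sum_(g <- Gs) eps (val g) *: Ug g = \sum_(g <- Gs) Ug g.
      by apply: eq_bigr => g _; rewrite (gl_eps Hc (glP g)) scale1r.
    rewrite Eg opprD addrA addrAC in Hx'.
    apply: (subspace_eqmod (subspace_Fs Hc n) Hx').
    by apply: (subspace_sum (subspace_Fs Hc n)) => a _; apply: (subspaceZ (subspace_Fs Hc n)).
  move=> g gG p Pp; rewrite -(fQ_eqmod _ (split_hit_dl uG Fa Fr E gG)); last first.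
    exact: (@Fs_hit _ _ _ _ Hc Hp n.+1).
  by rewrite co_fQ_hit_dl //; have [->|_] := eqVneq g p.1; rewrite ?mul0r ?eqxx.
move=> m nm; subst n; split.
  rewrite (fQ_split Fx E); last exact: splitT_gr_split.
  rewrite !big_cat !big_map /= [X in _ + (_ + X)]big1_seq ?addr0; last first.
    by move=> p /andP[_ /Fr Fp]; rewrite fQ_Fs //; exact: (islin0 (lin_Prep _)).
  rewrite [X in _ + X]big1 ?addr0; last first.
    move=> g _; rewrite cl_F0; last exact: (gl_F0 Hc Hp (glP g)).
    exact: (islin0 (lin_Prepl _)).
  by apply: eq_bigr => a _; rewrite cl_ar.
move=> a aA p Pp; rewrite -(fQ_eqmod _ (split_hit_d uA Fr E aA)); last first.
  exact: hit_d_F.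
by rewrite co_fQ_hit_d //; have [->|_] := eqVneq p.1 (tgt a); rewrite ?mul0r ?eqxx.
Qed.

Lemma co_nil_pi (z : kQ) v : co z (v, [::]) = dl (val v) (pi z).
Proof.
apply: (@kQ_lin_eq k glT arT src tgt k^o (fun z => co z (v, [::])) (fun z => dl (val v) (pi z))).
- exact: islinf_co.
- exact: (islinf_comp (ldl _) lin_pi).
move=> [w l] Pp _; rewrite co_pb // pi_pb //= xpair_eqE.
case: l {Pp} => [|a l] /=; last by rewrite andbF (islinf0 (ldl _)).
by rewrite andbT (dlE (glP v) (glP w)) (inj_eq val_inj) eq_sym.
Qed.

Lemma fQ0_pi (z : kQ) : deg 0 z -> fQ 0 (pi z) = z.
Proof.
move=> Hz; apply: fQ_unique; first exact: pi_F0.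
move=> [v [|a l]] Pp; first by rewrite co_nil_pi mul1r.
by rewrite mul0r; apply/eqP; apply: contraT => /(Hz _ Pp).
Qed.

Lemma pi_fQ0 x : F 0%N x -> pi (fQ 0 x) = x.
Proof.
move=> Fx; apply/eqP; rewrite -subr_eq0; apply/eqP.
apply: (F0_dl_eq0 Hc Hp ldl dlE); first by apply: (subspaceB (sF 0)) => //; apply: pi_F0.
move=> g gg; rewrite (islinfB (ldl g)) -[g]/(val (mkgl gg)) -co_nil_pi fQE //=.
by rewrite mul1r subrr.
Qed.

Lemma fQ1_surj (z : kQ) : deg 1 z -> exists x, F 1%N x /\ fQ 1 x = z.
Proof.
move=> Hz.
exists (lam (arrows z)); split; first exact: lam_F1.
apply: fQ_unique; first exact: lam_F1.
move=> [v [|a [|b l]]] Pp.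
- by rewrite mul0r; apply/eqP; apply: contraT => /(Hz _ Pp).
- have := Pp; rewrite pathb_cons => /andP[/eqP <- _].
  rewrite mul1r; apply: etrans (esym (arrowsE z a)) _; rewrite cq_arrow ?d_lam //; exact: lam_F1.
by rewrite mul0r; apply/eqP; apply: contraT => /(Hz _ Pp).
Qed.

Lemma fQ0_mul x y : F 0%N x -> F 0%N y -> fQ 0 (mul x y) = mQ (fQ 0 x) (fQ 0 y).
Proof.
move=> Fx Fy; rewrite -[in LHS](pi_fQ0 Fx) -[in LHS](pi_fQ0 Fy) -pi_mul.
by apply: fQ0_pi; apply: (mulQ_deg (i := 0) (j := 0)); apply: fQ_deg.
Qed.

Lemma fQ0_one : fQ 0 one = oQ.
Proof.
rewrite -pi_one; apply: fQ0_pi; exact: (@deg_pb k glT arT src tgt g1 [::]).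
Qed.

(** Applying [S] to a split coproduct exchanges its factors, so the image of [S x] grows at the end
    of paths by the antipodes of the arrows; this is the recursion of [SQ] on first arrows. *)
Lemma fQ_S n x : F n x -> fQ n (S x) = sQ (fQ n x).
Proof.
elim: n x => [|n IH] x Fx.
  rewrite -[in LHS](pi_fQ0 Fx) -pi_S; apply: fQ0_pi; apply: SQ_deg; exact: fQ_deg.
have [As [Gs [Ua [Ug [rest [[Fa Fg] Fr E _ /(_ n erefl)[Ex Hst]]]]]]] := fQ_splitT Fx.
have FSx : F n.+1 (S x) by apply: (Fs_S HM Hp (n := n.+2)).
have HS p : p \in [seq (S p.2, S p.1) | p <- [seq (Ua a, val a) | a <- As] ++
    [seq (Ug g, val g) | g <- Gs] ++ rest] -> gr_split n (p.2, p.1).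
  move=> /mapP[q /(splitT_gr_split Fa Fr) qs ->] /=; case: qs => [[F1q F2q]|Fq|Fq].
  - apply: Or31; split; first exact: (Fs_S HM Hp (n := n.+1)).
    exact: (Fs_S HM Hp (n := 2)).
  - by apply: Or32; apply: (F0_S HM Hp).
  by apply: Or33; apply: (Fs_S HM Hp).
apply: etrans (fQ_split_app FSx (teq2_S HM E) HS) _.
rewrite big_map !big_cat !big_map /=.
have lApl z : islin (App^~ z) := @lin_Appl k glT arT src tgt z.
rewrite [X in _ + (_ + X)]big1_seq; last first.
  move=> p /andP[_ /Fr Fp]; rewrite (fQ_Fs (Fs_S HM Hp Fp)).
  exact: (islin0 (@lin_App k glT arT src tgt _)).
rewrite [X in _ + (X + _)]big1; last first.
  move=> g _; rewrite cl_F0; last by apply: (F0_S HM Hp); apply: (gl_F0 Hc Hp (glP g)).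
  exact: (islin0 (lApl _)).
rewrite !addr0 Ex (islin_sum lin_sQ); apply: eq_big_seq => a aA.
rewrite (cl_S (basis_F1 Bst (arP a))) cl_ar (IH _ (Fa a)).
exact: (esym (SQ_Prep gi lin_sg (inMU k src tgt a) (Hst a aA))).
Qed.

Lemma Fs_mul_le a b n y z : Fs a y -> Fs b z ->
  ((0 < a)%N -> (0 < b)%N -> ((a + b).-1 <= n)%N) -> Fs n (mul y z).
Proof.
case: a => [|a]; first by move=> -> _ _; rewrite (islin0 (lm1 _));
  apply: (subspace0 (subspace_Fs Hc n)).
case: b => [|b]; first by move=> _ -> _; rewrite (islin0 (lm2 _));
  apply: (subspace0 (subspace_Fs Hc n)).
by move=> Fy Fz /(_ isT isT) le; apply: (Fs_le Hc Hp le); apply: (Fs_mul HM Hp).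
Qed.

Lemma split_F m As Gs Ua Ug (rest : seq (H * H)) p :
  (forall a : arT, Fs m (Ua a)) -> (forall g : glT, F m (Ug g)) ->
  (forall p, p \in rest -> Fs m.-1 p.1) ->
  p \in [seq (Ua a, val a) | a <- As] ++ [seq (Ug g, val g) | g <- Gs] ++ rest ->
  F m p.1.
Proof.
move=> Fa Fg Fr; rewrite !mem_cat => /or3P[/mapP[a _ ->]|/mapP[g _ ->]|/Fr Fp].
- exact: (FsS' (Fa a)).
- exact: Fg.
have le : (m.-1 <= m.+1)%N by lia.
exact: (Fs_le Hc Hp le Fp).
Qed.

Lemma prod_gr_split i j n As Gs Ua Ug (rest : seq (H * H)) As' Gs' Ua' Ug' (rest' : seq (H * H)) :
  (i + j = n.+1)%N ->
  (forall a : arT, Fs i (Ua a)) -> (forall g : glT, F i (Ug g)) ->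
  (forall p, p \in rest -> Fs i.-1 p.1) ->
  (forall a : arT, Fs j (Ua' a)) -> (forall g : glT, F j (Ug' g)) ->
  (forall p, p \in rest' -> Fs j.-1 p.1) ->
  forall p q,
  p \in [seq (Ua a, val a) | a <- As] ++ [seq (Ug g, val g) | g <- Gs] ++ rest ->
  q \in [seq (Ua' a, val a) | a <- As'] ++ [seq (Ug' g, val g) | g <- Gs'] ++ rest' ->
  gr_split n (mul p.1 q.1, mul p.2 q.2).
Proof.
move=> ijn Fa Fg Fr Fa' Fg' Fr' p q.
have Gg g : F 0%N (val (g : glT)) := gl_F0 Hc Hp (glP g).
have Ga a : F 1%N (val (a : arT)) := basis_F1 Bst (arP a).
move=> pin qin; have Fp := split_F Fa Fg Fr pin.
have Fq := split_F Fa' Fg' Fr' qin.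
move: pin qin; rewrite !mem_cat => /or3P[/mapP[a _ Ep]|/mapP[g _ Ep]|/Fr Fp'];
  last by move=> _; apply: Or33; apply: (@Fs_mul_le i.-1 j.+1) => //=; lia.
- move=> /or3P[/mapP[a' _ Eq]|/mapP[g' _ Eq]|/Fr' Fq']; last first.
  + by apply: Or33; apply: (@Fs_mul_le i.+1 j.-1) => //=; lia.
  + rewrite Ep Eq /=; apply: Or31; split; last exact: (F_mul HM Hp (Ga a) (Gg g')).
    have := Fs_mul HM Hp (Fa a) (Fg' g' : Fs j.+1 _); rewrite addnS /= ijn; exact.
  + by rewrite Ep Eq; apply: Or33; apply: (@Fs_mul_le i j) => //=; lia.
move=> /or3P[/mapP[a' _ Eq]|/mapP[g' _ Eq]|/Fr' Fq']; last first.
- by apply: Or33; apply: (@Fs_mul_le i.+1 j.-1) => //=; lia.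
- by rewrite Ep Eq; apply: Or32; exact: (F0_mul HM Hp (Gg g) (Gg g')).
rewrite Ep Eq /=; apply: Or31; split; last exact: (F_mul HM Hp (Gg g) (Ga a')).
have := Fs_mul HM Hp (Fg g : Fs i.+1 _) (Fa' a'); rewrite addSn /= ijn; exact.
Qed.

(** Induction on [i + j], multiplying the split coproducts of [x] and [y]. Only arrow times
    group-like and group-like times arrow survive: two arrows leave a left factor of too low degree,
    two group-likes a right factor in [F 0], and the remainders are too low. The survivors are the
    two parts of the shuffle product. *)
Lemma fQ_mul i j x y : F i x -> F j y -> fQ (i + j) (mul x y) = mQ (fQ i x) (fQ j y).
Proof.
elim: {i j}(i + j)%N {-2}i {-2}j (erefl (i + j)%N) x y => [|n IH] i j ijn x y Fx Fy.
  move/eqP: ijn Fx Fy; rewrite addn_eq0 => /andP[/eqP -> /eqP ->]; exact: fQ0_mul.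
have [As [Gs [Ua [Ug [rest [[Fa Fg] Fr E [Ex1 Sx1] Ex2]]]]]] := fQ_splitT Fx.
have [As' [Gs' [Ua' [Ug' [rest' [[Fa' Fg'] Fr' E' [Ey1 Sy1] Ey2]]]]]] := fQ_splitT Fy.
have Hsplit := prod_gr_split (As := As) (Gs := Gs) (As' := As')
  (Gs' := Gs') ijn Fa Fg Fr Fa' Fg' Fr'.
have Fxy : F n.+1 (mul x y) by rewrite -ijn; apply: (F_mul HM Hp).
rewrite ijn; apply: etrans (fQ_split Fxy (teq2_mul HM E E') _) _.
  by move=> _ /allpairsP[[p q] /= [ps qs ->]]; exact: Hsplit ps qs.
rewrite big_allpairs_dep /=.
pose T (p q : H * H) := Prep (cl (mul p.2 q.2)) (fQ n (mul p.1 q.1)).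
have lPl z : islin (Prep^~ z) := @lin_Prepl k glT arT src tgt z.
have lP m : islin (Prep m) := @lin_Prep k glT arT src tgt m.
have T1 p q : Fs n (mul p.1 q.1) -> T p q = 0.
  by move=> Fpq; rewrite /T (fQ_Fs Fpq); exact: (islin0 (lP _)).
have T2 p q : F 0%N (mul p.2 q.2) -> T p q = 0.
  by move=> Fpq; rewrite /T (cl_F0 Fpq); exact: (islin0 (lPl _)).
set s1 := _ ++ _ in Hsplit *; set s2 := _ ++ (_ ++ rest') in Hsplit *.
have inner p : p \in s1 -> \sum_(q <- s2) T p q =
    \sum_(a <- As') T p (Ua' a, val a) + \sum_(g <- Gs') T p (Ug' g, val g).
  move=> /(split_F Fa Fg Fr) Fp.
  rewrite !big_cat !big_map /= [X in _ + (_ + X)]big1_seq ?addr0 // => q /andP[_ /Fr' Fq].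
  by apply: T1; apply: (@Fs_mul_le i.+1 j.-1) => //=; lia.
rewrite (eq_big_seq _ inner) !big_cat !big_map /=.
rewrite [X in _ + (_ + X)]big1_seq ?addr0; last first.
  move=> p /andP[_ /Fr Fp].
  have Z z' : F j z' -> Fs n (mul p.1 z').
    by move=> Fz; apply: (@Fs_mul_le i.-1 j.+1) => //=; lia.
  rewrite !big1 ?addr0 // => a _; apply: T1; apply: Z => //=.
  exact: FsS' (Fa' a).
(* Arrows of [x] against group-likes of [y]: products whose first arrow comes from the left factor.
   For [i = 0] both sides vanish. *)
have -> : \sum_(a <- As) (\sum_(a' <- As') T (Ua a, val a) (Ua' a', val a') +
      \sum_(g <- Gs') T (Ua a, val a) (Ug' g, val g)) = mulRQ gm ar al (fQ i x) (fQ j y).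
  transitivity (\sum_(a <- As) \sum_(g <- Gs') T (Ua a, val a) (Ug' g, val g)).
    apply: eq_bigr => a _; rewrite big1 ?add0r // => a' _; apply: T1.
    by apply: (Fs_mul_le (Fa a) (Fa' a')); lia.
  have [i0|i0] := posnP i.
    rewrite big1 => [|a _].
      by apply/esym/mulRQ_deg0; move: (fQ_deg Fx); rewrite {1}i0.
    rewrite big1 // => g _; apply: T1; apply: (Fs_mul_le (Fa a) (FsS (n := j.+1) Hc Hp (Fg' g))).
    by rewrite i0.
  have Ei := esym (prednK i0); have [Ex Sx] := Ex2 _ Ei.
  rewrite Ex Ey1 (islin_sum (lin_mulRQl gm ar al _)); apply: eq_big_seq => a aA.
  rewrite (islin_sum (lin_mulRQr gm ar al _)); apply: eq_big_seq => g gG.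
  rewrite (mulRQ_Prep gm al lin_ar (inMU k src tgt a) (Sx a aA) (Sy1 g gG)).
  rewrite /T /= (cl_mulr g (basis_F1 Bst (arP a))) cl_ar; apply: congr1.
  have En : n = (i.-1 + j)%N by lia.
  have Fa1 : F i.-1 (Ua a) by have := Fa a; rewrite {1}Ei.
  by rewrite En; apply: IH => //; lia.
(* Symmetrically, the first arrow comes from the right factor. *)
have -> : \sum_(g <- Gs) (\sum_(a' <- As') T (Ug g, val g) (Ua' a', val a') +
      \sum_(g' <- Gs') T (Ug g, val g) (Ug' g', val g')) = mulLQ gm ar al (fQ i x) (fQ j y).
  transitivity (\sum_(g <- Gs) \sum_(a <- As') T (Ug g, val g) (Ua' a, val a)).
    apply: eq_bigr => g _; rewrite [X in _ + X]big1 ?addr0 // => g' _; apply: T2.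
    exact: (F0_mul HM Hp (gl_F0 Hc Hp (glP g)) (gl_F0 Hc Hp (glP g'))).
  have [j0|j0] := posnP j.
    rewrite big1 => [|g _].
      by apply/esym/mulLQ_deg0; move: (fQ_deg Fy); rewrite {1}j0.
    rewrite big1 // => a _; apply: T1; apply: (Fs_mul_le (FsS (n := i.+1) Hc Hp (Fg g)) (Fa' a)).
    by rewrite j0.
  have Ej := esym (prednK j0); have [Ey Sy] := Ey2 _ Ej.
  rewrite Ex1 Ey (islin_sum (lin_mulLQl gm ar al _)); apply: eq_big_seq => g gG.
  rewrite (islin_sum (lin_mulLQr gm ar al _)); apply: eq_big_seq => a aA.
  rewrite (mulLQ_Prep gm ar lin_al (inMU k src tgt a) (Sx1 g gG) (Sy a aA)).
  rewrite /T /= (cl_mull g (basis_F1 Bst (arP a))) cl_ar; apply: congr1.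
  have En : n = (i + j.-1)%N by lia.
  have Fa1 : F j.-1 (Ua' a) by have := Fa' a; rewrite {1}Ej.
  by rewrite En; apply: IH => //; lia.
rewrite /mQ mulQ_decomp (mul0Q_deg gm (fQ_deg Fx) (fQ_deg Fy)) ?addr0 // ijn //.
Qed.

(** Only terms tagged by the length of [P] contribute. When the lengths add up to [n] and the tag
    differs, either the left factor is too low for the form of [P] or the right factor is too low
    for that of [Q]. *)
Lemma fQ_copsum n x sl P Q : F n x ->
  (forall e : nat * (H * H), e \in sl -> [/\ (e.1 <= n)%N, F e.1 e.2.1 & F (n - e.1)%N e.2.2]) ->
  teq2 (cop x) [seq e.2 | e <- sl] -> pathb P -> pathb Q ->
  \sum_(e <- sl) co (fQ e.1 e.2.1) P * co (fQ (n - e.1)%N e.2.2) Q =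
  (size Q.2 + size P.2 == n)%:R * conv (cq P.1 P.2) (cq Q.1 Q.2) x.
Proof.
move=> Fx Hsl E PP PQ.
rewrite (convE (lin_cq P.1 P.2) (lin_cq Q.1 Q.2) E) big_map mulr_sumr;
  apply: eq_big_seq => e /Hsl[en F1 F2].
rewrite (fQE F1 PP) (fQE F2 PQ); have [Pe|nPe] := eqVneq (size P.2) e.1.
  have -> : (size Q.2 == n - e.1)%N = (size Q.2 + size P.2 == n)%N.
    by rewrite Pe -(eqn_add2r e.1) subnK.
  by rewrite mul1r mulrCA.
rewrite !mul0r; have [QPn|_] := eqVneq (size Q.2 + size P.2)%N n; last by rewrite mul0r.
have ltQ (m : nat) : (m <= n -> size P.2 < m -> (n - m).+1 <= size Q.2)%N by lia.
have [lt|gt|eq] := ltngtP (size P.2) e.1; last by rewrite eq eqxx in nPe.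
  by rewrite (cq_kill _ (Fs_le Hc Hp (ltQ _ en lt) F2)) !mulr0.
by rewrite (cq_kill _ (Fs_le Hc Hp gt F1)) mul0r mulr0.
Qed.

Lemma kQ_gr_embedding :
  gr_embedding cop eps mul one phi S alpha beta mQ oQ phiQ sQ alphaQ betaQ fQ.
Proof.
split.
- split; first exact: fQ_lin.
    by move=> n x Fx; apply/deg_homog; apply: fQ_deg.
  by move=> n x Fx; split; [exact: fQ_ker | exact: fQ_Fs].
- move=> [|[|n]] // y _ /deg_homog Hy; last exact: fQ1_surj.
  by exists (pi y); split; [exact: pi_F0 | exact: fQ0_pi].
- split; last by move=> x Fx; rewrite -eps_pi pi_fQ0.
  move=> n x Fx; have [sl [Hsl E]] := cop_tagged Hc Hp Fx.
  exists sl; split => //; apply: kQ_teq2 => P Q PP PQ.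
  rewrite big_map /= (fQ_copsum Fx Hsl E PP PQ).
  apply: etrans (copsum_co _ PP PQ) _.
  have [QPn|nQP] := eqVneq (size Q.2 + size P.2)%N n; last first.
    rewrite mul0r; have [QP|_] := eqVneq (pend Q) P.1; last by rewrite mul0r.
    have PQP : pathb (Q.1, Q.2 ++ P.2).
      by rewrite pathb_cat -surjective_pairing PQ QP -surjective_pairing.
    by rewrite (fQE Fx PQP) /= size_cat (negPf nQP) mul0r mulr0.
  have FxQP : F (size Q.2 + size P.2)%N x by rewrite QPn.
  rewrite mul1r; have [QP|nQP] := eqVneq (pend Q) P.1; last first.
    rewrite mul0r (@cq_noncomp P.1 P.2 Q.1 Q.2) -?surjective_pairing //.
    by rewrite eq_sym.
  have PQP : pathb (Q.1, Q.2 ++ P.2).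
    by rewrite pathb_cat -surjective_pairing PQ QP -surjective_pairing.
  rewrite (fQE Fx PQP) /= size_cat QPn eqxx !mul1r cq_cat //.
  by rewrite -surjective_pairing QP.
- split; [exact: fQ_mul | exact: fQ0_one | exact: fQ_S].
split=> [x y z Fx Fy Fz|x Fx|x Fx].
- by rewrite /phiQ !pi_fQ0.
- by rewrite /alphaQ pi_fQ0.
- by rewrite /betaQ pi_fQ0.
Qed.

(** ** The quiver is a Hopf quiver *)

(** Translating by [w] and then by its inverse gives back [m] up to nonzero values of [phi]. *)
Lemma ar_inj g h (m : {malg k[arT]}) w : inM src tgt g h m -> ar m w = 0 -> m = 0.
Proof.
move=> Hm E; have := arar w (gi w) Hm; rewrite E (islin0 (lin_ar _)) scaler0 gVm ar1.
move/esym/eqP; rewrite scaler_eq0 (negPf (gl_phi_neq0 HM (glP h) (glP w) (glP (gi w)))).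
by move/eqP.
Qed.

Lemma al_inj g h (m : {malg k[arT]}) w : inM src tgt g h m -> al w m = 0 -> m = 0.
Proof.
move=> Hm E; have := alal (gi w) w Hm; rewrite E (islin0 (lin_al _)) scaler0 gmV al1.
move/eqP; rewrite scaler_eq0 (negPf (gl_phi_neq0 HM (glP (gi w)) (glP w) (glP g))).
by move/eqP.
Qed.

(** A linear map injective on one isotypic component carries its arrows to an independent family in
    the other, and [fiber_inj] converts this into an injection of arrows. *)
Lemma inM_fiber_inj (T : {malg k[arT]} -> {malg k[arT]}) x y x' y' : islin T ->
  (forall m, inM src tgt y x m -> inM src tgt y' x' (T m)) ->
  (forall m, inM src tgt y x m -> T m = 0 -> m = 0) ->
  exists f : {e : arT | src e = x /\ tgt e = y} -> {e : arT | src e = x' /\ tgt e = y'},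
    injective f.
Proof.
move=> lT Tin Tinj.
have inMe (i : {e : arT | src e = x /\ tgt e =
  y}) : inM src tgt y x (<< proj1_sig i >> : {malg k[arT]}).
  by case: i => e /= [<- <-]; exact: (inMU k src tgt e).
apply: (fiber_inj (b := fun i : {e : arT | src e = x /\ tgt e = y} => T << proj1_sig i >>)).
  by move=> i e /(Tin _ (inMe i)) [].
(* [Q] is the image of the combinations with zero coefficient on [i]. If it contained the image of
   [i], a combination with coefficient 1 on [i] would be killed by [T]. *)
move=> i; pose Q (z : {malg k[arT]}) := exists m, [/\ inM src tgt y x m, m@_(proj1_sig i) =
  0 & z = T m].
have sM : subspace (inM src tgt y x : {malg k[arT]} -> Prop).
  split=> [e|c u z Hu Hv e]; first by rewrite mcoeff0 eqxx.
  rewrite mcoeffD mcoeffZ; have [u0|/Hu //] := eqVneq (u@_e) 0.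
  by rewrite u0 mulr0 add0r; apply: Hv.
have sQ : subspace Q.
  split; first by exists 0; split; [exact: (subspace0 sM) | rewrite mcoeff0 | rewrite (islin0 lT)].
  move=> c _ _ [m [m1 m2 ->]] [m' [m1' m2' ->]]; exists (c *: m + m'); split => //.
    by case: sM => _; apply.
  by rewrite mcoeffD mcoeffZ m2 m2' mulr0 addr0.
move=> /(spn_sub (Q := Q) sQ) [||m [m1 m2 E]].
- by move=> z ->; exact: (subspace0 sQ).
- move=> z [j [ji ->]]; exists << proj1_sig j >>; split => //.
  rewrite mcoeffU; case: eqP => // ji'; case: ji; case: (j) (i) ji' => [e He] [e' He'] /= ee.
  by subst e'; congr exist; exact: Prop_irrelevance.
have := Tinj (<< proj1_sig i >> - m) (subspaceB sM (inMe i) m1).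
rewrite (islinB lT) E subrr => /(_ erefl) /(congr1 (fun m => m@_(proj1_sig i))).
by rewrite mcoeffB mcoeffUU m2 subr0 mcoeff0 => /eqP; rewrite oner_eq0.
Qed.

(** Right translation by the inverse of [x], and back by [x], compares the arrows from [x] to [y]
    with those from the unit; conjugation by [g] and by its inverse compares the members of a
    conjugacy class. Each direction contributes one injection. *)
Lemma kQ_hopf_quiver : hopf_quiver src tgt.
Proof.
exists gm, g1, gi; split; [exact: gmA | exact: gm1 | exact: gmV | move=> x y | move=> c g].
  have [f fI] : exists f : {e : arT | src e = x /\ tgt e = y} ->
      {e : arT | src e = g1 /\ tgt e = gm y (gi x)}, injective f.
    apply: (inM_fiber_inj (T := ar^~ (gi x)) (lin_ar _)).
      by move=> m /(ar_in (w := gi x)); rewrite gVm.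
    by move=> m Hm; apply: ar_inj Hm.
  have [f' fI'] : exists f : {e : arT | src e = g1 /\ tgt e = gm y (gi x)} ->
      {e : arT | src e = x /\ tgt e = y}, injective f.
    apply: (inM_fiber_inj (T := ar^~ x) (lin_ar _)).
      by move=> m /(ar_in (w := x)); rewrite gm1 -gmA gmV gx1.
    by move=> m Hm; apply: ar_inj Hm.
  exact: inj_inj_bij fI fI'.
pose T w w' m := ar (al w m) w'.
have lT w w' : islin (T w w') by apply: (islin_comp (lin_ar _) (lin_al _)).
have TI g' h w w' m : inM src tgt g' h m -> T w w' m = 0 -> m = 0.
  by move=> Hm E; exact: (al_inj Hm (ar_inj (al_in (w := w) Hm) E)).
have Tin g' h w w' m : inM src tgt g' h m ->
    inM src tgt (gm (gm w g') w') (gm (gm w h) w') (T w w' m).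
  by move=> Hm; apply: ar_in; apply: al_in.
set c' := gm (gm g c) (gi g).
have [f fI] : exists f : {e : arT | src e = g1 /\ tgt e = c} ->
    {e : arT | src e = g1 /\ tgt e = c'}, injective f.
  apply: (inM_fiber_inj (lT g (gi g))).
    by move=> m /(Tin _ _ g (gi g) _); rewrite gx1 gVm.
  by move=> m Hm; apply: TI Hm.
have [f' fI'] : exists f : {e : arT | src e = g1 /\ tgt e = c'} ->
    {e : arT | src e = g1 /\ tgt e = c}, injective f.
  apply: (inM_fiber_inj (lT (gi g) g)).
    by move=> m /(Tin _ _ (gi g) g _); rewrite gx1 gmV /c' !gmA gmV gm1 -gmA gmV gx1.
  by move=> m Hm; apply: TI Hm.
exact: inj_inj_bij fI fI'.
Qed.

(** ** Uniqueness of the quiver *)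

Section Uniqueness.
Variables (V' E' : choiceType) (s' t' : E' -> V').
Notation kQ' := (Defs.kQ s' t' k).
Notation pb' := (@Defs.pb V' E' s' t' k).
Variable f : nat -> H -> kQ'.
Hypotheses (f_lin : forall n, islin_on (F n) (f n))
  (f_deg : forall n x, F n x -> deg n (f n x))
  (f_ker : forall n x, F n x -> (f n x = 0 <-> Fs n x))
  (f_surj : forall n y, (n <= 1)%N -> deg n y -> exists x, F n x /\ f n x = y)
  (f_cop : forall n x, F n x -> exists sl : seq (nat * (H * H)),
              [/\ forall e, e \in sl ->
                    [/\ (e.1 <= n)%N, F e.1 e.2.1 & F (n - e.1)%N e.2.2],
                  teq2 (cop x) [seq e.2 | e <- sl] &
                  teq2 (Defs.pcop (f n x))
                       [seq (f e.1 e.2.1, f (n - e.1)%N e.2.2) | e <- sl]]).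

Lemma f_sum n (I : eqType) (r : seq I) (c : I -> k) (Y : I -> H) :
  (forall i, i \in r -> F n (Y i)) ->
  f n (\sum_(i <- r) c i *: Y i) = \sum_(i <- r) c i *: f n (Y i).
Proof.
elim: r => [|i r IH] FY.
  by rewrite !big_nil; apply/f_ker;
    [exact: (subspace0 (sF n)) | exact: (subspace0 (subspace_Fs Hc n))].
rewrite !big_cons f_lin ?IH //; first by move=> j jr; apply: FY; rewrite inE jr orbT.
  by apply: FY; rewrite mem_head.
apply: (subspace_sum (sF n)) => j jr; apply: (subspaceZ (sF n)).
by apply: FY; rewrite inE jr orbT.
Qed.

Lemma f_eqP n x y : F n x -> F n y -> f n x = f n y <-> Fs n (x - y).
Proof.
move=> Fx Fy; have Fxy : F n (x - y) by apply: (subspaceB (sF n)).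
have E : f n (x - y) = f n x - f n y.
  by have := f_lin (-1) Fy Fx; rewrite !scaleN1r addrC => ->; rewrite addrC.
split=> [Exy|/(f_ker Fxy)]; first by apply/(f_ker Fxy); rewrite E Exy subrr.
by rewrite E => /eqP; rewrite subr_eq0 => /eqP.
Qed.

Lemma co_deg0 n (z : kQ') p : deg n z -> Defs.pathb s' t' p -> size p.2 != n -> co z p = 0.
Proof. by move=> Hz Pp np; apply/eqP; apply: contraT => /(Hz _ Pp) E; rewrite E eqxx in np. Qed.

Lemma f_pcop n x P Q : F n x -> exists sl : seq (nat * (H * H)),
   [/\ forall e, e \in sl -> [/\ (e.1 <= n)%N, F e.1 e.2.1 & F (n - e.1)%N e.2.2],
       teq2 (cop x) [seq e.2 | e <- sl] &
       Defs.pathb s' t' P -> Defs.pathb s' t' Q ->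
       (Defs.pend t' Q == P.1)%:R * co (f n x) (Q.1, Q.2 ++ P.2) =
       \sum_(e <- sl) co (f e.1 e.2.1) P * co (f (n - e.1)%N e.2.2) Q].
Proof.
move=> /f_cop [sl [H1 H2 H3]]; exists sl; split => // PP PQ.
rewrite -(copsum_co _ PP PQ); apply: etrans (H3 _ _ (islinf_co P) (islinf_co Q)) _.
by rewrite big_map.
Qed.

(** Compatibility with coproducts makes the coefficients of the image of a group-like orthogonal
    idempotents of the field. The image being nonzero, it is a single vertex. *)
Lemma f_vertex g : exists u, f 0 (val (g : glT)) = pb' (u, [::]).
Proof.
set z := f 0 _; have Fg := gl_F0 Hc Hp (glP g).
have Hz : deg 0 z by apply: f_deg.
have ortho u w : (w == u)%:R * co z (w, [::]) = co z (u, [::]) * co z (w, [::]).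
  have [sl [Hsl E Es]] := f_pcop (u, [::]) (w, [::]) Fg.
  apply: etrans (Es isT isT) _.
  pose T y y' : k^o := co (f 0 y) (u, [::]) * co (f 0 y') (w, [::]).
  have bT : isbilin_on (F 0%N) T.
    split=> y Fy c x x' Fx Fx'; rewrite /T (f_lin c Fx Fx') (islinf_co _) /GRing.scale /=; ring.
  have Fsl p : p \in [seq e.2 | e <- sl] -> F 0%N p.1 /\ F 0%N p.2.
    by move=> /mapP[e /Hsl[+ + +] ->]; case: (e.1).
  have Fgg p : p \in [:: (val g, val g)] -> F 0%N p.1 /\ F 0%N p.2 by rewrite inE => /eqP ->.
  have := teq2_bilin_on (sF 0) bT Fsl Fgg (teq2_trans (teq2_sym E) (proj2 (glP g))).
  rewrite big_seq1 big_map => Eg; apply: etrans _ Eg; apply: eq_big_seq => e /Hsl[].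
  by case: (e.1).
have [u zv] : exists u, co z (u, [::]) != 0.
  apply: contrapT => H0; have [/eqP g0 _] := glP g; apply: g0.
  apply: (proj1 (f_ker Fg)); apply: co_inj => -[u [|a l]] Pp; rewrite (islinf0 (islinf_co _)).
    by apply: contrapT => /eqP zv; apply: H0; exists u.
  exact: (co_deg0 Hz).
exists u; have z1 : co z (u, [::]) = 1.
  by apply: (mulIf zv); rewrite -ortho eqxx.
apply: co_inj => -[w [|a l]] Pp; rewrite co_pb //; last first.
  by rewrite xpair_eqE andbF; apply: (co_deg0 Hz).
rewrite xpair_eqE andbT eq_sym; have := ortho u w; rewrite z1 mul1r.
by have [->|_] := eqVneq w u; [rewrite z1 | rewrite mul0r].
Qed.

Definition fv : glT -> V' := projT1 (choice f_vertex).

Lemma fvE g : f 0 (val g) = pb' (fv g, [::]).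
Proof. exact: (projT2 (choice f_vertex) g). Qed.

Lemma co_f0 g x : F 0%N x -> co (f 0 x) (fv g, [::]) = dl (val g) x.
Proof.
move=> Fx; have := Fx; move=> /(coradical_spn Hc Hp) sx.
have sF' : subspace (fun x => F 0%N x /\ co (f 0 x) (fv g, [::]) = dl (val g) x).
  split.
    split; first exact: (subspace0 (sF 0)).
    have -> : f 0 0 = 0 by apply/f_ker => //; exact: (subspace0 (sF 0)).
    by rewrite (islinf0 (islinf_co _)) (islinf0 (ldl _)).
  move=> c y z [Fy Ey] [Fz Ez]; split; first by case: (sF 0) => _; apply.
  by rewrite f_lin // (islinf_co _) Ey Ez (ldl _).
have [] // := spn_sub (Q := fun x => F 0%N x /\ co (f 0 x) (fv g, [::]) = dl (val g) x) sF' _ _ sx.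
  by move=> y ->; exact: (subspace0 sF').
move=> h gh; split; first exact: (gl_F0 Hc Hp).
rewrite -[h]/(val (mkgl gh)) fvE co_pb // xpair_eqE andbT (dlE (glP g) (glP _)).
rewrite (inj_eq val_inj) eq_sym; congr (_%:R); congr nat_of_bool.
apply/eqP/eqP => [E|-> //]; apply: val_inj; apply/eqP; rewrite -subr_eq0; apply/eqP.
have Fgl g' := gl_F0 Hc Hp (glP g').
by apply: (proj1 (f_eqP (n := 0) (Fgl _) (Fgl _))); rewrite !fvE E.
Qed.

Lemma fv_inj : injective fv.
Proof.
move=> g h E; have := co_f0 g (gl_F0 Hc Hp (glP h)); rewrite fvE E co_pb // eqxx.
rewrite (dlE (glP g) (glP h)) (inj_eq val_inj); case: eqP => // _ /eqP.
by rewrite oner_eq0.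
Qed.

Lemma fv_bij : bijective fv.
Proof.
apply: inj_surj_bij fv_inj _ => u.
have Hv : deg 0 (pb' (u, [::])) := @deg_pb k V' E' s' t' u [::].
have [x [Fx Ex]] := f_surj (leqnSn 0) Hv.
apply: contrapT => nu; have x0 : x = 0.
  apply: (F0_dl_eq0 Hc Hp ldl dlE Fx) => g gg; rewrite -[g]/(val (mkgl gg)) -co_f0 //.
  rewrite Ex co_pb // xpair_eqE andbT; case: eqP => // E; case: nu; by exists (mkgl gg).
move: Ex; have -> : f 0 x = 0 by apply/f_ker.
move=> /(congr1 (fun z => co z (u, [::]))); rewrite (islinf0 (islinf_co _)) co_pb // eqxx => /eqP.
by rewrite eq_sym oner_eq0.
Qed.

(** The coordinate on the arrow [e] of the image of [x] in degree 1. On [F 1] modulo [F 0] these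
    coordinates play for the second quiver the role that the forms [d b] play for the first. *)
Definition kap (e : E') x : k := co (f 1 x) (s' e, [:: e]).

Lemma kap_sum e (I : eqType) (r : seq I) (c : I -> k) (Y : I -> H) :
  (forall i, i \in r -> F 1%N (Y i)) ->
  kap e (\sum_(i <- r) c i *: Y i) = \sum_(i <- r) c i * kap e (Y i).
Proof.
move=> FY; rewrite /kap (f_sum c FY) (islinf_sum (islinf_co _)).
by apply: eq_bigr => i _; rewrite (islinfZ (islinf_co _)).
Qed.

Lemma kapP x y : F 1%N x -> F 1%N y -> (forall e, kap e x = kap e y) <-> F 0%N (x - y).
Proof.
move=> Fx Fy; split=> [E|/(f_eqP (n := 1) Fx Fy) E e]; last by rewrite /kap E.
apply/(f_eqP (n := 1) Fx Fy); apply: co_inj => -[u [|a [|b l]]] Pp.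
- by rewrite !(co_deg0 (n := 1)) //; apply: f_deg.
- by have := Pp; rewrite pathb_cons => /andP[/eqP <- _]; apply: E.
by rewrite !(co_deg0 (n := 1)) //; apply: f_deg.
Qed.

Lemma kap_F0 e x : F 0%N x -> kap e x = 0.
Proof.
move=> Fx; have F00 := subspace0 (sF 0).
have E : F 0%N (x - 0) by rewrite subr0.
rewrite (proj2 (kapP (F0_F1 Fx) (F0_F1 F00)) E); rewrite /kap.
have -> : f 1 0 = 0 by apply/f_ker; [exact: F0_F1 | exact: F00].
exact: (islinf0 (islinf_co _)).
Qed.

Let Psrc e : Defs.pathb s' t' (s' e, [:: e]).
Proof. by rewrite pathb_cons eqxx. Qed.

(** The coefficient of vertex tensor arrow in the coproduct of [f 1 x] is computed by concatenation
    and from a tagged representative. Tag 0 contributes the contraction by [dl]; tag 1 contributes 0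
    on both sides. *)
Lemma kap_ract e g x : F 1%N x ->
  kap e (ract (dl (val (g : glT))) x) = (t' e == fv g)%:R * kap e x.
Proof.
move=> Fx; have [sl [Hsl E Es]] := f_pcop (fv g, [::]) (s' e, [:: e]) Fx.
apply: etrans _ (esym (Es isT (Psrc e))).
rewrite (ractE (ldl _) E) big_map kap_sum; last first.
  by move=> i /Hsl[]; case: (i.1) => [|[|]] // _ _; apply: F0_F1.
apply: eq_big_seq => i /Hsl[]; case: (i.1) => [|[|]] // _ F1 F2.
  by rewrite co_f0.
rewrite kap_F0 // mulr0 (co_deg0 (n := 1)) ?mul0r //; exact: f_deg.
Qed.

Lemma kap_hit e g x : F 1%N x ->
  kap e (hit (dl (val (g : glT))) x) = (s' e == fv g)%:R * kap e x.
Proof.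
move=> Fx; have [sl [Hsl E Es]] := f_pcop (s' e, [:: e]) (fv g, [::]) Fx.
have -> : (s' e == fv g)%:R * kap e x = (Defs.pend t' (fv g, [::]) == s' e)%:R * co (f 1 x)
  (fv g, [:: e]).
  rewrite /Defs.pend /= eq_sym /kap; have [->|_] := eqVneq (fv g) (s' e) => //.
  by rewrite !mul0r.
apply: etrans _ (esym (Es (Psrc e) isT)).
rewrite (hitE (ldl _) E) big_map kap_sum; last first.
  by move=> i /Hsl[]; case: (i.1) => [|[|]] // _ + _; apply: F0_F1.
apply: eq_big_seq => i /Hsl[]; case: (i.1) => [|[|]] // _ F1 F2.
  rewrite kap_F0 // mulr0 [X in _ * X](co_deg0 (n := 1)) ?mulr0 //; exact: f_deg.
by rewrite co_f0 // mulrC.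
Qed.

Lemma sprim_kap e g h x : sprim (val (g : glT)) (val (h : glT)) x -> kap e x != 0 ->
  s' e = fv h /\ t' e = fv g.
Proof.
move=> Hx; have [Fx Hx'] := Hx.
have [_ Hr] := Hx' _ (ldl (val g)); have [Hh _] := Hx' _ (ldl (val h)).
rewrite dlE ?eqxx ?scale1r in Hr; [|exact: glP|exact: glP].
rewrite dlE ?eqxx ?scale1r in Hh; [|exact: glP|exact: glP].
have Fr : F 1%N (ract (dl (val g)) x) by apply: (@Fs_ract _ _ _ _ Hc Hp 2).
have Fh : F 1%N (hit (dl (val h)) x) by apply: (@Fs_hit _ _ _ _ Hc Hp 2).
have := proj2 (kapP Fr Fx) Hr e; have := proj2 (kapP Fh Fx) Hh e.
rewrite kap_ract // kap_hit //.
have [->|_] := eqVneq (s' e) (fv h); last by rewrite mul0r => <-; rewrite eqxx.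
have [->|_] := eqVneq (t' e) (fv g) => //; by rewrite mul0r => _ <-; rewrite eqxx.
Qed.

(** Projecting a preimage on the isotypic component multiplies its coordinate on an arrow [a] by the
    test that [a] runs from [fv h] to [fv g]. The image is one arrow passing this test, so it does
    not change. *)
Lemma arrow_preimage e g h : s' e = fv h -> t' e = fv g ->
  exists y, sprim (val g) (val h) y /\ f 1 y = pb' (s' e, [:: e]).
Proof.
move=> se te; have He : deg 1 (pb' (s' e, [:: e])) := @deg_pb k V' E' s' t' (s' e) [:: e].
have [x [Fx Ex]] := f_surj (leqnn 1) He.
pose y := ract (dl (val g)) (hit (dl (val h)) x).
have Hy : sprim (val g) (val h) y.
  exact: (sprim_proj Hc Hp ldl dlE (glP g) (glP h) Fx).
exists y; split => //; rewrite -Ex; apply/(f_eqP (n := 1)) => //; first by case: Hy.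
apply/kapP => // [|a]; first by case: Hy.
rewrite kap_ract; last exact: (@Fs_hit _ _ _ _ Hc Hp 2).
rewrite kap_hit // /kap Ex co_pb // xpair_eqE eqseq_cons andbT.
have [ea|_] := eqVneq e a; first by subst a; rewrite -se -te !eqxx !mul1r.
by rewrite andbF !mulr0.
Qed.

Section Fiber.
Variables g h : glT.
Notation fib := {e : arT | src e = h /\ tgt e = g}.
Notation fib' := {e : E' | s' e = fv h /\ t' e = fv g}.

Lemma fib_sprim (i : fib) : sprim (val g) (val h) (val (proj1_sig i)).
Proof. by case: i => e /= [<- <-]; case: (Bst (arP e)). Qed.

(** The images of the basis arrows are independent because [f 1] is injective modulo [F 0]: a
    relation would yield an element whose coordinate [d (val a)] is both 0 and 1. *)
Lemma fiber_inj_to : exists u : fib -> fib', injective u.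
Proof.
pose b (i : fib) := arrows (f 1 (val (proj1_sig i))).
have bE (y : H) a : (arrows (f 1 y))@_a = kap a y by rewrite arrowsE.
apply: (fiber_inj (b := b)) => [i e|i].
  by rewrite bE; apply: sprim_kap (fib_sprim i).
set a := proj1_sig i.
pose Q z := exists y, [/\ F 1%N y, d (val a) y = 0 & z = arrows (f 1 y)].
have sQ : subspace Q.
  split.
    exists 0; split; [exact: (subspace0 (sF 1)) | exact: (islinf0 (ld _)) |].
    have -> : f 1 0 = 0 by apply/f_ker; [exact: (subspace0 (sF 1)) | exact: (subspace0 (sF 0))].
    by rewrite (islin0 (lin_arrows (t := t'))).
  move=> c _ _ [y [y1 y2 ->]] [y' [y1' y2' ->]]; exists (c *: y + y'); split.
  - by case: (sF 1) => _; apply.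
  - by rewrite ld y2 y2' mulr0 addr0.
  by rewrite f_lin // (lin_arrows (t := t')).
have Fa e : F 1%N (val (e : arT)) := basis_F1 Bst (arP e).
move=> /(spn_sub (Q := Q) sQ) [||y [y1 y2 E]].
- by move=> z ->; exact: (subspace0 sQ).
- move=> z [j [ji ->]]; exists (val (proj1_sig j)); split => //.
  rewrite dB; [|exact: arP|exact: arP].
  rewrite (inj_eq val_inj); case: eqP => // aj; case: ji.
  move: aj; rewrite /a; case: (j) (i) => [e He] [e' He'] /= ee.
  by subst e'; congr exist; exact: Prop_irrelevance.
have := proj1 (kapP (Fa a) y1) (fun e => etrans (esym (bE _ e)) (etrans (congr1
  (fun m => m@_e) E) (bE _ e))).
move=> /(dP (val a)); rewrite (islinfB (ld _)) y2 subr0 dB; [|exact: arP|exact: arP].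
by rewrite eqxx => /eqP; rewrite oner_eq0.
Qed.

(** Homogeneous preimages of the arrows have independent classes, by the same argument with [kap] in
    place of the dual forms. *)
Lemma fiber_inj_from : exists u : fib' -> fib, injective u.
Proof.
have /choice[y Hy] : forall i : fib', exists y, sprim (val g) (val h) y /\
    f 1 y = pb' (s' (proj1_sig i), [:: proj1_sig i]).
  by case=> e [se te]; apply: arrow_preimage.
have Fy i : F 1%N (y i) by case: (Hy i) => -[].
apply: (fiber_inj (b := fun i => cl (y i))) => [i e|i].
  by case: (Hy i) => /sprim_cl H1 _ /H1[].
set a := proj1_sig i.
pose Q z := exists y, [/\ F 1%N y, kap a y = 0 & z = cl y].
have sQ : subspace Q.
  split.
    exists 0; split; [exact: (subspace0 (sF 1)) | exact: (kap_F0 _ (subspace0 (sF 0))) |].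
    by rewrite cl_F0 //; exact: (subspace0 (sF 0)).
  move=> c _ _ [y0 [y1 y2 ->]] [y' [y1' y2' ->]]; exists (c *: y0 + y'); split.
  - by case: (sF 1) => _; apply.
  - by rewrite /kap f_lin // (islinf_co _) -/(kap a y0) -/(kap a y') y2 y2' mulr0 addr0.
  by rewrite cl_lin.
have ky j e : kap e (y j) = (proj1_sig j == e)%:R.
  case: (Hy j) => _ Ej; rewrite /kap Ej co_pb // xpair_eqE eqseq_cons andbT.
  by have [->|_] := eqVneq (proj1_sig j) e; rewrite ?eqxx ?andbF.
move=> /(spn_sub (Q := Q) sQ) [||y0 [y1 y2 E]].
- by move=> z ->; exact: (subspace0 sQ).
- move=> z [j [ji ->]]; exists (y j); split => //.
  rewrite ky; case: eqP => // aj; case: ji.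
  move: aj; rewrite /a; case: (j) (i) => [e He] [e' He'] /= ee.
  by subst e'; congr exist; exact: Prop_irrelevance.
have := proj2 (kapP (Fy i) y1) (proj1 (cl_eqP (Fy i) y1) E) a.
by rewrite ky y2 eqxx => /eqP; rewrite oner_eq0.
Qed.

Lemma fiber_bij : exists u : fib -> fib', bijective u.
Proof.
have [u uI] := fiber_inj_to; have [u' uI'] := fiber_inj_from.
exact: inj_inj_bij uI uI'.
Qed.

End Fiber.

(** The arrows of each quiver are partitioned by their end points, and [fv] is a bijection on
    vertices, so the bijections between fibres glue to a bijection on arrows. *)
Lemma kQ_quiver_iso : quiver_iso src tgt s' t'.
Proof.
pose U g h := proj1_sig (cid (fiber_bij g h)).
have bU g h : bijective (U g h) by rewrite /U; case: cid.
(* Each arrow is evaluated in its own fibre; [feE] allows any other presentation of this fibre,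
   which makes arrows with equal end points comparable. *)
pose fe e := proj1_sig (U (tgt e) (src e) (exist _ e (conj erefl erefl))).
have feE g h e (He : src e = h /\ tgt e = g) : proj1_sig (U g h (exist _ e He)) = fe e.
  by case: He => sh tg'; subst h g.
have feP e : s' (fe e) = fv (src e) /\ t' (fe e) = fv (tgt e).
  by rewrite /fe; case: (U _ _ _).
exists fv, fe; split => //; first exact: fv_bij.
apply: inj_surj_bij => [e1 e2 E|e'].
  have [s1 t1] := feP e1; have [s2 t2] := feP e2; rewrite E in s1 t1.
  have He : src e1 = src e2 /\ tgt e1 = tgt e2.
    by split; apply: fv_inj; [rewrite -s1 -s2 | rewrite -t1 -t2].
  have He2 : src e2 = src e2 /\ tgt e2 = tgt e2 by [].
  have : U _ _ (exist _ e1 He) = U _ _ (exist _ e2 He2).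
    have : proj1_sig (U _ _ (exist _ e1 He)) = proj1_sig (U _ _ (exist _ e2 He2)).
      by rewrite !feE.
    case: (U _ _ _) => a Ha; case: (U _ _ _) => b Hb /= ab; subst b.
    by congr exist; exact: Prop_irrelevance.
  by move=> /(bij_inj (bU _ _)) [].
have [fv' _ fvK] := fv_bij.
pose g := fv' (t' e'); pose h := fv' (s' e').
have He' : s' e' = fv h /\ t' e' = fv g by rewrite /g /h !fvK.
have [u uK Ku] := bU g h.
have := Ku (exist _ e' He'); case: (u _) => e He /(congr1 (@proj1_sig _ _)).
by rewrite feE /= => E; exists e.
Qed.

End Uniqueness.

End SkewPrimitives.

Theorem theorem3p4 (k : fieldType) (H : lmodType k)
    (cop : H -> seq (H * H)) (eps : H -> k) (mul : H -> H -> H) (one : H)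
    (phi phiinv : H -> H -> H -> k) (S : H -> H) (alpha beta : H -> k) :
  is_majid cop eps mul one phi phiinv S alpha beta ->
  pointed cop ->
  exists (V E : choiceType) (s t : E -> V),
    good_quiver cop eps mul one phi phiinv S alpha beta s t /\
    (forall (V' E' : choiceType) (s' t' : E' -> V'),
       good_quiver cop eps mul one phi phiinv S alpha beta s' t' ->
       quiver_iso s t s' t').
Proof.
move=> HM Hp; have Hc := majid_coalgebra HM.
have [dl [ldl dlE]] := gl_dual Hc.
have [B [d [sr [tg [ld dP dB sB Bst]]]]] := arrow_basis Hc Hp ldl dlE.
exists (glT cop), (arT B), (src Bst), (tgt Bst); split.
  split; first exact: (kQ_hopf_quiver HM Hp ld dP dB sB Bst).
  do 7 eexists; split; first exact: (kQ_graded_majid HM Hp ldl dlE ld dP dB sB Bst).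
  eexists; exact: (kQ_gr_embedding HM Hp ldl dlE ld dP dB sB Bst).
move=> V' E' s' t' [_ [mulQ [oneQ [phiQ [phiinvQ [SQ [alphaQ [betaQ [_ [f]]]]]]]]]].
case=> [[f_lin f_hom f_ker] f_surj [f_cop _] _ _].
apply: (kQ_quiver_iso HM Hp ldl dlE ld dP dB sB Bst f_lin) => //.
- by move=> n x Fx; apply/deg_homog; apply: f_hom.
- by move=> n y n1 /deg_homog Hy; apply: f_surj.
Qed.
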